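(* Let $k=s+\frac12$ with $s\in\mathbb Z$, and write $s=12a+b$ with $a\in\mathbb Z$ and $b\in\{6,8,9,10,11,12,13,14,15,16,17,19\}$. There are absolute positive constants $A\le 9$ and $B\le 109$ such that the following holds. Let $m$ be an integer with $m\ge A|a|+B$ and $m\equiv 0,(-1)^{s-1}\pmod 4$, and let $\{f_{2-k,i}\}$ be the canonical basis of $M^!_{2-k}$, indexed by the admissible indices $i$ for weight $2-k$ in increasing order. Then for any integer $M>3a+\frac{3m}4+\frac b2-C$, it is impossible that the Fourier coefficients of $q^m$ in each of the first $M$ basis elements $f_{2-k,i}$ with $i\not\equiv m\pmod 4$ simultaneously vanish.
   Context: Let $q=e^{2\pi i\tau}$ and $\vartheta(\tau)=\sum_{n\in\mathbb Z}q^{n^2}$. For a weight $\kappa=t+\frac12$, $t\in\mathbb Z$, $M^!_\kappa$ is the space of holomorphic functions on the upper half plane, possibly with poles at the cusps, transforming like $\vartheta^{2\kappa}$ under $\Gamma_0(4)$ and satisfying Kohnen's plus space condition (Fourier expansion $\sum_{(-1)^tn\equiv0,1\,(4)}a(n)q^n$). Write $t=6\ell+\frac{k'}2$ with $\ell\in\mathbb Z$, $k'\in\{0,4,6,8,10,14\}$; let $N_\kappa=2\ell$ if $\ell$ is even and $N_\kappa=2\ell-(-1)^t$ if $\ell$ is odd. An integer $i$ is an admissible index for weight $\kappa$ if $i\ge -N_\kappa$ and $(-1)^{t-1}i\equiv0,1\pmod4$; for each such $i$ the canonical basis element is $f_{\kappa,i}(\tau)=q^{-i}+\sum_{n>N_\kappa,\,(-1)^tn\equiv0,1\,(4)}a_\kappa(i,n)q^n\in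 M^!_\kappa$, and these form a basis of $M^!_\kappa$. The constant $C$ is: $C=1$ if $m$ and $b$ are even; $C=\frac32$ if $m$ is even and $b$ odd; $C=\frac34$ if $m$ is odd and $b\in\{6,8,9,10,11,13\}$; $C=\frac74$ if $m$ is odd and $b\in\{12,14,15,16,17,19\}$. *)

(* Defs.v *)
From Stdlib Require Import Reals ZArith List.
From Coquelicot Require Export Coquelicot.
Open Scope R_scope.

Definition Cexp (z : C) : C :=
  (exp (Re z) * cos (Im z), exp (Re z) * sin (Im z)).

Definition qpow (tau : C) (n : Z) : C :=
  Cexp (Cmult (Cmult (RtoC (2 * PI * IZR n)) Ci) tau).

(* theta(tau) = sum_{n in Z} q^{n^2} = 1 + 2 sum_{k >= 1} q^{k^2} *)
Definition theta (tau : C) : C :=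
  (1 + 2 * Series (fun k : nat => Re (qpow tau (Z.of_nat (S k) * Z.of_nat (S k)))),
   2 * Series (fun k : nat => Im (qpow tau (Z.of_nat (S k) * Z.of_nat (S k))))).

Definition Czpow (z : C) (n : Z) : C :=
  match n with
  | Z0 => RtoC 1
  | Zpos p => Cpow z (Pos.to_nat p)
  | Zneg p => Cinv (Cpow z (Pos.to_nat p))
  end.

Definition mobius (a b c d : Z) (tau : C) : C :=
  Cdiv (Cplus (Cmult (RtoC (IZR a)) tau) (RtoC (IZR b)))
       (Cplus (Cmult (RtoC (IZR c)) tau) (RtoC (IZR d))).

Definition in_Gamma0_4 (a b c d : Z) : Prop :=
  (a * d - b * c = 1)%Z /\ (4 | c)%Z.

(* Fourier coefficient of q^n of a 1-periodic function, computed on Im tau = 1 *)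
Definition fcoef (f : C -> C) (n : Z) : C :=
  RInt (V := C_R_CompleteNormedModule)
    (fun x : R => Cmult (f (x, 1)) (qpow (x, 1) (- n))) 0 1.

Definition plus_okb (t n : Z) : bool :=
  let r := ((if Z.even t then n else - n) mod 4)%Z in
  (Z.eqb r 0 || Z.eqb r 1)%bool.

(* weight kappa = t + 1/2 *)
Definition holo_on_H (f : C -> C) : Prop :=
  forall tau : C, 0 < Im tau -> ex_derive (K := C_AbsRing) (V := C_NormedModule) f tau.

Definition transforms_like_theta (t : Z) (f : C -> C) : Prop :=
  forall a b c d : Z, in_Gamma0_4 a b c d ->
  forall tau : C, 0 < Im tau ->
    f (mobius a b c d tau) =
    Cmult (Czpow (Cdiv (theta (mobius a b c d tau)) (theta tau)) (2 * t + 1)) (f tau).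

(* meromorphic (at worst poles) at every cusp: for every gamma in SL2(Z),
   |(c tau + d)^{-kappa} f(gamma tau)| = O(exp(N Im tau)) as Im tau -> oo *)
Definition poles_at_cusps (t : Z) (f : C -> C) : Prop :=
  forall a b c d : Z, (a * d - b * c = 1)%Z ->
  exists K N : R, forall tau : C, 1 <= Im tau ->
    Cmod (f (mobius a b c d tau)) <=
    K * exp (N * Im tau) *
    Rpower (Cmod (Cplus (Cmult (RtoC (IZR c)) tau) (RtoC (IZR d)))) (IZR t + / 2).

Definition plus_space (t : Z) (f : C -> C) : Prop :=
  forall n : Z, plus_okb t n = false -> fcoef f n = RtoC 0.

Definition in_Mshriek (t : Z) (f : C -> C) : Prop :=
  holo_on_H f /\ transforms_like_theta t f /\ poles_at_cusps t f /\ plus_space t f.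

(* t = 6 l + k'/2, k'/2 in {0,2,3,4,5,7} *)
Definition kp_half (t : Z) : Z :=
  match (t mod 6)%Z with
  | 1%Z => 7%Z
  | r => r
  end.
Definition ell (t : Z) : Z := ((t - kp_half t) / 6)%Z.
Definition Nk (t : Z) : Z :=
  if Z.even (ell t) then (2 * ell t)%Z
  else (2 * ell t - (if Z.even t then 1 else -1))%Z.

Definition admissibleb (t i : Z) : bool :=
  (Z.leb (- Nk t) i && plus_okb (t - 1) i)%bool.

Definition canonical (t i : Z) (f : C -> C) : Prop :=
  in_Mshriek t f /\ fcoef f (- i) = RtoC 1 /\
  forall n : Z, (n <= Nk t)%Z -> n <> (- i)%Z -> fcoef f n = RtoC 0.

Definition qualb (t m j : Z) : bool :=
  (admissibleb t j && negb (Z.eqb (j mod 4) (m mod 4)))%bool.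

(* number of qualifying indices strictly smaller than i (0-based position) *)
Definition rank (t m i : Z) : nat :=
  length (filter (fun k : nat => qualb t m (- Nk t + Z.of_nat k)%Z)
                 (seq 0 (Z.to_nat (i + Nk t)))).

Definition Cconst (m b : Z) : R :=
  if Z.even m then (if Z.even b then 1 else 3 / 2)
  else (if existsb (Z.eqb b) (6 :: 8 :: 9 :: 10 :: 11 :: 13 :: nil)%Z then 3 / 4 else 7 / 4).

Definition b_range : list Z := (6 :: 8 :: 9 :: 10 :: 11 :: 12 :: 13 :: 14 :: 15 :: 16 :: 17 :: 19 :: nil)%Z.

(* Main.v *)
(* Let [f] be a form of weight [t + 1/2] in the plus space, and let [u], [v] be the parts of [f]
   supported on even and on odd exponents. Then [(u (z / 4), v (z / 4))] transforms under
   [z |-> z + 1] and [z |-> -1 / z] like the [(2 t + 1)]-st power of the theta vector, so its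
   Wronskian [W] is a form of level one. If the expansions of [u] and [v] start at [A] and [B] with
   [2 t + 3 < 3 (A + B)], then [W ^ 12] divided by a power of the discriminant form has weight zero
   and vanishes at the cusp, hence [W = 0]. As the leading coefficient of [W] is a nonzero multiple
   of the product of those of [u] and [v], such an [f] is zero.
   This is applied to a combination of the basis elements of indices [i0, i0 + 4, ..., i0 + 4 L],
   where [i0] is the first index of parity opposite to [m]. Linear algebra makes the [L]
   coefficients at the exponents below [m] of the parity of [m] vanish; if each element also has
   coefficient zero at [m], the combination violates the estimate. *)
Require Import Defs.
From Stdlib Require Import Reals ZArith List Lra Lia Classical IndefiniteDescription.
From Coquelicot Require Import Coquelicot.
Open Scope R_scope.

(** * Complex numbers *)

Lemma im_le_Cmod (z : C) : Rabs (Im z) <= Cmod z.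
Proof. eapply Rle_trans; [apply Rmax_r|apply Rmax_Cmod]. Qed.

Lemma Cmod_le_re_im (z : C) : Cmod z <= Rabs (Re z) + Rabs (Im z).
Proof.
  destruct z as [x y].
  replace ((x, y) : C) with (RtoC x + RtoC y * Ci)%C
    by (apply injective_projections; simpl; ring).
  eapply Rle_trans; [apply Cmod_triangle|].
  rewrite Cmod_mult, Cmod_Ci, !Cmod_R. simpl.
  replace (x + (y * 0 - 0 * 1)) with x by ring.
  replace (0 + (y * 1 + 0 * 0)) with y by ring. lra.
Qed.

Lemma Cmod_triangle_minus (a b : C) : Cmod (a - b) <= Cmod a + Cmod b.
Proof. rewrite <- (Cmod_opp b). apply Cmod_triangle. Qed.

Lemma Cmod_triangle_rev (a b : C) : Cmod a - Cmod b <= Cmod (a - b).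
Proof.
  assert (H := Cmod_triangle (a - b) b).
  replace (a - b + b)%C with a in H by ring. lra.
Qed.

Lemma Cmod_minus_sym (a b : C) : Cmod (a - b) = Cmod (b - a).
Proof. rewrite <- Cmod_opp. f_equal. ring. Qed.

Lemma Ceq_of_Cmod_le (a b : C) : (forall eps, 0 < eps -> Cmod (a - b) <= eps) -> a = b.
Proof.
  intros H. apply Ceq_minus, Cmod_eq_0, Rle_antisym; [|apply Cmod_ge_0].
  apply Rnot_lt_le. intros h. specialize (H (Cmod (a - b) / 2)). lra.
Qed.

Lemma Cmult_integral (a b : C) : (a * b)%C = RtoC 0 -> a = RtoC 0 \/ b = RtoC 0.
Proof.
  intros H. apply NNPP. intros N. apply not_or_and in N.
  apply (Cmult_neq_0 a b); tauto.
Qed.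

Lemma RtoC_neq_0 (r : R) : r <> 0 -> RtoC r <> RtoC 0.
Proof. intros H E. apply H, RtoC_inj, E. Qed.

Lemma Cconj_neq_0 (z : C) : z <> RtoC 0 -> Cconj z <> RtoC 0.
Proof. rewrite !Cmod_gt_0, Cmod_conj. auto. Qed.

Lemma Ci_sqr : (Ci * Ci)%C = RtoC (-1).
Proof. apply injective_projections; simpl; ring. Qed.

Lemma Im_plus_R (z : C) (r : R) : Im (z + RtoC r) = Im z.
Proof. destruct z. simpl. ring. Qed.

(** * Continuity and differentiability of complex functions *)

Notation ccontinuous := (continuous (U := C_UniformSpace)).
Notation is_cderive := (is_derive (K := C_AbsRing) (V := C_NormedModule)).
Notation ex_cderive := (ex_derive (K := C_AbsRing) (V := C_NormedModule)).

Lemma locally_Cmod (z : C) (P : C -> Prop) :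
  locally z P <-> exists d, 0 < d /\ forall w, Cmod (w - z) < d -> P w.
Proof.
  rewrite locally_C. split.
  - intros [d Hd]. exists d. split; [apply cond_pos|]. intros w Hw. apply Hd. exact Hw.
  - intros [d [Hd H]]. exists (mkposreal d Hd). intros w Hw. apply H. exact Hw.
Qed.

Lemma ccontinuous_Cmod {T : UniformSpace} (f : T -> C) (x : T) :
  ccontinuous f x <-> forall eps, 0 < eps -> locally x (fun u => Cmod (f u - f x) < eps).
Proof.
  split.
  - intros H eps He. apply (H (fun w => Cmod (w - f x) < eps)), locally_Cmod. exists eps. auto.
  - intros H P HP. apply locally_Cmod in HP. destruct HP as [d [Hd HP]].
    unfold filtermap. generalize (H d Hd). apply filter_imp. auto.
Qed.

Lemma continuous_Cmod {T : UniformSpace} (f : T -> C) (x : T) :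
  ccontinuous f x -> continuous (fun u => Cmod (f u)) x.
Proof.
  intros H. apply filterlim_locally. intros eps.
  generalize (proj1 (ccontinuous_Cmod f x) H eps (cond_pos eps)). apply filter_imp. intros u Hu.
  assert (Hfu := Cmod_triangle_rev (f u) (f x)). assert (Hfx := Cmod_triangle_rev (f x) (f u)).
  rewrite Cmod_minus_sym in Hfx. change (Rabs (Cmod (f u) - Cmod (f x)) < eps).
  apply Rabs_def1; lra.
Qed.

Lemma ccontinuous_AbsRing {T : UniformSpace} (f : T -> C) (x : T) :
  continuous (U := AbsRing_UniformSpace C_AbsRing) f x <-> ccontinuous f x.
Proof. split; intros H P HP; apply H, locally_C, HP. Qed.

Lemma ccontinuous_ext_loc {T : UniformSpace} (f g : T -> C) (x : T) :
  locally x (fun y => f y = g y) -> ccontinuous f x -> ccontinuous g x.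
Proof. apply continuous_ext_loc. Qed.

Lemma ccontinuous_plus {T : UniformSpace} (f g : T -> C) (x : T) :
  ccontinuous f x -> ccontinuous g x -> ccontinuous (fun u => f u + g u)%C x.
Proof. apply (continuous_plus (V := C_NormedModule)). Qed.

Lemma ccontinuous_minus {T : UniformSpace} (f g : T -> C) (x : T) :
  ccontinuous f x -> ccontinuous g x -> ccontinuous (fun u => f u - g u)%C x.
Proof. apply (continuous_minus (V := C_NormedModule)). Qed.

Lemma ccontinuous_mult {T : UniformSpace} (f g : T -> C) (x : T) :
  ccontinuous f x -> ccontinuous g x -> ccontinuous (fun u => f u * g u)%C x.
Proof. rewrite <- !ccontinuous_AbsRing. apply (continuous_mult (K := C_AbsRing)). Qed.

Lemma ccontinuous_RtoC (x : R) : ccontinuous RtoC x.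
Proof.
  apply ccontinuous_Cmod. intros eps He. exists (mkposreal eps He). intros u Hu.
  rewrite <- RtoC_minus, Cmod_R. exact Hu.
Qed.

Lemma ccontinuous_line (f : C -> C) (z d : C) (x : R) :
  ccontinuous f (z + RtoC x * d)%C -> ccontinuous (fun u : R => f (z + RtoC u * d)%C) x.
Proof.
  intros H. apply (continuous_comp (fun u : R => (z + RtoC u * d)%C) f); [|exact H].
  apply ccontinuous_plus; [apply continuous_const|].
  apply ccontinuous_mult; [apply ccontinuous_RtoC|apply continuous_const].
Qed.

Lemma is_cderive_AbsRing (f : C -> C) (z l : C) :
  is_derive (K := C_AbsRing) (V := AbsRing_NormedModule C_AbsRing) f z l <-> is_cderive f z l.
Proof.
  split; intros [[Hp Hs [M HM]] Hd];
    (split; [split; [exact Hp|exact Hs|exists M; exact HM]|exact Hd]).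
Qed.

Lemma is_cderive_Cmod (f : C -> C) (z l : C) :
  is_cderive f z l <->
  forall eps, 0 < eps ->
    locally z (fun w => Cmod (f w - f z - l * (w - z)) <= eps * Cmod (w - z)).
Proof.
  assert (E : forall w, minus (minus (f w) (f z)) (scal (minus w z) l)
                        = (f w - f z - l * (w - z))%C).
  { intros w. unfold minus, plus, opp, scal; simpl. unfold mult; simpl. ring. }
  split.
  - intros [_ H] eps He. apply locally_C.
    generalize (H z (fun P HP => HP) (mkposreal eps He)). apply filter_imp.
    intros w Hw. rewrite <- E. exact Hw.
  - intros H. split; [apply is_linear_scal_l|]. intros y Hy.
    apply (is_filter_lim_locally_unique (V := AbsRing_NormedModule C_AbsRing)) in Hy. subst y.
    intros eps. generalize (proj1 (locally_C _ _) (H eps (cond_pos eps))). apply filter_imp.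
    intros w Hw. rewrite <- E in Hw. exact Hw.
Qed.

Lemma ex_cderive_continuous (f : C -> C) (z : C) : ex_cderive f z -> ccontinuous f z.
Proof.
  intros H P HP. apply locally_C.
  exact (ex_derive_continuous (K := C_AbsRing) (V := C_NormedModule) f z H P HP).
Qed.

Lemma is_cderive_eq (f : C -> C) (z a b : C) : is_cderive f z a -> a = b -> is_cderive f z b.
Proof. intros H <-. exact H. Qed.

Lemma is_cderive_const (c z : C) : is_cderive (fun _ => c) z (RtoC 0).
Proof. apply (is_derive_const (K := C_AbsRing) (V := C_NormedModule)). Qed.

Lemma is_cderive_id (z : C) : is_cderive (fun w => w) z (RtoC 1).
Proof. apply is_cderive_AbsRing, (is_derive_id (K := C_AbsRing)). Qed.

Lemma is_cderive_plus (f g : C -> C) (z a b : C) :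
  is_cderive f z a -> is_cderive g z b -> is_cderive (fun w => f w + g w)%C z (a + b)%C.
Proof. apply (is_derive_plus (K := C_AbsRing) (V := C_NormedModule)). Qed.

Lemma is_cderive_mult (f g : C -> C) (z a b : C) :
  is_cderive f z a -> is_cderive g z b ->
  is_cderive (fun w => f w * g w)%C z (a * g z + f z * b)%C.
Proof.
  rewrite <- !is_cderive_AbsRing. intros Hf Hg.
  apply (is_derive_mult (K := C_AbsRing) f g); auto. intros; apply Cmult_comm.
Qed.

Lemma is_cderive_scal (c : C) (f : C -> C) (z a : C) :
  is_cderive f z a -> is_cderive (fun w => c * f w)%C z (c * a)%C.
Proof.
  intros H. apply is_cderive_eq with (RtoC 0 * f z + c * a)%C; [|ring].
  apply (is_cderive_mult (fun _ => c)); auto. apply is_cderive_const.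
Qed.

Lemma is_cderive_affine (a b z : C) : is_cderive (fun w => a * w + b)%C z a.
Proof.
  apply is_cderive_eq with (a * RtoC 1 + RtoC 0)%C; [|ring].
  apply is_cderive_plus; [apply is_cderive_scal, is_cderive_id|apply is_cderive_const].
Qed.

Lemma is_cderive_comp (f g : C -> C) (z a b : C) :
  is_cderive f (g z) a -> is_cderive g z b -> is_cderive (fun w => f (g w)) z (a * b)%C.
Proof.
  rewrite <- (is_cderive_AbsRing g), Cmult_comm.
  apply (is_derive_comp (K := C_AbsRing) (V := C_NormedModule)).
Qed.

Lemma is_cderive_Cinv (z : C) : z <> RtoC 0 -> is_cderive Cinv z (- / (z * z))%C.
Proof.
  intros Nz. assert (Pz := proj1 (Cmod_gt_0 z) Nz). set (m := Cmod z) in *.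
  assert (Pm : 0 < m * m * m) by (repeat apply Rmult_lt_0_compat; lra).
  apply is_cderive_Cmod. intros eps He. apply locally_Cmod.
  exists (Rmin (m / 2) (eps * (m * m * m) / 2)).
  split; [apply Rmin_pos; [lra|apply Rdiv_lt_0_compat; nra]|]. intros w Hw.
  assert (Hw_half := Rlt_le_trans _ _ _ Hw (Rmin_l _ _)).
  assert (Hw_eps := Rlt_le_trans _ _ _ Hw (Rmin_r _ _)).
  assert (Hmw : m / 2 < Cmod w).
  { rewrite Cmod_minus_sym in Hw_half. assert (Htri := Cmod_triangle_rev z w). fold m in Htri.
    lra. }
  assert (Nw : w <> RtoC 0) by (apply Cmod_gt_0; lra).
  replace (/ w - / z - - / (z * z) * (w - z))%C with ((w - z) * ((w - z) / (w * (z * z))))%C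
    by (field; auto).
  rewrite Cmod_mult, Rmult_comm. apply Rmult_le_compat_r; [apply Cmod_ge_0|].
  rewrite Cmod_div, !Cmod_mult by (repeat apply Cmult_neq_0; auto). fold m.
  apply Rmult_le_reg_r with (Cmod w * (m * m)); [apply Rmult_lt_0_compat; nra|].
  unfold Rdiv. rewrite Rmult_assoc, Rinv_l by (apply Rgt_not_eq, Rmult_lt_0_compat; nra).
  assert (m / 2 * (m * m) <= Cmod w * (m * m)) by (apply Rmult_le_compat_r; nra). nra.
Qed.

Lemma ccontinuous_div {T : UniformSpace} (f g : T -> C) (x : T) :
  ccontinuous f x -> ccontinuous g x -> g x <> RtoC 0 -> ccontinuous (fun u => f u / g u)%C x.
Proof.
  intros Hf Hg Nx. apply ccontinuous_mult; auto. apply (continuous_comp g Cinv); auto.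
  apply ex_cderive_continuous. eexists. apply is_cderive_Cinv, Nx.
Qed.

Lemma ex_cderive_mult (f g : C -> C) (z : C) :
  ex_cderive f z -> ex_cderive g z -> ex_cderive (fun w => f w * g w)%C z.
Proof. intros [a Ha] [b Hb]. eexists. apply is_cderive_mult; eauto. Qed.

Lemma ex_cderive_comp (f g : C -> C) (z : C) :
  ex_cderive f (g z) -> ex_cderive g z -> ex_cderive (fun w => f (g w)) z.
Proof. intros [a Ha] [b Hb]. eexists. apply is_cderive_comp; eauto. Qed.

Lemma ex_cderive_pow (f : C -> C) (z : C) (n : nat) :
  ex_cderive f z -> ex_cderive (fun w => f w ^ n)%C z.
Proof.
  intros H. induction n as [|n IH].
  - exists (RtoC 0). apply (is_cderive_const (RtoC 1)).
  - apply (ex_cderive_mult f (fun w => f w ^ n)%C); auto.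
Qed.

Lemma is_derive_C_R_Cmod (f : R -> C) (x : R) (l : C) :
  is_derive (V := C_R_NormedModule) f x l <->
  forall eps, 0 < eps ->
    locally x (fun u => Cmod (f u - f x - l * RtoC (u - x)) <= eps * Rabs (u - x)).
Proof.
  assert (E : forall u : R, norm (V := C_R_NormedModule)
      (minus (minus (f u) (f x)) (scal (minus u x) l)) = Cmod (f u - f x - l * RtoC (u - x))).
  { intros u. rewrite <- Cmod_norm, scal_R_Cmult. f_equal. unfold minus at 1 2, plus, opp; simpl.
    change (minus u x) with (u - x). unfold Cminus. rewrite (Cmult_comm l). reflexivity. }
  split.
  - intros [_ H] eps He.
    generalize (H x (fun P HP => HP) (mkposreal eps He)). apply filter_imp.
    intros u Hu. rewrite <- E. exact Hu.
  - intros H. split; [apply is_linear_scal_l|]. intros y Hy.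
    apply (is_filter_lim_locally_unique (V := R_NormedModule)) in Hy. subst y.
    intros eps. generalize (H eps (cond_pos eps)). apply filter_imp.
    intros u Hu. rewrite <- E in Hu. exact Hu.
Qed.

Lemma is_derive_line (F : C -> C) (z d l : C) (x : R) :
  is_cderive F (z + RtoC x * d)%C l ->
  is_derive (V := C_R_NormedModule) (fun u : R => F (z + RtoC u * d)%C) x (l * d)%C.
Proof.
  intros H. apply is_derive_C_R_Cmod. intros eps He. assert (Pd := Cmod_ge_0 d).
  assert (He' : 0 < eps / (Cmod d + 1)) by (apply Rdiv_lt_0_compat; lra).
  assert (Hline : ccontinuous (fun u : R => (z + RtoC u * d)%C) x).
  { apply (ccontinuous_line (fun w => w)), continuous_id. }
  generalize (Hline _ (proj1 (is_cderive_Cmod _ _ _) H _ He')). unfold filtermap.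
  apply filter_imp. intros u Hu.
  replace (z + RtoC u * d - (z + RtoC x * d))%C with (d * RtoC (u - x))%C in Hu
    by (rewrite RtoC_minus; ring).
  rewrite Cmult_assoc in Hu. eapply Rle_trans; [exact Hu|].
  rewrite Cmod_mult, Cmod_R, <- Rmult_assoc. apply Rmult_le_compat_r; [apply Rabs_pos|].
  apply Rmult_le_reg_r with (Cmod d + 1); [lra|].
  replace (eps / (Cmod d + 1) * Cmod d * (Cmod d + 1)) with (eps * Cmod d) by (field; lra). nra.
Qed.

(** * Integrals of complex-valued functions *)

Notation is_CInt := (is_RInt (V := C_R_CompleteNormedModule)).
Notation ex_CInt := (ex_RInt (V := C_R_CompleteNormedModule)).

Definition CInt (f : R -> C) (a b : R) : C := RInt (V := C_R_CompleteNormedModule) f a b.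

Lemma CInt_unique (f : R -> C) (a b : R) (l : C) : is_CInt f a b l -> CInt f a b = l.
Proof. apply (is_RInt_unique (V := C_R_CompleteNormedModule)). Qed.

Lemma CInt_correct (f : R -> C) (a b : R) : ex_CInt f a b -> is_CInt f a b (CInt f a b).
Proof. apply (RInt_correct (V := C_R_CompleteNormedModule)). Qed.

Lemma ex_CInt_continuous (f : R -> C) (a b : R) : (forall x, ccontinuous f x) -> ex_CInt f a b.
Proof. intros H. apply ex_RInt_continuous. intros x _. apply H. Qed.

Lemma CInt_ext (f g : R -> C) (a b : R) : (forall x, f x = g x) -> CInt f a b = CInt g a b.
Proof. intros H. apply (RInt_ext (V := C_R_CompleteNormedModule)). auto. Qed.

Lemma ccontinuous_translate (f : R -> C) (h x : R) :
  ccontinuous f (x + h) -> ccontinuous (fun u => f (u + h)%R) x.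
Proof.
  apply (continuous_comp (fun u => u + h) f).
  apply (continuous_plus (V := R_NormedModule)); [apply continuous_id|apply continuous_const].
Qed.

Lemma Cmod_is_CInt_le (f : R -> C) (a b M : R) (l : C) : a <= b -> is_CInt f a b l ->
  (forall x, a <= x <= b -> Cmod (f x) <= M) -> Cmod l <= (b - a) * M.
Proof.
  intros Hab Hf HM. rewrite Cmod_norm.
  apply (norm_RInt_le_const (V := C_R_CompleteNormedModule) f a b); [exact Hab| |exact Hf].
  intros x Hx. etransitivity; [right; symmetry; apply Cmod_norm|auto].
Qed.

Lemma Cmod_CInt_le (f : R -> C) (a b M : R) : a <= b -> ex_CInt f a b ->
  (forall x, a <= x <= b -> Cmod (f x) <= M) -> Cmod (CInt f a b) <= (b - a) * M.
Proof. intros Hab Hf. apply Cmod_is_CInt_le; [exact Hab|apply CInt_correct, Hf]. Qed.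

Lemma is_CInt_scal (c : C) (f : R -> C) (a b : R) (l : C) :
  is_CInt f a b l -> is_CInt (fun x => c * f x)%C a b (c * l)%C.
Proof.
  intros H.
  assert (Hre := is_RInt_fct_extend_fst (U := R_NormedModule) (V := R_NormedModule) f a b l H).
  assert (Him := is_RInt_fct_extend_snd (U := R_NormedModule) (V := R_NormedModule) f a b l H).
  destruct c as [p q], l as [u v]. simpl in Hre, Him.
  apply (is_RInt_fct_extend_pair (U := R_NormedModule) (V := R_NormedModule)); simpl.
  - apply (is_RInt_minus (V := R_NormedModule)); apply (is_RInt_scal (V := R_NormedModule)); auto.
  - apply (is_RInt_plus (V := R_NormedModule)); apply (is_RInt_scal (V := R_NormedModule)); auto.
Qed.

Lemma CInt_scal (c : C) (f : R -> C) (a b : R) :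
  ex_CInt f a b -> CInt (fun x => c * f x)%C a b = (c * CInt f a b)%C.
Proof.
  intros H. apply CInt_unique, is_CInt_scal.
  apply CInt_correct, H.
Qed.

Lemma CInt_plus (f g : R -> C) (a b : R) : ex_CInt f a b -> ex_CInt g a b ->
  CInt (fun x => f x + g x)%C a b = (CInt f a b + CInt g a b)%C.
Proof. apply (RInt_plus (V := C_R_CompleteNormedModule)). Qed.

Lemma CInt_minus (f g : R -> C) (a b : R) : ex_CInt f a b -> ex_CInt g a b ->
  CInt (fun x => f x - g x)%C a b = (CInt f a b - CInt g a b)%C.
Proof. apply (RInt_minus (V := C_R_CompleteNormedModule)). Qed.

Lemma CInt_Chasles (f : R -> C) (a b c : R) : ex_CInt f a b -> ex_CInt f b c ->
  (CInt f a b + CInt f b c)%C = CInt f a c.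
Proof. apply (RInt_Chasles (V := C_R_CompleteNormedModule)). Qed.

Lemma is_CInt_const (c : C) (a b : R) : is_CInt (fun _ => c) a b (RtoC (b - a) * c)%C.
Proof. rewrite <- scal_R_Cmult. apply (is_RInt_const (V := C_R_NormedModule)). Qed.

Lemma CInt_const (c : C) (a b : R) : CInt (fun _ => c) a b = (RtoC (b - a) * c)%C.
Proof. apply CInt_unique, is_CInt_const. Qed.

Lemma CInt_comp_lin (f : R -> C) (u v a b : R) :
  u <> 0 -> ex_CInt f (u * a + v) (u * b + v) ->
  CInt (fun x => f (u * x + v)%R) a b = (RtoC (/ u) * CInt f (u * a + v) (u * b + v))%C.
Proof.
  intros Hu Hf. apply CInt_unique.
  apply (is_RInt_ext (V := C_R_NormedModule)
           (fun x => RtoC (/ u) * scal (V := C_R_NormedModule) u (f (u * x + v)%R))%C).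
  { intros x _. rewrite scal_R_Cmult, Cmult_assoc, <- RtoC_mult, Rinv_l by auto. apply Cmult_1_l. }
  apply is_CInt_scal, (is_RInt_comp_lin (V := C_R_NormedModule)).
  apply CInt_correct, Hf.
Qed.

Lemma CInt_translate (f : R -> C) (h a b : R) : ex_CInt f (a + h) (b + h) ->
  CInt (fun x => f (x + h)%R) a b = CInt f (a + h) (b + h).
Proof.
  intros H. rewrite <- (Rmult_1_l a), <- (Rmult_1_l b) in H.
  etransitivity; [|etransitivity; [apply (CInt_comp_lin f 1 h a b R1_neq_R0 H)|]].
  - apply CInt_ext. intros x. rewrite Rmult_1_l. reflexivity.
  - rewrite Rinv_1, !Rmult_1_l, Cmult_1_l. reflexivity.
Qed.

Lemma is_CInt_cderive_line (F f : C -> C) (z d : C) (a b : R) :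
  (forall x, is_cderive F (z + RtoC x * d)%C (f (z + RtoC x * d)%C)) ->
  (forall x, ccontinuous f (z + RtoC x * d)%C) ->
  is_CInt (fun x => f (z + RtoC x * d) * d)%C a b
    (F (z + RtoC b * d) - F (z + RtoC a * d))%C.
Proof.
  intros HF Hf.
  apply (is_RInt_derive (V := C_R_CompleteNormedModule) (fun x => F (z + RtoC x * d)%C)).
  - intros x _. apply is_derive_line, HF.
  - intros x _. apply ccontinuous_mult; [apply ccontinuous_line, Hf|apply continuous_const].
Qed.

(** * The complex exponential *)

Lemma Cexp_plus (a b : C) : Cexp (a + b) = (Cexp a * Cexp b)%C.
Proof.
  destruct a as [x y], b as [u v]. unfold Cexp. simpl.
  rewrite exp_plus, cos_plus, sin_plus. apply injective_projections; simpl; ring.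
Qed.

Lemma Cexp_0 : Cexp (RtoC 0) = RtoC 1.
Proof.
  unfold Cexp. simpl. rewrite exp_0, cos_0, sin_0. apply injective_projections; simpl; ring.
Qed.

Lemma Cmod_Cexp (z : C) : Cmod (Cexp z) = exp (Re z).
Proof.
  unfold Cexp, Cmod. simpl.
  replace (_ + _) with (exp (Re z) * exp (Re z) * (Rsqr (sin (Im z)) + Rsqr (cos (Im z))))
    by (unfold Rsqr; ring).
  rewrite sin2_cos2, Rmult_1_r. apply sqrt_square. left. apply exp_pos.
Qed.

Lemma Cexp_Cconj (z : C) : Cexp (Cconj z) = Cconj (Cexp z).
Proof.
  destruct z. unfold Cexp, Cconj. simpl. rewrite cos_neg, sin_neg.
  apply injective_projections; simpl; ring.
Qed.

Lemma exp_le (x y : R) : x <= y -> exp x <= exp y.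
Proof. intros [H| ->]; [left; apply exp_increasing; auto|right; auto]. Qed.

Lemma exp_mult_INR (a : R) (n : nat) : exp (a * INR n) = exp a ^ n.
Proof.
  induction n as [|n IH]; [simpl; rewrite Rmult_0_r; apply exp_0|].
  rewrite S_INR. simpl. rewrite <- IH, <- exp_plus. f_equal. ring.
Qed.

Lemma Cmod_Cexp_le (z : C) : Cmod (Cexp z) <= exp (Cmod z).
Proof.
  rewrite Cmod_Cexp. apply exp_le. eapply Rle_trans; [apply Rle_abs|apply re_le_Cmod].
Qed.

Lemma is_CInt_Cexp (w : C) : is_CInt (fun t => w * Cexp (RtoC t * w))%C 0 1 (Cexp w - RtoC 1)%C.
Proof.
  replace (Cexp w - RtoC 1)%C with (Cexp (RtoC 1 * w) - Cexp (RtoC 0 * w))%C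
    by (rewrite Cmult_1_l, Cmult_0_l, Cexp_0; auto).
  destruct w as [a b].
  apply (is_RInt_fct_extend_pair (U := R_NormedModule) (V := R_NormedModule)).
  - apply (is_RInt_derive (V := R_CompleteNormedModule)
             (fun t => fst (Cexp (RtoC t * (a, b)))) _ 0 1);
      intros t _; unfold Cexp; simpl.
    + auto_derive; auto. unfold Rminus. ring.
    + apply (ex_derive_continuous (K := R_AbsRing) (V := R_NormedModule)). auto_derive; auto.
  - apply (is_RInt_derive (V := R_CompleteNormedModule)
             (fun t => snd (Cexp (RtoC t * (a, b)))) _ 0 1);
      intros t _; unfold Cexp; simpl.
    + auto_derive; auto. unfold Rminus. ring.
    + apply (ex_derive_continuous (K := R_AbsRing) (V := R_NormedModule)). auto_derive; auto.
Qed.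

Lemma Cmod_scal_01_le (t : R) (w : C) : 0 <= t <= 1 -> Cmod (RtoC t * w) <= Cmod w.
Proof.
  intros Ht. rewrite Cmod_mult, Cmod_R, Rabs_pos_eq by lra. assert (Hw := Cmod_ge_0 w). nra.
Qed.

Lemma Cexp_minus_1_bound (w : C) : Cmod (Cexp w - RtoC 1) <= Cmod w * exp (Cmod w).
Proof.
  replace (Cmod w * exp (Cmod w)) with ((1 - 0) * (Cmod w * exp (Cmod w))) by ring.
  apply (Cmod_is_CInt_le _ _ _ _ _ Rle_0_1 (is_CInt_Cexp w)). intros t Ht.
  rewrite Cmod_mult. apply Rmult_le_compat_l; [apply Cmod_ge_0|].
  eapply Rle_trans; [apply Cmod_Cexp_le|apply exp_le, Cmod_scal_01_le, Ht].
Qed.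

Lemma Cexp_taylor1_bound (w : C) :
  Cmod (Cexp w - RtoC 1 - w) <= Cmod w * (Cmod w * exp (Cmod w)).
Proof.
  assert (H : is_CInt (fun t => w * Cexp (RtoC t * w) - w)%C 0 1
                (Cexp w - RtoC 1 - RtoC (1 - 0) * w)%C).
  { apply (is_RInt_minus (V := C_R_NormedModule)); [apply is_CInt_Cexp|apply is_CInt_const]. }
  replace (RtoC (1 - 0) * w)%C with w in H by (rewrite Rminus_0_r; ring).
  replace (Cmod w * (Cmod w * exp (Cmod w)))
    with ((1 - 0) * (Cmod w * (Cmod w * exp (Cmod w)))) by ring.
  apply (Cmod_is_CInt_le _ _ _ _ _ Rle_0_1 H). intros t Ht. assert (Htw := Cmod_scal_01_le t w Ht).
  replace (w * Cexp (RtoC t * w) - w)%C with (w * (Cexp (RtoC t * w) - RtoC 1))%C by ring.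
  rewrite Cmod_mult. apply Rmult_le_compat_l; [apply Cmod_ge_0|].
  eapply Rle_trans; [apply Cexp_minus_1_bound|].
  apply Rmult_le_compat; [apply Cmod_ge_0|left; apply exp_pos|exact Htw|apply exp_le, Htw].
Qed.

Lemma is_cderive_Cexp (z : C) : is_cderive Cexp z (Cexp z).
Proof.
  apply is_cderive_Cmod. intros eps He. apply locally_Cmod.
  set (K := Cmod (Cexp z) * exp 1).
  assert (PK : 0 < K) by (unfold K; rewrite Cmod_Cexp, <- exp_plus; apply exp_pos).
  exists (Rmin 1 (eps / K)). split; [apply Rmin_pos; [lra|apply Rdiv_lt_0_compat; auto]|].
  intros w Hw. assert (Hw_one := Rlt_le_trans _ _ _ Hw (Rmin_l _ _)).
  assert (Hw_eps := Rlt_le_trans _ _ _ Hw (Rmin_r _ _)).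
  replace (Cexp w) with (Cexp z * Cexp (w - z))%C by (rewrite <- Cexp_plus; f_equal; ring).
  replace (Cexp z * Cexp (w - z) - Cexp z - Cexp z * (w - z))%C
    with (Cexp z * (Cexp (w - z) - RtoC 1 - (w - z)))%C by ring.
  rewrite Cmod_mult. set (h := Cmod (w - z)) in *. assert (Ph : 0 <= h) by apply Cmod_ge_0.
  apply Rle_trans with (Cmod (Cexp z) * (h * (h * exp 1))).
  - apply Rmult_le_compat_l; [apply Cmod_ge_0|].
    eapply Rle_trans; [apply Cexp_taylor1_bound|]. fold h.
    assert (exp h <= exp 1) by (apply exp_le; lra). apply Rmult_le_compat_l; nra.
  - replace (Cmod (Cexp z) * (h * (h * exp 1))) with (h * K * h) by (unfold K; ring).
    apply Rmult_le_compat_r; auto.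
    apply Rmult_lt_compat_r with (r := K) in Hw_eps; auto.
    replace (eps / K * K) with eps in Hw_eps by (field; lra). lra.
Qed.

Definition C2PIi : C := (RtoC (2 * PI) * Ci)%C.
Definition e2pi (w : C) : C := Cexp (C2PIi * w).

Lemma C2PIi_neq_0 : C2PIi <> RtoC 0.
Proof.
  apply Cmult_neq_0; [|apply Ci_nz]. intros E. apply RtoC_inj in E.
  assert (HPI := PI_RGT_0). lra.
Qed.

Lemma e2pi_plus (a b : C) : e2pi (a + b) = (e2pi a * e2pi b)%C.
Proof. unfold e2pi. rewrite <- Cexp_plus. f_equal. ring. Qed.

Lemma e2pi_0 : e2pi (RtoC 0) = RtoC 1.
Proof. unfold e2pi. rewrite Cmult_0_r. apply Cexp_0. Qed.

Lemma Cmod_e2pi (w : C) : Cmod (e2pi w) = exp (- (2 * PI * Im w)).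
Proof. unfold e2pi, C2PIi. rewrite Cmod_Cexp. f_equal. simpl. unfold Im. ring. Qed.

Lemma Cmod_e2pi_R (r : R) : Cmod (e2pi (RtoC r)) = 1.
Proof. rewrite Cmod_e2pi. simpl. rewrite Rmult_0_r, Ropp_0. apply exp_0. Qed.

Lemma e2pi_neq_0 (w : C) : e2pi w <> RtoC 0.
Proof. apply Cmod_gt_0. rewrite Cmod_e2pi. apply exp_pos. Qed.

Lemma e2pi_R (r : R) : e2pi (RtoC r) = (cos (2 * PI * r), sin (2 * PI * r)).
Proof.
  unfold e2pi, C2PIi, Cexp. simpl.
  replace ((2 * PI * 0 - 0 * 1) * r - (2 * PI * 1 + 0 * 0) * 0) with 0 by ring.
  replace ((2 * PI * 0 - 0 * 1) * 0 + (2 * PI * 1 + 0 * 0) * r) with (2 * PI * r) by ring.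
  rewrite exp_0, !Rmult_1_l. reflexivity.
Qed.

Lemma e2pi_half : e2pi (RtoC (/ 2)) = RtoC (-1).
Proof.
  rewrite e2pi_R. replace (2 * PI * / 2) with PI by field. rewrite cos_PI, sin_PI. reflexivity.
Qed.

Lemma e2pi_quarter : e2pi (RtoC (/ 4)) = Ci.
Proof.
  rewrite e2pi_R. replace (2 * PI * / 4) with (PI / 2) by field.
  rewrite cos_PI2, sin_PI2. reflexivity.
Qed.

Lemma periodic_IZR {A : Type} (u : R -> A) (k : Z) (x : R) :
  (forall x, u (x + 1) = u x) -> u (x + IZR k) = u x.
Proof.
  intros Hu.
  assert (Hnat : forall n x, u (x + INR n) = u x).
  { induction n as [|n IH]; intros y; [rewrite Rplus_0_r; reflexivity|].
    rewrite S_INR, <- Rplus_assoc, Hu. apply IH. }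
  destruct (Z_le_gt_dec 0 k) as [Hk|Hk].
  - rewrite <- (Z2Nat.id k), <- INR_IZR_INZ by auto. apply Hnat.
  - rewrite <- (Hnat (Z.to_nat (- k)) (x + IZR k)). f_equal.
    rewrite INR_IZR_INZ, Z2Nat.id, opp_IZR by lia. ring.
Qed.

Lemma e2pi_IZR (n : Z) : e2pi (RtoC (IZR n)) = RtoC 1.
Proof.
  rewrite <- (Rplus_0_l (IZR n)), (periodic_IZR (fun x => e2pi (RtoC x))); [apply e2pi_0|].
  intros x. rewrite RtoC_plus, e2pi_plus, (e2pi_R 1), Rmult_1_r, cos_2PI, sin_2PI.
  apply Cmult_1_r.
Qed.

Lemma e2pi_eq_1 (r : R) : e2pi (RtoC r) = RtoC 1 -> exists k : Z, r = IZR k.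
Proof.
  intros H. assert (E := H). rewrite e2pi_R in E. apply (f_equal snd) in E. simpl in E.
  apply sin_eq_0_0 in E. destruct E as [k Hk]. assert (HPI := PI_RGT_0).
  assert (Er : r = IZR k / 2).
  { apply Rmult_eq_reg_l with (2 * PI); [|lra]. rewrite Hk. field. }
  destruct (Z.Even_or_Odd k) as [[j ->]|[j ->]].
  - exists j. rewrite Er, mult_IZR. field.
  - exfalso. assert (Er_half : r = IZR j + / 2) by (rewrite Er, plus_IZR, mult_IZR; field).
    rewrite Er_half, RtoC_plus, e2pi_plus, e2pi_IZR, e2pi_half in H.
    apply (f_equal fst) in H. simpl in H. lra.
Qed.

Lemma e2pi_Cconj (w : C) : e2pi (- Cconj w) = Cconj (e2pi w).
Proof.
  unfold e2pi, C2PIi. rewrite <- Cexp_Cconj. f_equal. apply injective_projections; simpl; ring.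
Qed.

Lemma is_cderive_e2pi (w : C) : is_cderive e2pi w (C2PIi * e2pi w)%C.
Proof.
  apply is_cderive_eq with (e2pi w * C2PIi)%C; [|ring].
  apply (is_cderive_comp Cexp); [apply is_cderive_Cexp|].
  apply (is_derive_ext (K := C_AbsRing) (V := C_NormedModule) (fun z => C2PIi * z + RtoC 0)%C);
    [intros; apply Cplus_0_r|apply is_cderive_affine].
Qed.

Lemma ccontinuous_e2pi (w : C) : ccontinuous e2pi w.
Proof. apply ex_cderive_continuous. eexists. apply is_cderive_e2pi. Qed.

Lemma ccontinuous_e2pi_R (a x : R) : ccontinuous (fun u : R => e2pi (RtoC (a * u))) x.
Proof.
  apply (continuous_comp (fun u => RtoC (a * u)) e2pi); [|apply ccontinuous_e2pi].
  apply (continuous_comp (fun u => a * u) RtoC); [|apply ccontinuous_RtoC].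
  apply (continuous_mult (K := R_AbsRing)); [apply continuous_const|apply continuous_id].
Qed.

Lemma qpow_e2pi (tau : C) (n : Z) : qpow tau n = e2pi (RtoC (IZR n) * tau).
Proof. unfold qpow, e2pi, C2PIi. f_equal. rewrite RtoC_mult. ring. Qed.

Lemma qpow_plus (tau : C) (n m : Z) : qpow tau (n + m) = (qpow tau n * qpow tau m)%C.
Proof. rewrite !qpow_e2pi, <- e2pi_plus, plus_IZR, RtoC_plus. f_equal. ring. Qed.

Lemma qpow_0 (tau : C) : qpow tau 0 = RtoC 1.
Proof. rewrite qpow_e2pi, Cmult_0_l. apply e2pi_0. Qed.

Lemma qpow_mul_opp (z : C) (n : Z) : (qpow z n * qpow z (- n))%C = RtoC 1.
Proof. rewrite <- qpow_plus, Z.add_opp_diag_r. apply qpow_0. Qed.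

Lemma Cmod_qpow (tau : C) (n : Z) : Cmod (qpow tau n) = exp (- (2 * PI * IZR n * Im tau)).
Proof. rewrite qpow_e2pi, Cmod_e2pi, im_scal_l. f_equal. ring. Qed.

Lemma qpow_translate (tau w : C) (n : Z) : qpow (tau + w) n = (qpow tau n * qpow w n)%C.
Proof. rewrite !qpow_e2pi, <- e2pi_plus. f_equal. ring. Qed.

Lemma qpow_1 (n : Z) : qpow (RtoC 1) n = RtoC 1.
Proof. rewrite qpow_e2pi, Cmult_1_r. apply e2pi_IZR. Qed.

Lemma is_cderive_qpow (tau : C) (n : Z) :
  is_cderive (fun z => qpow z n) tau (C2PIi * RtoC (IZR n) * qpow tau n)%C.
Proof.
  apply (is_derive_ext (K := C_AbsRing) (V := C_NormedModule)
           (fun z => e2pi (RtoC (IZR n) * z + RtoC 0))).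
  { intros z. rewrite qpow_e2pi, Cplus_0_r. reflexivity. }
  apply is_cderive_eq with (C2PIi * e2pi (RtoC (IZR n) * tau + RtoC 0) * RtoC (IZR n))%C.
  - apply (is_cderive_comp e2pi); [apply is_cderive_e2pi|apply is_cderive_affine].
  - rewrite qpow_e2pi, Cplus_0_r. ring.
Qed.

(** * Goursat's theorem on rectangles *)

Lemma div_pow2_S (w : R) (n : nat) : w / 2 ^ S n = w / 2 ^ n / 2.
Proof. simpl. field. apply pow_nonzero. lra. Qed.

Lemma div_pow2_ge_0 (w : R) (n : nat) : 0 <= w -> 0 <= w / 2 ^ n.
Proof.
  intros Hw. apply Rmult_le_pos; auto. left. apply Rinv_0_lt_compat, pow_lt. lra.
Qed.

Lemma nested_halves_common_point (x : nat -> R) (w : R) : 0 <= w ->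
  (forall n, x (S n) = x n \/ x (S n) = x n + w / 2 ^ n / 2) ->
  exists u, forall n, x n <= u <= x n + w / 2 ^ n.
Proof.
  intros Hw Hstep.
  assert (Hnested : forall n k, x n <= x (n + k)%nat /\
                          x (n + k)%nat + w / 2 ^ (n + k) <= x n + w / 2 ^ n).
  { intros n. induction k as [|k IH]; [rewrite Nat.add_0_r; lra|].
    rewrite Nat.add_succ_r, div_pow2_S. assert (Hpos := div_pow2_ge_0 w (n + k) Hw).
    destruct (Hstep (n + k)%nat) as [E|E]; rewrite E; lra. }
  assert (Hupper : forall n k, x k <= x n + w / 2 ^ n).
  { intros n k. assert (Hn := div_pow2_ge_0 w n Hw). assert (Hk := div_pow2_ge_0 w k Hw).
    destruct (Nat.le_gt_cases n k) as [Hle|Hlt].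
    - destruct (Hnested n (k - n)%nat) as [_ Hnk].
      replace (n + (k - n))%nat with k in Hnk by lia. lra.
    - destruct (Hnested k (n - k)%nat) as [Hkn _].
      replace (k + (n - k))%nat with n in Hkn by lia. lra. }
  destruct (completeness (fun r => exists n, r = x n)) as [u [Hub Hlub]].
  - exists (x O + w / 2 ^ 0). intros r [k ->]. apply Hupper.
  - exists (x O), O. reflexivity.
  - exists u. intros n. split; [apply Hub; eauto|].
    apply Hlub. intros r [k ->]. apply Hupper.
Qed.

Section RectangleBisection.

Variable P : R -> R -> R -> R -> Prop.
Hypothesis Hsplit : forall x y w h, 0 <= w -> 0 <= h ->
  P x y (w / 2) (h / 2) -> P (x + w / 2) y (w / 2) (h / 2) ->
  P x (y + h / 2) (w / 2) (h / 2) -> P (x + w / 2) (y + h / 2) (w / 2) (h / 2) -> P x y w h.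

Definition quarter_corner (x y w h : R) (p : R * R) : Prop :=
  (fst p = x \/ fst p = x + w / 2) /\ (snd p = y \/ snd p = y + h / 2).

Lemma exists_bad_quarter (x y w h : R) : 0 <= w -> 0 <= h -> ~ P x y w h ->
  exists p, ~ P (fst p) (snd p) (w / 2) (h / 2) /\ quarter_corner x y w h p.
Proof.
  intros Hw Hh Hbad. apply NNPP. intros Hgood. apply Hbad.
  assert (Hquarter : forall p, quarter_corner x y w h p -> P (fst p) (snd p) (w / 2) (h / 2)).
  { intros p Hp. apply NNPP. intros N. apply Hgood. exists p. split; assumption. }
  apply Hsplit; try assumption.
  - apply (Hquarter (x, y)). split; left; reflexivity.
  - apply (Hquarter (x + w / 2, y)). split; [right|left]; reflexivity.
  - apply (Hquarter (x, y + h / 2)). split; [left|right]; reflexivity.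
  - apply (Hquarter (x + w / 2, y + h / 2)). split; right; reflexivity.
Qed.

Lemma exists_bad_corners (X Y W H : R) : 0 <= W -> 0 <= H -> ~ P X Y W H ->
  exists corner : nat -> R * R, corner O = (X, Y) /\ forall n,
    ~ P (fst (corner n)) (snd (corner n)) (W / 2 ^ n) (H / 2 ^ n) /\
    quarter_corner (fst (corner n)) (snd (corner n)) (W / 2 ^ n) (H / 2 ^ n) (corner (S n)).
Proof.
  intros HW HH Hbad0.
  set (bad := fun n (p : R * R) => ~ P (fst p) (snd p) (W / 2 ^ n) (H / 2 ^ n)).
  assert (Hquarter : forall np : nat * (R * R), exists q, bad (fst np) (snd np) ->
    bad (S (fst np)) q /\
    quarter_corner (fst (snd np)) (snd (snd np)) (W / 2 ^ fst np) (H / 2 ^ fst np) q).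
  { intros [n p]. cbn [fst snd]. destruct (classic (bad n p)) as [Hbad|Hgood].
    - destruct (exists_bad_quarter _ _ _ _ (div_pow2_ge_0 W n HW) (div_pow2_ge_0 H n HH) Hbad)
        as [q Hq].
      exists q. intros _. unfold bad. rewrite !div_pow2_S. exact Hq.
    - exists p. intros Hbad. destruct (Hgood Hbad). }
  destruct (functional_choice _ Hquarter) as [next Hnext].
  set (corner := fix corner n := match n with O => (X, Y) | S n => next (n, corner n) end).
  assert (Hbad : forall n, bad n (corner n)).
  { induction n as [|n IH]; [|apply (Hnext (n, corner n) IH)].
    unfold bad. simpl. rewrite !Rdiv_1_r. exact Hbad0. }
  exists corner. split; [reflexivity|]. intros n. split; [apply Hbad|].
  apply (Hnext (n, corner n) (Hbad n)).
Qed.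

Lemma rectangle_bisection (X Y W H : R) : 0 <= W -> 0 <= H ->
  (forall a b, X <= a <= X + W -> Y <= b <= Y + H ->
     exists d, 0 < d /\ forall x y w h, 0 <= w < d -> 0 <= h < d ->
       x <= a <= x + w -> y <= b <= y + h -> P x y w h) ->
  P X Y W H.
Proof.
  intros HW HH Hlocal. apply NNPP. intros Hbad.
  destruct (exists_bad_corners X Y W H HW HH Hbad) as [corner [Hcorner0 Hcorner]].
  destruct (nested_halves_common_point (fun n => fst (corner n)) W HW) as [a Ha].
  { intros n. apply Hcorner. }
  destruct (nested_halves_common_point (fun n => snd (corner n)) H HH) as [b Hb].
  { intros n. apply Hcorner. }
  destruct (Hlocal a b) as [d [Hd Hsmall]].
  { specialize (Ha O). simpl in Ha. rewrite Hcorner0 in Ha. simpl in Ha. lra. }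
  { specialize (Hb O). simpl in Hb. rewrite Hcorner0 in Hb. simpl in Hb. lra. }
  destruct (cv_pow_half W d Hd) as [NW HNW]. destruct (cv_pow_half H d Hd) as [NH HNH].
  set (n := (NW + NH)%nat). specialize (HNW n ltac:(lia)). specialize (HNH n ltac:(lia)).
  unfold Rdist in HNW, HNH. rewrite Rminus_0_r, Rabs_pos_eq in HNW, HNH
    by (apply div_pow2_ge_0; assumption).
  apply (proj1 (Hcorner n)), Hsmall; try apply Ha; try apply Hb;
    split; assumption || (apply div_pow2_ge_0; assumption).
Qed.

End RectangleBisection.

Definition rect_int (f : C -> C) (x y w h : R) : C :=
  (CInt (fun u => f (u, y)) x (x + w) + Ci * CInt (fun v => f (x + w, v)%R) y (y + h)
   - CInt (fun u => f (u, y + h)%R) x (x + w) - Ci * CInt (fun v => f (x, v)) y (y + h))%C.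

Definition in_rect (x y w h : R) (z : C) : Prop :=
  x <= Re z <= x + w /\ y <= Im z <= y + h.

Definition sub_rect (x y w h X Y W H : R) : Prop :=
  X <= x /\ x + w <= X + W /\ Y <= y /\ y + h <= Y + H.

Lemma in_sub_rect (x y w h X Y W H : R) (z : C) :
  sub_rect x y w h X Y W H -> in_rect x y w h z -> in_rect X Y W H z.
Proof. unfold sub_rect, in_rect. lra. Qed.

Lemma horizontal_line (x y : R) : ((0, y) + RtoC x * RtoC 1)%C = (x, y).
Proof. apply injective_projections; simpl; ring. Qed.

Lemma vertical_line (x y : R) : (RtoC x + RtoC y * Ci)%C = (x, y).
Proof. apply injective_projections; simpl; ring. Qed.

Lemma ccontinuous_horizontal (f : C -> C) (x y : R) :
  ccontinuous f (x, y) -> ccontinuous (fun u : R => f (u, y)) x.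
Proof.
  rewrite <- horizontal_line. intros H.
  apply (continuous_ext (fun u : R => f ((0, y) + RtoC u * RtoC 1)%C)).
  - intros u. rewrite horizontal_line. reflexivity.
  - apply ccontinuous_line, H.
Qed.

Lemma ccontinuous_vertical (f : C -> C) (x y : R) :
  ccontinuous f (x, y) -> ccontinuous (fun v : R => f (x, v)) y.
Proof.
  rewrite <- vertical_line. intros H.
  apply (continuous_ext (fun v : R => f (RtoC x + RtoC v * Ci)%C)).
  - intros v. rewrite vertical_line. reflexivity.
  - apply ccontinuous_line, H.
Qed.

Section RectangleIntegral.

Variables (f : C -> C) (X Y W H : R).
Hypothesis Hf : forall z, in_rect X Y W H z -> ccontinuous f z.

Lemma ex_CInt_horizontal (y a b : R) :
  X <= a <= X + W -> X <= b <= X + W -> Y <= y <= Y + H -> ex_CInt (fun u => f (u, y)) a b.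
Proof.
  intros Ha Hb Hy. apply ex_RInt_continuous. intros x Hx.
  apply ccontinuous_horizontal, Hf. unfold in_rect. simpl.
  revert Hx. unfold Rmin, Rmax. destruct (Rle_dec a b); lra.
Qed.

Lemma ex_CInt_vertical (x a b : R) :
  Y <= a <= Y + H -> Y <= b <= Y + H -> X <= x <= X + W -> ex_CInt (fun v => f (x, v)) a b.
Proof.
  intros Ha Hb Hx. apply ex_RInt_continuous. intros y Hy.
  apply ccontinuous_vertical, Hf. unfold in_rect. simpl.
  revert Hy. unfold Rmin, Rmax. destruct (Rle_dec a b); lra.
Qed.

Lemma rect_int_quarters (x y w h : R) : 0 <= w -> 0 <= h ->
  sub_rect x y w h X Y W H ->
  rect_int f x y w h =
  (rect_int f x y (w / 2) (h / 2) + rect_int f (x + w / 2) y (w / 2) (h / 2)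
   + rect_int f x (y + h / 2) (w / 2) (h / 2)
   + rect_int f (x + w / 2) (y + h / 2) (w / 2) (h / 2))%C.
Proof.
  unfold sub_rect. intros Hw Hh Hsub. unfold rect_int.
  replace (x + w / 2 + w / 2) with (x + w) by lra.
  replace (y + h / 2 + h / 2) with (y + h) by lra.
  rewrite <- (CInt_Chasles (fun u => f (u, y)) x (x + w / 2) (x + w))
    by (apply ex_CInt_horizontal; lra).
  rewrite <- (CInt_Chasles (fun u => f (u, y + h)%R) x (x + w / 2) (x + w))
    by (apply ex_CInt_horizontal; lra).
  rewrite <- (CInt_Chasles (fun v => f (x, v)) y (y + h / 2) (y + h))
    by (apply ex_CInt_vertical; lra).
  rewrite <- (CInt_Chasles (fun v => f (x + w, v)%R) y (y + h / 2) (y + h))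
    by (apply ex_CInt_vertical; lra).
  ring.
Qed.

Lemma Cmod_rect_int_le (M : R) : 0 <= W -> 0 <= H ->
  (forall z, in_rect X Y W H z -> Cmod (f z) <= M) ->
  Cmod (rect_int f X Y W H) <= 2 * (W + H) * M.
Proof.
  intros HW HH HM. unfold rect_int.
  assert (Hhor : forall y, Y <= y <= Y + H -> Cmod (CInt (fun u => f (u, y)) X (X + W)) <= W * M).
  { intros y Hy. replace W with (X + W - X) at 2 by ring.
    apply Cmod_CInt_le; [lra|apply ex_CInt_horizontal; lra|].
    intros u Hu. apply HM. split; simpl; lra. }
  assert (Hver : forall x, X <= x <= X + W -> Cmod (CInt (fun v => f (x, v)) Y (Y + H)) <= H * M).
  { intros x Hx. replace H with (Y + H - Y) at 2 by ring.
    apply Cmod_CInt_le; [lra|apply ex_CInt_vertical; lra|].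
    intros v Hv. apply HM. split; simpl; lra. }
  assert (Hbottom := Hhor Y ltac:(lra)). assert (Htop := Hhor (Y + H) ltac:(lra)).
  assert (Hleft := Hver X ltac:(lra)). assert (Hright := Hver (X + W) ltac:(lra)).
  eapply Rle_trans; [apply Cmod_triangle_minus|]. rewrite Cmod_mult, Cmod_Ci.
  eapply Rle_trans; [apply Rplus_le_compat_r, Cmod_triangle_minus|].
  eapply Rle_trans; [apply Rplus_le_compat_r, Rplus_le_compat_r, Cmod_triangle|].
  rewrite Cmod_mult, Cmod_Ci. lra.
Qed.

End RectangleIntegral.

Lemma rect_int_minus (f g : C -> C) (x y w h : R) : 0 <= w -> 0 <= h ->
  (forall z, in_rect x y w h z -> ccontinuous f z) ->
  (forall z, in_rect x y w h z -> ccontinuous g z) ->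
  rect_int (fun z => f z - g z)%C x y w h = (rect_int f x y w h - rect_int g x y w h)%C.
Proof.
  intros Hw Hh Hf Hg. unfold rect_int.
  assert (Hfh := fun v => ex_CInt_horizontal f x y w h Hf v x (x + w)).
  assert (Hgh := fun v => ex_CInt_horizontal g x y w h Hg v x (x + w)).
  assert (Hfv := fun u => ex_CInt_vertical f x y w h Hf u y (y + h)).
  assert (Hgv := fun u => ex_CInt_vertical g x y w h Hg u y (y + h)).
  rewrite (CInt_minus (fun u => f (u, y)) (fun u => g (u, y)));
    [|apply Hfh; lra|apply Hgh; lra].
  rewrite (CInt_minus (fun u => f (u, y + h)%R) (fun u => g (u, y + h)%R));
    [|apply Hfh; lra|apply Hgh; lra].
  rewrite (CInt_minus (fun v => f (x + w, v)%R) (fun v => g (x + w, v)%R));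
    [|apply Hfv; lra|apply Hgv; lra].
  rewrite (CInt_minus (fun v => f (x, v)) (fun v => g (x, v)));
    [|apply Hfv; lra|apply Hgv; lra].
  ring.
Qed.

Lemma rect_int_primitive (F f : C -> C) (x y w h : R) :
  (forall z, is_cderive F z (f z)) -> (forall z, ccontinuous f z) -> rect_int f x y w h = RtoC 0.
Proof.
  intros HF Hf.
  assert (Hh : forall v a b, CInt (fun u => f (u, v)) a b = (F (b, v) - F (a, v))%C).
  { intros v a b. apply CInt_unique. rewrite <- (horizontal_line a), <- (horizontal_line b).
    apply (is_RInt_ext (V := C_R_NormedModule) (fun u => f ((0, v) + RtoC u * RtoC 1) * RtoC 1)%C).
    - intros u _. rewrite horizontal_line. apply Cmult_1_r.
    - apply is_CInt_cderive_line; auto. }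
  assert (Hv : forall u a b, (Ci * CInt (fun v => f (u, v)) a b)%C = (F (u, b) - F (u, a))%C).
  { intros u a b. rewrite <- CInt_scal.
    - apply CInt_unique. rewrite <- (vertical_line u a), <- (vertical_line u b).
      apply (is_RInt_ext (V := C_R_NormedModule) (fun v => f (RtoC u + RtoC v * Ci) * Ci)%C).
      + intros v _. rewrite vertical_line. apply Cmult_comm.
      + apply is_CInt_cderive_line; auto.
    - apply ex_CInt_continuous. intros v. apply ccontinuous_vertical, Hf. }
  unfold rect_int. rewrite !Hh, !Hv. ring.
Qed.

Lemma rect_int_affine (p q : C) (x y w h : R) : rect_int (fun z => p * z + q)%C x y w h = RtoC 0.
Proof.
  apply (rect_int_primitive (fun z => (RtoC (/ 2) * p * (z * z) + q * z))%C).
  - intros z. apply is_cderive_eq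
      with (RtoC (/ 2) * p * (RtoC 1 * z + z * RtoC 1) + q * RtoC 1)%C.
    + apply is_cderive_plus; apply is_cderive_scal;
        [apply (is_cderive_mult (fun w => w) (fun w => w))|]; apply is_cderive_id.
    + rewrite RtoC_inv by lra. field.
  - intros z. apply ex_cderive_continuous. eexists. apply is_cderive_affine.
Qed.

Lemma rect_int_bound_of_quarters (f : C -> C) (X Y W H x y w h M : R) :
  (forall z, in_rect X Y W H z -> ccontinuous f z) ->
  0 <= w -> 0 <= h -> sub_rect x y w h X Y W H ->
  Cmod (rect_int f x y (w / 2) (h / 2)) <= M ->
  Cmod (rect_int f (x + w / 2) y (w / 2) (h / 2)) <= M ->
  Cmod (rect_int f x (y + h / 2) (w / 2) (h / 2)) <= M ->
  Cmod (rect_int f (x + w / 2) (y + h / 2) (w / 2) (h / 2)) <= M ->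
  Cmod (rect_int f x y w h) <= 4 * M.
Proof.
  intros Hc Hw Hh Hsub Hll Hlr Hul Hur. rewrite (rect_int_quarters f X Y W H Hc) by assumption.
  eapply Rle_trans; [apply Cmod_triangle|].
  eapply Rle_trans; [apply Rplus_le_compat_r, Cmod_triangle|].
  eapply Rle_trans; [apply Rplus_le_compat_r, Rplus_le_compat_r, Cmod_triangle|]. lra.
Qed.

(* The integral of the affine approximation of [f] at a point of the rectangle vanishes. *)
Lemma rect_int_local_bound (f : C -> C) (p l : C) (eps : R) : is_cderive f p l -> 0 < eps ->
  exists d, 0 < d /\ forall x y w h, 0 <= w < d -> 0 <= h < d -> in_rect x y w h p ->
    (forall z, in_rect x y w h z -> ccontinuous f z) ->
    Cmod (rect_int f x y w h) <= eps * ((w + h) * (w + h)).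
Proof.
  intros Hl Heps.
  destruct (proj1 (locally_Cmod _ _) (proj1 (is_cderive_Cmod _ _ _) Hl (eps / 2) ltac:(lra)))
    as [d [Hd Happrox]].
  exists (d / 2). split; [lra|]. intros x y w h Hw Hh Hp Hc. set (q := (f p - l * p)%C).
  assert (Hq : forall z, ccontinuous (fun z => l * z + q)%C z)
    by (intros; apply ex_cderive_continuous; eexists; apply is_cderive_affine).
  replace (rect_int f x y w h) with (rect_int (fun z => f z - (l * z + q))%C x y w h).
  2: { rewrite rect_int_minus, rect_int_affine by (auto || lra). ring. }
  replace (eps * ((w + h) * (w + h))) with (2 * (w + h) * (eps / 2 * (w + h))) by field.
  apply Cmod_rect_int_le; try lra.
  - intros z Hz. apply ccontinuous_minus; auto.
  - intros z Hz. assert (Hdist : Cmod (z - p) <= w + h).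
    { eapply Rle_trans; [apply Cmod_le_re_im|]. destruct z, p, Hz, Hp. simpl in *.
      apply Rplus_le_compat; apply Rabs_le; lra. }
    replace (f z - (l * z + q))%C with (f z - f p - l * (z - p))%C by (unfold q; ring).
    eapply Rle_trans; [apply Happrox; lra|]. apply Rmult_le_compat_l; lra.
Qed.

Theorem Goursat (f : C -> C) (X Y W H : R) : 0 <= W -> 0 <= H ->
  (forall z, in_rect X Y W H z -> ex_cderive f z) -> rect_int f X Y W H = RtoC 0.
Proof.
  intros HW HH Hf. apply Ceq_of_Cmod_le. intros eps Heps.
  replace (rect_int f X Y W H - RtoC 0)%C with (rect_int f X Y W H) by ring.
  assert (Hc : forall z, in_rect X Y W H z -> ccontinuous f z)
    by (intros; apply ex_cderive_continuous; auto).
  set (T := W + H). set (e := eps / (T * T + 1)).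
  assert (He : 0 < e) by (apply Rdiv_lt_0_compat; [exact Heps|nra]).
  assert (Hbound : sub_rect X Y W H X Y W H -> Cmod (rect_int f X Y W H) <= e * (T * T)).
  - apply (rectangle_bisection (fun x y w h =>
      sub_rect x y w h X Y W H -> Cmod (rect_int f x y w h) <= e * ((w + h) * (w + h)))); auto.
    + intros x y w h Hw Hh Hll Hlr Hul Hur Hsub.
      replace (e * ((w + h) * (w + h)))
        with (4 * (e * ((w / 2 + h / 2) * (w / 2 + h / 2)))) by field.
      apply (rect_int_bound_of_quarters f X Y W H x y w h); try assumption;
        unfold sub_rect in Hsub; [apply Hll|apply Hlr|apply Hul|apply Hur];
        unfold sub_rect; lra.
    + intros a b Ha Hb. destruct (Hf (a, b) (conj Ha Hb)) as [l Hl].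
      destruct (rect_int_local_bound f (a, b) l e Hl He) as [d [Hd Hsmall]].
      exists d. split; [exact Hd|]. intros x y w h Hw Hh Hax Hby Hsub.
      apply Hsmall; auto; [exact (conj Hax Hby)|].
      intros z Hz. apply Hc, (in_sub_rect x y w h); assumption.
  - eapply Rle_trans; [apply Hbound; unfold sub_rect; lra|]. unfold e.
    apply Rmult_le_reg_r with (T * T + 1); [nra|].
    replace (eps / (T * T + 1) * (T * T) * (T * T + 1)) with (eps * (T * T)) by (field; nra). nra.
Qed.

(** * Absolutely convergent series of complex numbers *)

Notation is_Cseries := (is_series (K := C_AbsRing) (V := C_NormedModule)).

Definition Cseries (u : nat -> C) : C :=
  (Series (fun n => Re (u n)), Series (fun n => Im (u n))).

Definition Csum (u : nat -> C) (n : nat) : C := sum_n (G := C_AbelianGroup) u n.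

Lemma Csum_0 (u : nat -> C) : Csum u 0 = u O.
Proof. apply (sum_O (G := C_AbelianGroup)). Qed.

Lemma Csum_S (u : nat -> C) (n : nat) : Csum u (S n) = (Csum u n + u (S n))%C.
Proof. apply (sum_Sn (G := C_AbelianGroup)). Qed.

Lemma Csum_ext (u v : nat -> C) (n : nat) :
  (forall k, (k <= n)%nat -> u k = v k) -> Csum u n = Csum v n.
Proof. apply (sum_n_ext_loc (G := C_AbelianGroup)). Qed.

Lemma Csum_plus (u v : nat -> C) (n : nat) :
  Csum (fun j => u j + v j)%C n = (Csum u n + Csum v n)%C.
Proof. apply (sum_n_plus (G := C_AbelianGroup)). Qed.

Lemma Csum_fst_snd (u : nat -> C) (n : nat) :
  Csum u n = (sum_n (fun k => Re (u k)) n, sum_n (fun k => Im (u k)) n).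
Proof.
  induction n as [|n IH]; [rewrite Csum_0, !sum_O; destruct (u O); auto|].
  rewrite Csum_S, !sum_Sn, IH. reflexivity.
Qed.

Lemma Csum_add (u : nat -> C) (m p : nat) :
  Csum u (m + S p) = (Csum u m + Csum (fun j => u (S m + j)%nat) p)%C.
Proof.
  induction p as [|p IH].
  - replace (m + 1)%nat with (S m) by lia. rewrite Csum_S, Csum_0, Nat.add_0_r. reflexivity.
  - replace (m + S (S p))%nat with (S (m + S p)) by lia.
    rewrite !Csum_S, IH. replace (S m + S p)%nat with (S (m + S p)) by lia. ring.
Qed.

Lemma Csum_rev (u : nat -> C) (n : nat) : Csum (fun j => u (n - j)%nat) n = Csum u n.
Proof.
  revert u. induction n as [|n IH]; intros u; [rewrite !Csum_0; reflexivity|].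
  rewrite Csum_S, Nat.sub_diag. change (S n) with (0 + S n)%nat at 2.
  rewrite Csum_add, Csum_0. rewrite <- (IH (fun j => u (1 + j)%nat)).
  rewrite (Csum_ext _ (fun j => u (1 + (n - j))%nat)) by (intros j Hj; f_equal; lia).
  apply Cplus_comm.
Qed.

Lemma Csum_scal (c : C) (u : nat -> C) (n : nat) : Csum (fun j => c * u j)%C n = (c * Csum u n)%C.
Proof. apply (sum_n_mult_l (K := C_Ring)). Qed.

Lemma Csum_single (u : nat -> C) (n i : nat) : (i <= n)%nat ->
  (forall j, (j <= n)%nat -> j <> i -> u j = RtoC 0) -> Csum u n = u i.
Proof.
  intros Hi Hu. induction n as [|n IH].
  - rewrite Csum_0. f_equal. lia.
  - rewrite Csum_S. destruct (Nat.eq_dec i (S n)) as [->|Ni].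
    + rewrite (Csum_ext u (fun j => RtoC 0 * u j)%C), Csum_scal; [ring|].
      intros j Hj. rewrite Hu by lia. ring.
    + rewrite IH, (Hu (S n)) by (lia || intros; apply Hu; lia). ring.
Qed.

Lemma Csum_eq_0 (u : nat -> C) (n : nat) :
  (forall j, (j <= n)%nat -> u j = RtoC 0) -> Csum u n = RtoC 0.
Proof. intros Hu. rewrite (Csum_single u n 0), Hu; auto with arith. Qed.

Lemma Csum_const (c : C) (n : nat) : Csum (fun _ => c) n = (RtoC (INR (S n)) * c)%C.
Proof.
  induction n as [|n IH]; [rewrite Csum_0; simpl; ring|].
  rewrite Csum_S, IH, (S_INR (S n)), RtoC_plus. ring.
Qed.

Lemma is_Cseries_Cmod (u : nat -> C) (l : C) :
  is_Cseries u l <->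
  forall eps, 0 < eps -> exists N, forall n, (N <= n)%nat -> Cmod (Csum u n - l) < eps.
Proof.
  split.
  - intros H eps Heps.
    apply (H (fun w => Cmod (w - l) < eps)), locally_Cmod. exists eps. auto.
  - intros H P HP. apply locally_Cmod in HP. destruct HP as [d [Hd HP]].
    destruct (H d Hd) as [N HN]. exists N. auto.
Qed.

Lemma is_Cseries_unique (u : nat -> C) (l : C) : is_Cseries u l -> Cseries u = l.
Proof.
  intros H. rewrite is_Cseries_Cmod in H.
  apply injective_projections; apply is_series_unique; intros P [eps Heps];
    destruct (H eps (cond_pos eps)) as [N HN]; exists N; intros n Hn; apply Heps;
    specialize (HN n Hn); rewrite Csum_fst_snd in HN;
    (eapply Rle_lt_trans; [|exact HN]).
  - exact (re_le_Cmod ((sum_n (fun k => Re (u k)) n, sum_n (fun k => Im (u k)) n) - l)).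
  - exact (im_le_Cmod ((sum_n (fun k => Re (u k)) n, sum_n (fun k => Im (u k)) n) - l)).
Qed.

Lemma Cseries_correct (u : nat -> C) :
  ex_series (fun n => Cmod (u n)) -> is_Cseries u (Cseries u).
Proof.
  intros H. destruct (ex_series_le (V := C_CompleteNormedModule) u (fun n => Cmod (u n))) as [l Hl];
    [intros; apply Rle_refl|exact H|].
  rewrite (is_Cseries_unique u l Hl). exact Hl.
Qed.

Lemma is_Cseries_ext (u v : nat -> C) (l : C) :
  (forall n, u n = v n) -> is_Cseries u l -> is_Cseries v l.
Proof. apply (is_series_ext (K := C_AbsRing) (V := C_NormedModule)). Qed.

Lemma Cseries_ext (u v : nat -> C) : (forall n, u n = v n) -> Cseries u = Cseries v.
Proof. intros H. unfold Cseries. f_equal; apply Series_ext; intros n; rewrite H; auto. Qed.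

Lemma ex_series_le_R (a b : nat -> R) :
  (forall n, 0 <= a n <= b n) -> ex_series b -> ex_series a.
Proof.
  intros H. apply (ex_series_le (V := R_CompleteNormedModule)). intros n.
  unfold norm; simpl. unfold abs; simpl. rewrite Rabs_pos_eq; apply H.
Qed.

Lemma Cmod_Cseries_le (u : nat -> C) (b : nat -> R) :
  (forall n, Cmod (u n) <= b n) -> ex_series b -> Cmod (Cseries u) <= Series b.
Proof.
  intros Hu Hb. apply Rnot_lt_le. intros Hlt.
  set (eps := (Cmod (Cseries u) - Series b) / 2). assert (He : 0 < eps) by (unfold eps; lra).
  assert (Hs : ex_series (fun n => Cmod (u n))).
  { apply ex_series_le_R with b; auto. intros n. split; [apply Cmod_ge_0|apply Hu]. }
  destruct (proj1 (is_Cseries_Cmod _ _) (Cseries_correct u Hs) eps He) as [Nu HNu].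
  destruct (proj1 (filterlim_locally _ _) (Series_correct b Hb) (mkposreal eps He)) as [Nb HNb].
  specialize (HNu (Nu + Nb)%nat ltac:(lia)). specialize (HNb (Nu + Nb)%nat ltac:(lia)).
  assert (Hb_near : Rabs (sum_n b (Nu + Nb) - Series b) < eps) by exact HNb.
  apply Rabs_lt_between in Hb_near.
  assert (Hpartial : forall n, Cmod (Csum u n) <= sum_n b n).
  { induction n as [|n IH]; [rewrite Csum_0, sum_O; auto|]. rewrite Csum_S, sum_Sn.
    eapply Rle_trans; [apply Cmod_triangle|]. apply Rplus_le_compat; auto. }
  specialize (Hpartial (Nu + Nb)%nat). rewrite Cmod_minus_sym in HNu.
  assert (Htri := Cmod_triangle_rev (Cseries u) (Csum u (Nu + Nb))). unfold eps in *. lra.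
Qed.

Lemma Cseries_incr_1 (u : nat -> C) : ex_series (fun n => Cmod (u n)) ->
  Cseries u = (u O + Cseries (fun k => u (S k)))%C.
Proof.
  intros H. apply is_Cseries_unique.
  assert (Htail : is_Cseries (fun k => u (S k)) (u O + Cseries (fun k => u (S k)) - u O)%C).
  { replace (u O + Cseries (fun k => u (S k)) - u O)%C with (Cseries (fun k => u (S k))) by ring.
    apply Cseries_correct, (ex_series_incr_1 (fun n => Cmod (u n))), H. }
  exact (is_series_decr_1 (K := C_AbsRing) (V := C_NormedModule) u _ Htail).
Qed.

(* A sum over the integers is computed by pairing the terms of index [k] and [-1 - k], so that
   its partial sums run over the intervals [-n <= m < n]. *)
Definition zfold (a : Z -> C) (k : nat) : C := (a (Z.of_nat k) + a (-1 - Z.of_nat k)%Z)%C.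
Definition zfold_R (b : Z -> R) (k : nat) : R := b (Z.of_nat k) + b (-1 - Z.of_nat k)%Z.

Definition zsum (a : Z -> C) : C := Cseries (zfold a).
Definition is_zsum (a : Z -> C) (l : C) : Prop := is_Cseries (zfold a) l.
Definition zseries (b : Z -> R) : R := Series (zfold_R b).
Definition ex_zseries (b : Z -> R) : Prop := ex_series (zfold_R b).
Definition zsummable (a : Z -> C) : Prop := ex_zseries (fun n => Cmod (a n)).

Lemma ex_zseries_le (a b : Z -> R) :
  (forall n, 0 <= a n <= b n) -> ex_zseries b -> ex_zseries a.
Proof.
  intros H. apply ex_series_le_R. intros k. unfold zfold_R.
  assert (Hnonneg := H (Z.of_nat k)). assert (Hneg := H (-1 - Z.of_nat k)%Z). lra.
Qed.

Lemma ex_zseries_scal (c : R) (b : Z -> R) : ex_zseries b -> ex_zseries (fun n => c * b n).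
Proof.
  intros H. apply (ex_series_ext (fun k => c * zfold_R b k)).
  - intros k. apply Rmult_plus_distr_l.
  - apply (ex_series_scal (V := R_NormedModule)), H.
Qed.

Lemma zseries_scal (c : R) (b : Z -> R) : zseries (fun n => c * b n) = c * zseries b.
Proof.
  unfold zseries. rewrite <- Series_scal_l. apply Series_ext. intros k. unfold zfold_R. ring.
Qed.

Lemma zseries_ge_0 (b : Z -> R) : (forall n, 0 <= b n) -> ex_zseries b -> 0 <= zseries b.
Proof.
  intros Hb H. replace 0 with (zseries (fun n => 0 * b n)) by (rewrite zseries_scal; ring).
  apply Series_le; auto. intros k. unfold zfold_R.
  assert (Hnonneg := Hb (Z.of_nat k)). assert (Hneg := Hb (-1 - Z.of_nat k)%Z). lra.
Qed.

Lemma zsummable_le (a : Z -> C) (b : Z -> R) :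
  (forall n, Cmod (a n) <= b n) -> ex_zseries b -> zsummable a.
Proof. intros H. apply ex_zseries_le. intros n. split; [apply Cmod_ge_0|auto]. Qed.

Lemma zsummable_ext (a b : Z -> C) : (forall n, a n = b n) -> zsummable a -> zsummable b.
Proof. intros H. apply zsummable_le. intros n. rewrite H. apply Rle_refl. Qed.

Lemma zsum_ext (a b : Z -> C) : (forall n, a n = b n) -> zsum a = zsum b.
Proof. intros H. apply Cseries_ext. intros k. unfold zfold. rewrite !H. reflexivity. Qed.

Lemma is_zsum_ext (a b : Z -> C) (l : C) : (forall n, a n = b n) -> is_zsum a l -> is_zsum b l.
Proof.
  intros H. apply is_Cseries_ext. intros k. unfold zfold.
  rewrite !H. reflexivity.
Qed.

Lemma is_zsum_unique (a : Z -> C) (l : C) : is_zsum a l -> zsum a = l.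
Proof. apply is_Cseries_unique. Qed.

Lemma zsummable_zfold (a : Z -> C) : zsummable a -> ex_series (fun k => Cmod (zfold a k)).
Proof.
  apply ex_series_le_R. intros k. split; [apply Cmod_ge_0|apply Cmod_triangle].
Qed.

Lemma zsum_correct (a : Z -> C) : zsummable a -> is_zsum a (zsum a).
Proof. intros H. apply Cseries_correct, zsummable_zfold, H. Qed.

Lemma is_zsum_plus (a b : Z -> C) (la lb : C) :
  is_zsum a la -> is_zsum b lb -> is_zsum (fun n => a n + b n)%C (la + lb)%C.
Proof.
  intros Ha Hb.
  apply (is_Cseries_ext (fun k => zfold a k + zfold b k)%C).
  - intros k. unfold zfold. ring.
  - apply (is_series_plus (K := C_AbsRing) (V := C_NormedModule)); auto.
Qed.

Lemma is_zsum_scal (c : C) (a : Z -> C) (l : C) :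
  is_zsum a l -> is_zsum (fun n => c * a n)%C (c * l)%C.
Proof.
  intros Ha.
  apply (is_Cseries_ext (fun k => c * zfold a k)%C).
  - intros k. unfold zfold. ring.
  - apply (is_series_scal (K := C_AbsRing) (V := C_NormedModule)); auto.
Qed.

Lemma is_zsum_Csum (a : nat -> Z -> C) (l : nat -> C) (n : nat) :
  (forall j, is_zsum (a j) (l j)) -> is_zsum (fun m => Csum (fun j => a j m) n) (Csum l n).
Proof.
  intros H. induction n as [|n IH].
  - rewrite Csum_0. apply (is_zsum_ext (a O)); auto. intros m. rewrite Csum_0. reflexivity.
  - rewrite Csum_S. apply (is_zsum_ext (fun m => Csum (fun j => a j m) n + a (S n) m)%C).
    + intros m. rewrite Csum_S. reflexivity.
    + apply is_zsum_plus; auto.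
Qed.

Lemma zsummable_scal (c : C) (a : Z -> C) : zsummable a -> zsummable (fun n => c * a n)%C.
Proof.
  intros H. apply (zsummable_le _ (fun n => Cmod c * Cmod (a n))).
  - intros n. rewrite Cmod_mult. apply Rle_refl.
  - apply ex_zseries_scal, H.
Qed.

Lemma Cmod_zsum_le (a : Z -> C) (b : Z -> R) :
  (forall n, Cmod (a n) <= b n) -> ex_zseries b -> Cmod (zsum a) <= zseries b.
Proof.
  intros H. apply Cmod_Cseries_le. intros k. unfold zfold, zfold_R.
  eapply Rle_trans; [apply Cmod_triangle|]. apply Rplus_le_compat; auto.
Qed.

Lemma is_zsum_delta (c : C) : is_zsum (fun n => if Z.eq_dec n 0 then c else RtoC 0) c.
Proof.
  apply is_Cseries_Cmod. intros eps Heps. exists O. intros n _.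
  replace (Csum _ n) with c; [replace (c - c)%C with (RtoC 0) by ring; rewrite Cmod_0; exact Heps|].
  symmetry. induction n as [|n IH].
  - rewrite Csum_0. apply Cplus_0_r.
  - rewrite Csum_S, IH. unfold zfold.
    destruct (Z.eq_dec (Z.of_nat (S n)) 0); [lia|].
    destruct (Z.eq_dec (-1 - Z.of_nat (S n)) 0); [lia|]. ring.
Qed.

Lemma is_zsum_telescope (b : Z -> C) :
  (forall eps, 0 < eps -> exists N, forall n, (N <= Z.abs n)%Z -> Cmod (b n) <= eps) ->
  is_zsum (fun n => b (n - 1)%Z - b n)%C (RtoC 0).
Proof.
  intros Hb. apply is_Cseries_Cmod. intros eps Heps.
  assert (E : forall n, Csum (zfold (fun n => b (n - 1)%Z - b n)%C) n
                        = (b (-2 - Z.of_nat n)%Z - b (Z.of_nat n))%C).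
  { induction n as [|n IH].
    - rewrite Csum_0. unfold zfold. simpl. ring.
    - rewrite Csum_S, IH. unfold zfold.
      replace (Z.of_nat (S n) - 1)%Z with (Z.of_nat n) by lia.
      replace (-1 - Z.of_nat (S n) - 1)%Z with (-2 - Z.of_nat (S n))%Z by lia.
      replace (-1 - Z.of_nat (S n))%Z with (-2 - Z.of_nat n)%Z by lia.
      ring. }
  destruct (Hb (eps / 3)) as [N HN]; [lra|]. exists (Z.to_nat N). intros n Hn.
  rewrite E. replace (b (-2 - Z.of_nat n)%Z - b (Z.of_nat n) - RtoC 0)%C
    with (b (-2 - Z.of_nat n)%Z - b (Z.of_nat n))%C by ring.
  assert (Hneg := HN (-2 - Z.of_nat n)%Z ltac:(lia)).
  assert (Hnonneg := HN (Z.of_nat n) ltac:(lia)).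
  eapply Rle_lt_trans; [apply Cmod_triangle_minus|]. lra.
Qed.

Lemma zsummable_small (a : Z -> C) : zsummable a ->
  forall eps, 0 < eps -> exists N, forall n, (N <= Z.abs n)%Z -> Cmod (a n) <= eps.
Proof.
  intros H eps Heps. assert (Hlim := ex_series_lim_0 _ H).
  apply is_lim_seq_spec in Hlim. destruct (Hlim (mkposreal eps Heps)) as [N HN].
  exists (Z.of_nat N + 1)%Z. intros n Hn. unfold zfold_R in HN.
  assert (Hge0 : forall m, 0 <= Cmod (a m)) by (intros; apply Cmod_ge_0).
  destruct (Z_le_gt_dec 0 n) as [Hsign|Hsign].
  - specialize (HN (Z.to_nat n) ltac:(lia)). cbn [real pos] in HN.
    rewrite Rminus_0_r, Z2Nat.id in HN by lia. apply Rabs_lt_between in HN.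
    specialize (Hge0 (-1 - n)%Z). lra.
  - specialize (HN (Z.to_nat (-1 - n)) ltac:(lia)). cbn [real pos] in HN.
    rewrite Rminus_0_r, Z2Nat.id in HN by lia. apply Rabs_lt_between in HN.
    replace (-1 - (-1 - n))%Z with n in HN by ring. specialize (Hge0 (-1 - n)%Z). lra.
Qed.

Lemma is_zsum_pred (a : Z -> C) : zsummable a -> is_zsum (fun n => a (n - 1)%Z) (zsum a).
Proof.
  intros H. replace (zsum a) with (RtoC 0 + zsum a)%C by ring.
  apply (is_zsum_ext (fun n => (a (n - 1)%Z - a n) + a n)%C); [intros; ring|].
  apply is_zsum_plus; [apply is_zsum_telescope, zsummable_small, H|apply zsum_correct, H].
Qed.

Lemma is_zsum_residues (a : Z -> C) (l : C) (d : nat) : is_zsum a l ->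
  is_zsum (fun m => Csum (fun j => a (m * Z.of_nat (S d) + Z.of_nat j)%Z) d) l.
Proof.
  intros H. apply is_Cseries_Cmod. intros eps Heps.
  destruct (proj1 (is_Cseries_Cmod _ _) H eps Heps) as [N HN].
  set (b := fun m => Csum (fun j => a (m * Z.of_nat (S d) + Z.of_nat j)%Z) d).
  assert (Hblock : forall k, zfold b k = Csum (fun j => zfold a (S d * k + j)%nat) d).
  { intros k. unfold zfold at 2. rewrite Csum_plus. unfold zfold, b. f_equal.
    - apply Csum_ext. intros j _. f_equal. nia.
    - rewrite <- Csum_rev. apply Csum_ext. intros j Hj. f_equal. nia. }
  assert (E : forall n, Csum (zfold b) n = Csum (zfold a) (d + S d * n)).
  { induction n as [|n IH].
    - rewrite Csum_0, Hblock. rewrite Nat.mul_0_r, Nat.add_0_r. apply sum_n_ext.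
      intros j. reflexivity.
    - rewrite Csum_S, IH, Hblock. replace (d + S d * S n)%nat with ((d + S d * n) + S d)%nat by nia.
      rewrite Csum_add. apply (f_equal (Cplus _)), sum_n_ext. intros j. f_equal. lia. }
  exists N. intros n Hn. rewrite E. apply HN. nia.
Qed.

Lemma ex_series_exp_neg (a : R) : 0 < a -> ex_series (fun n => exp (- (a * INR n))).
Proof.
  intros Ha. apply ex_series_ext with (fun n => exp (- a) ^ n).
  - intros n. rewrite <- exp_mult_INR, Ropp_mult_distr_l. reflexivity.
  - apply ex_series_geom. rewrite Rabs_pos_eq by (left; apply exp_pos).
    rewrite <- exp_0. apply exp_increasing. lra.
Qed.

Lemma Cmod_Cseries_geom (u : nat -> C) (K a : R) : 0 < a ->
  (forall k, Cmod (u k) <= K * exp (- (a * INR k))) -> Cmod (Cseries u) <= K / (1 - exp (- a)).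
Proof.
  intros Ha H. eapply Rle_trans.
  - apply Cmod_Cseries_le with (1 := H).
    apply (ex_series_scal (V := R_NormedModule)), ex_series_exp_neg, Ha.
  - right. rewrite Series_scal_l. unfold Rdiv. f_equal. rewrite <- Series_geom.
    + apply Series_ext. intros k. rewrite <- exp_mult_INR, Ropp_mult_distr_l. reflexivity.
    + rewrite Rabs_pos_eq by (left; apply exp_pos). rewrite <- exp_0. apply exp_increasing. lra.
Qed.

Lemma ex_zseries_exp_neg_abs (a : R) :
  0 < a -> ex_zseries (fun n => exp (- (a * Rabs (IZR n)))).
Proof.
  intros Ha. apply ex_series_le_R with (fun k => 2 * exp (- (a * INR k))).
  - intros k. unfold zfold_R.
    assert (Pk := exp_pos (- (a * Rabs (IZR (Z.of_nat k))))).
    assert (Pneg := exp_pos (- (a * Rabs (IZR (-1 - Z.of_nat k))))).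
    assert (Hk : exp (- (a * Rabs (IZR (Z.of_nat k)))) <= exp (- (a * INR k))).
    { apply exp_le. rewrite <- INR_IZR_INZ, Rabs_pos_eq; [lra|apply pos_INR]. }
    assert (Hneg : exp (- (a * Rabs (IZR (-1 - Z.of_nat k)))) <= exp (- (a * INR k))).
    { apply exp_le. assert (Hk0 := pos_INR k). rewrite minus_IZR, <- INR_IZR_INZ, Rabs_left1 by lra.
      nra. }
    lra.
  - apply (ex_series_scal (V := R_NormedModule)), ex_series_exp_neg, Ha.
Qed.

Lemma ex_zseries_gaussian (a b : R) : 0 < a ->
  ex_zseries (fun n => exp (- (a * (IZR n * IZR n)) + b * Rabs (IZR n))).
Proof.
  intros Ha. set (K := exp ((b + 1) * (b + 1) / (4 * a))).
  apply ex_zseries_le with (fun n => K * exp (- (1 * Rabs (IZR n)))).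
  - intros n. split; [left; apply exp_pos|]. unfold K. rewrite <- exp_plus. apply exp_le.
    set (x := Rabs (IZR n)).
    assert (Ex : IZR n * IZR n = x * x)
      by (unfold x; rewrite <- Rabs_mult, Rabs_pos_eq; nra).
    assert (Hsqr := Rle_0_sqr (x - (b + 1) / (2 * a))). unfold Rsqr in Hsqr.
    apply (Rmult_le_compat_l a) in Hsqr; [|lra].
    replace (a * ((x - (b + 1) / (2 * a)) * (x - (b + 1) / (2 * a))))
      with (a * (x * x) - (b + 1) * x + (b + 1) * (b + 1) / (4 * a)) in Hsqr by (field; lra).
    rewrite Ex. lra.
  - apply ex_zseries_scal, ex_zseries_exp_neg_abs. lra.
Qed.

(** * Series of exponentials *)

Definition exp_series (c a : Z -> C) (z : C) : C := zsum (fun n => c n * e2pi (a n * z))%C.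

Definition exp_summable (c a : Z -> C) (z : C) (r : R) : Prop :=
  ex_zseries (fun n => Cmod (c n) * Cmod (e2pi (a n * z)) * exp (2 * PI * Cmod (a n) * r)).

Lemma Cmod_C2PIi : Cmod C2PIi = 2 * PI.
Proof.
  unfold C2PIi. assert (HPI := PI_RGT_0).
  rewrite Cmod_mult, Cmod_R, Cmod_Ci, Rabs_pos_eq by lra. ring.
Qed.

Lemma Cmod_e2pi_le (w : C) : Cmod (e2pi w) <= exp (2 * PI * Cmod w).
Proof. rewrite <- Cmod_C2PIi, <- Cmod_mult. apply Cmod_Cexp_le. Qed.

Lemma e2pi_taylor1_bound (w : C) :
  Cmod (e2pi w - RtoC 1 - C2PIi * w)
    <= 2 * PI * Cmod w * (2 * PI * Cmod w * exp (2 * PI * Cmod w)).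
Proof. rewrite <- Cmod_C2PIi, <- Cmod_mult. apply Cexp_taylor1_bound. Qed.

Lemma sqr_le_exp (x r : R) : 0 < r -> 0 <= x -> x * x <= 16 / (r * r) * exp (x * r / 2).
Proof.
  intros Hr Hx. apply Rmult_le_reg_l with (r * r); [nra|].
  replace (r * r * (16 / (r * r) * exp (x * r / 2))) with (16 * exp (x * r / 2)) by (field; lra).
  replace (x * r / 2) with (x * r / 4 + x * r / 4) by field. rewrite exp_plus.
  assert (Hexp := exp_ineq1_le (x * r / 4)). assert (0 <= x * r) by nra. nra.
Qed.

Lemma e2pi_taylor1_dominated (a h : C) (r : R) : 0 < r -> Cmod h <= r / 2 ->
  Cmod (e2pi (a * h) - RtoC 1 - C2PIi * (a * h))
    <= 16 / (r * r) * (Cmod h * Cmod h) * exp (2 * PI * Cmod a * r).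
Proof.
  intros Hr Hh. eapply Rle_trans; [apply e2pi_taylor1_bound|]. rewrite Cmod_mult.
  set (m := Cmod h) in *. set (x := 2 * PI * Cmod a).
  assert (Px : 0 <= x).
  { assert (HPI := PI_RGT_0). apply Rmult_le_pos; [lra|apply Cmod_ge_0]. }
  assert (Hsqr := sqr_le_exp x r Hr Px).
  assert (Hexp : exp (x * m) <= exp (x * r / 2)) by (apply exp_le; nra).
  replace (2 * PI * (Cmod a * m)) with (x * m) by (unfold x; ring).
  replace (exp (x * r)) with (exp (x * r / 2) * exp (x * r / 2))
    by (rewrite <- exp_plus; f_equal; field).
  replace (x * m * (x * m * exp (x * m))) with (m * m * (x * x * exp (x * m))) by ring.
  replace (16 / (r * r) * (m * m) * (exp (x * r / 2) * exp (x * r / 2)))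
    with (m * m * (16 / (r * r) * exp (x * r / 2) * exp (x * r / 2))) by ring.
  apply Rmult_le_compat_l; [nra|].
  apply Rmult_le_compat; auto; [nra|left; apply exp_pos].
Qed.

Section ExpSeries.

Variables (c a : Z -> C) (z : C) (r : R).
Hypotheses (Hr : 0 < r) (Hsum : exp_summable c a z r).

Let b (n : Z) : R := Cmod (c n) * Cmod (e2pi (a n * z)) * exp (2 * PI * Cmod (a n) * r).

Lemma exp_summable_zsummable (w : C) :
  Cmod (w - z) <= r -> zsummable (fun n => c n * e2pi (a n * w))%C.
Proof.
  intros Hw. apply (zsummable_le _ b); [|exact Hsum]. intros n. unfold b.
  replace (a n * w)%C with (a n * z + a n * (w - z))%C by ring.
  rewrite e2pi_plus, !Cmod_mult, <- Rmult_assoc.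
  apply Rmult_le_compat_l; [apply Rmult_le_pos; apply Cmod_ge_0|].
  eapply Rle_trans; [apply Cmod_e2pi_le|]. rewrite Cmod_mult, <- Rmult_assoc. apply exp_le.
  assert (HPI := PI_RGT_0). assert (Pa := Cmod_ge_0 (a n)).
  apply Rmult_le_compat_l; [apply Rmult_le_pos; lra|auto].
Qed.

Lemma exp_summable_zsummable_center : zsummable (fun n => c n * e2pi (a n * z))%C.
Proof.
  apply exp_summable_zsummable. replace (z - z)%C with (RtoC 0) by ring. rewrite Cmod_0. lra.
Qed.

Lemma exp_summable_derive_zsummable : zsummable (fun n => c n * a n * e2pi (a n * z))%C.
Proof.
  assert (HPI := PI_RGT_0). assert (Pr : 0 < 2 * PI * r) by nra.
  apply (zsummable_le _ (fun n => / (2 * PI * r) * b n)); [|apply ex_zseries_scal, Hsum].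
  intros n. rewrite !Cmod_mult. unfold b.
  assert (Hexp := exp_ineq1_le (2 * PI * Cmod (a n) * r)).
  replace (Cmod (c n) * Cmod (a n) * Cmod (e2pi (a n * z)))
    with (/ (2 * PI * r) * (Cmod (c n) * Cmod (e2pi (a n * z)) * (2 * PI * Cmod (a n) * r)))
    by (field; lra).
  apply Rmult_le_compat_l; [left; apply Rinv_0_lt_compat; auto|].
  apply Rmult_le_compat_l; [apply Rmult_le_pos; apply Cmod_ge_0|lra].
Qed.

Lemma exp_series_taylor1_bound (w : C) : Cmod (w - z) <= r / 2 ->
  Cmod (exp_series c a w - exp_series c a z
        - C2PIi * exp_series (fun n => c n * a n)%C a z * (w - z))
    <= 16 / (r * r) * (Cmod (w - z) * Cmod (w - z)) * zseries b.
Proof.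
  intros Hw. set (h := Cmod (w - z)) in *. assert (Ph : 0 <= h) by apply Cmod_ge_0.
  assert (Sw := exp_summable_zsummable w ltac:(fold h; lra)).
  assert (Sz := exp_summable_zsummable_center).
  assert (Sd := exp_summable_derive_zsummable).
  assert (E : is_zsum (fun n => c n * e2pi (a n * w) + (RtoC (-1) * (c n * e2pi (a n * z)) +
                         - (C2PIi * (w - z)) * (c n * a n * e2pi (a n * z))))%C
    (exp_series c a w + (RtoC (-1) * exp_series c a z +
       - (C2PIi * (w - z)) * exp_series (fun n => c n * a n) a z))%C).
  { apply is_zsum_plus; [apply zsum_correct, Sw|].
    apply is_zsum_plus; apply is_zsum_scal, zsum_correct; assumption. }
  match goal with |- Cmod ?x <= _ =>
    replace x with (exp_series c a w + (RtoC (-1) * exp_series c a z +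
       - (C2PIi * (w - z)) * exp_series (fun n => c n * a n) a z))%C by ring end.
  rewrite <- (is_zsum_unique _ _ E), <- zseries_scal.
  apply Cmod_zsum_le; [|apply ex_zseries_scal, Hsum]. intros n. unfold b.
  replace (a n * w)%C with (a n * z + a n * (w - z))%C by ring. rewrite e2pi_plus.
  match goal with |- Cmod ?x <= _ =>
    replace x with (c n * e2pi (a n * z) *
      (e2pi (a n * (w - z)) - RtoC 1 - C2PIi * (a n * (w - z))))%C by ring end.
  rewrite !Cmod_mult. set (A := Cmod (c n) * Cmod (e2pi (a n * z))).
  replace (16 / (r * r) * (h * h) * (A * exp (2 * PI * Cmod (a n) * r)))
    with (A * (16 / (r * r) * (h * h) * exp (2 * PI * Cmod (a n) * r))) by ring.
  apply Rmult_le_compat_l; [apply Rmult_le_pos; apply Cmod_ge_0|].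
  apply e2pi_taylor1_dominated; auto.
Qed.

Lemma is_cderive_exp_series :
  is_cderive (exp_series c a) z (C2PIi * exp_series (fun n => c n * a n)%C a z)%C.
Proof.
  apply is_cderive_Cmod. intros eps Heps. apply locally_Cmod.
  set (M := 16 / (r * r) * (zseries b + 1)).
  assert (HB : 0 <= zseries b).
  { apply zseries_ge_0; [|exact Hsum]. intros n. unfold b.
    repeat apply Rmult_le_pos; try apply Cmod_ge_0. left. apply exp_pos. }
  assert (HK : 0 < 16 / (r * r)) by (apply Rdiv_lt_0_compat; nra).
  assert (HM : 0 < M) by (apply Rmult_lt_0_compat; lra).
  exists (Rmin (r / 2) (eps / M)).
  split; [apply Rmin_pos; [lra|apply Rdiv_lt_0_compat; auto]|]. intros w Hw.
  assert (Hw_half := Rlt_le_trans _ _ _ Hw (Rmin_l _ _)).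
  assert (Hw_eps := Rlt_le_trans _ _ _ Hw (Rmin_r _ _)).
  eapply Rle_trans; [apply exp_series_taylor1_bound; lra|].
  assert (Ph := Cmod_ge_0 (w - z)). set (h := Cmod (w - z)) in *.
  apply Rle_trans with (h * M * h).
  - unfold M. nra.
  - apply Rmult_le_compat_r; auto. apply Rmult_lt_compat_r with (r := M) in Hw_eps; auto.
    replace (eps / M * M) with eps in Hw_eps by (field; lra). lra.
Qed.

End ExpSeries.

Lemma exp_summable_derive (c a : Z -> C) (z : C) (r : R) : 0 < r -> exp_summable c a z r ->
  exp_summable (fun n => c n * a n)%C a z (r / 2).
Proof.
  intros Hr H. assert (HPI := PI_RGT_0). assert (Pr : 0 < PI * r) by nra.
  apply ex_zseries_le
    with (fun n => / (PI * r) *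
            (Cmod (c n) * Cmod (e2pi (a n * z)) * exp (2 * PI * Cmod (a n) * r)));
    [|apply ex_zseries_scal, H].
  intros n. rewrite Cmod_mult.
  set (x := 2 * PI * Cmod (a n) * (r / 2)). assert (Px := exp_pos x).
  assert (Pc := Cmod_ge_0 (c n)). assert (Pa := Cmod_ge_0 (a n)).
  assert (Pe := Cmod_ge_0 (e2pi (a n * z))).
  split; [repeat apply Rmult_le_pos; lra|].
  replace (2 * PI * Cmod (a n) * r) with (x + x) by (unfold x; field).
  rewrite exp_plus.
  replace (Cmod (c n) * Cmod (a n) * Cmod (e2pi (a n * z)) * exp x)
    with (/ (PI * r) * (Cmod (c n) * Cmod (e2pi (a n * z)) * (x * exp x)))
    by (unfold x; field; lra).
  apply Rmult_le_compat_l; [left; apply Rinv_0_lt_compat; auto|].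
  apply Rmult_le_compat_l; [apply Rmult_le_pos; auto|].
  apply Rmult_le_compat_r; [lra|]. assert (Hexp := exp_ineq1_le x). lra.
Qed.

(** * Pointwise convergence of Fourier series *)

Definition fourier (u : R -> C) (n : Z) : C :=
  CInt (fun x => u x * e2pi (RtoC (- IZR n * x)))%C 0 1.

Lemma e2pi_R_succ (n : Z) (x : R) :
  e2pi (RtoC (- IZR n * (x + 1))) = e2pi (RtoC (- IZR n * x)).
Proof.
  rewrite Rmult_plus_distr_l, Rmult_1_r, RtoC_plus, e2pi_plus, <- opp_IZR, e2pi_IZR. ring.
Qed.

Lemma CInt_period (u : R -> C) (h : R) : (forall x, ccontinuous u x) ->
  (forall x, u (x + 1) = u x) -> CInt u h (h + 1) = CInt u 0 1.
Proof.
  intros Hc Hp. assert (Hex : forall a b, ex_CInt u a b) by (intros; apply ex_CInt_continuous, Hc).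
  assert (Eshift : CInt u 1 (h + 1) = CInt u 0 h).
  { replace 1 with (0 + 1) at 1 by ring. rewrite <- CInt_translate by auto. apply CInt_ext, Hp. }
  rewrite <- (CInt_Chasles u h 1 (h + 1)), Eshift by auto.
  rewrite Cplus_comm. apply CInt_Chasles; auto.
Qed.

Lemma CInt_periods (u : R -> C) (n : nat) : (forall x, ccontinuous u x) ->
  (forall x, u (x + 1) = u x) -> CInt u 0 (INR n) = (RtoC (INR n) * CInt u 0 1)%C.
Proof.
  intros Hc Hp. induction n as [|n IH].
  - simpl. rewrite Cmult_0_l. exact (RInt_point (V := C_R_CompleteNormedModule) 0 u).
  - rewrite S_INR, <- (CInt_Chasles u 0 (INR n)) by (apply ex_CInt_continuous, Hc).
    rewrite IH, CInt_period, RtoC_plus by assumption. ring.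
Qed.

Lemma ex_fourier (u : R -> C) (n : Z) (a b : R) : (forall x, ccontinuous u x) ->
  ex_CInt (fun x => u x * e2pi (RtoC (- IZR n * x)))%C a b.
Proof.
  intros Hu. apply ex_CInt_continuous. intros x.
  apply ccontinuous_mult; [apply Hu|apply ccontinuous_e2pi_R].
Qed.

Lemma fourier_ext (u v : R -> C) (n : Z) : (forall x, u x = v x) -> fourier u n = fourier v n.
Proof. intros H. unfold fourier. apply CInt_ext. intros x. rewrite H. reflexivity. Qed.

Lemma fourier_plus (u v : R -> C) (n : Z) :
  (forall x, ccontinuous u x) -> (forall x, ccontinuous v x) ->
  fourier (fun x => u x + v x)%C n = (fourier u n + fourier v n)%C.
Proof.
  intros Hu Hv. unfold fourier. rewrite <- CInt_plus by (apply ex_fourier; auto).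
  apply CInt_ext. intros x. ring.
Qed.

Lemma fourier_scal (c : C) (u : R -> C) (n : Z) : (forall x, ccontinuous u x) ->
  fourier (fun x => c * u x)%C n = (c * fourier u n)%C.
Proof.
  intros Hu. unfold fourier. rewrite <- CInt_scal by (apply ex_fourier; auto).
  apply CInt_ext. intros x. ring.
Qed.

Lemma fourier_translate (u : R -> C) (h : R) (n : Z) :
  (forall x, ccontinuous u x) -> (forall x, u (x + 1) = u x) ->
  fourier (fun x => u (x + h)%R) n = (e2pi (RtoC (IZR n * h)) * fourier u n)%C.
Proof.
  intros Hc Hp. unfold fourier.
  set (g := fun x => (u x * e2pi (RtoC (- IZR n * x)))%C).
  assert (Hg : forall a b, ex_CInt g a b) by (intros; apply ex_fourier, Hc).
  rewrite <- (CInt_period g h).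
  - replace (CInt g h (h + 1)) with (CInt (fun x => g (x + h)%R) 0 1)
      by (rewrite CInt_translate by auto; f_equal; ring).
    rewrite <- CInt_scal.
    + apply CInt_ext. intros x. unfold g.
      replace (- IZR n * x) with (IZR n * h + - IZR n * (x + h)) by ring.
      rewrite RtoC_plus, e2pi_plus. ring.
    + apply ex_CInt_continuous. intros x. apply (ccontinuous_translate g).
      apply ccontinuous_mult; [apply Hc|apply ccontinuous_e2pi_R].
  - intros x. apply ccontinuous_mult; [apply Hc|apply ccontinuous_e2pi_R].
  - intros x. unfold g. rewrite Hp, e2pi_R_succ. reflexivity.
Qed.

Lemma Cmod_fourier_le (u : R -> C) (n : Z) (M : R) : (forall x, ccontinuous u x) ->
  (forall x, 0 <= x <= 1 -> Cmod (u x) <= M) -> Cmod (fourier u n) <= M.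
Proof.
  intros Hu HM. unfold fourier. replace M with ((1 - 0) * M) by ring.
  apply Cmod_CInt_le; [lra|apply ex_fourier, Hu|]. intros x Hx.
  rewrite Cmod_mult, Cmod_e2pi_R, Rmult_1_r. auto.
Qed.

Lemma fourier_translate_half_wave (u : R -> C) (n : Z) : n <> 0%Z ->
  (forall x, ccontinuous u x) -> (forall x, u (x + 1) = u x) ->
  fourier (fun x => u (x + / 2 * / IZR n)%R) n = (- fourier u n)%C.
Proof.
  intros Hn Hc Hp. rewrite fourier_translate by auto.
  replace (IZR n * (/ 2 * / IZR n)) with (/ 2) by (field; apply not_0_IZR, Hn).
  rewrite e2pi_half. ring.
Qed.

Lemma fourier_const (c : C) (n : Z) :
  fourier (fun _ => c) n = if Z.eq_dec n 0 then c else RtoC 0.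
Proof.
  destruct (Z.eq_dec n 0) as [->|Hn].
  - unfold fourier. rewrite (CInt_ext _ (fun _ => c)); [rewrite CInt_const|].
    + rewrite Rminus_0_r. ring.
    + intros x. replace (- 0 * x) with 0 by ring. rewrite e2pi_0. ring.
  - assert (E := fourier_translate_half_wave (fun _ => c) n Hn
                   (fun x => continuous_const c x) (fun _ => eq_refl)).
    cbv beta in E. set (a := fourier (fun _ => c) n) in *.
    replace a with (RtoC (/ 2) * (a - - a))%C.
    + rewrite E at 1. rewrite RtoC_inv by lra. field.
    + rewrite RtoC_inv by lra. field.
Qed.

Lemma uniform_ccontinuous (v : R -> C) (a b : R) : (forall x, ccontinuous v x) ->
  forall eps, 0 < eps -> exists d, 0 < d /\ forall x y, a <= x <= b -> a <= y <= b ->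
    Rabs (y - x) < d -> Cmod (v y - v x) <= eps.
Proof.
  intros Hv eps Heps.
  destruct (unifcont_1d (V := C_UniformSpace) v a b) with (eps := mkposreal (eps / 2) ltac:(lra))
    as [d Hd]; [intros; apply Hv|].
  exists d. split; [apply cond_pos|]. intros x y Hx Hy Hxy.
  specialize (Hd x y Hx Hy Hxy). apply NNPP in Hd. destruct Hd as [Hre Him].
  assert (Hre' : Rabs (Re (v y - v x)) < eps / 2) by exact Hre.
  assert (Him' : Rabs (Im (v y - v x)) < eps / 2) by exact Him.
  eapply Rle_trans; [apply Cmod_le_re_im|]. lra.
Qed.

(* Twice the coefficient is the coefficient of [u - u (. + 1 / (2 n))], which is uniformly small. *)
Lemma riemann_lebesgue (u : R -> C) : (forall x, ccontinuous u x) -> (forall x, u (x + 1) = u x) ->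
  forall eps, 0 < eps -> exists N, forall n, (N <= Z.abs n)%Z -> Cmod (fourier u n) <= eps.
Proof.
  intros Hc Hp eps Heps.
  destruct (uniform_ccontinuous u (-1) 2 Hc eps Heps) as [d [Hd Hu]].
  exists (up (/ d) + 1)%Z. intros n Hn.
  assert (Pd := Rinv_0_lt_compat d Hd). destruct (archimed (/ d)) as [Hup _].
  assert (Pup : (0 < up (/ d))%Z) by (apply lt_IZR; lra).
  assert (Nn : n <> 0%Z) by lia.
  set (h := / 2 * / IZR n).
  assert (Hn_gt : / d < Rabs (IZR n)).
  { rewrite <- abs_IZR. apply IZR_le in Hn. rewrite plus_IZR in Hn. lra. }
  assert (Hn_ge_1 : 1 <= Rabs (IZR n)) by (rewrite <- abs_IZR; apply IZR_le; lia).
  assert (Eh : Rabs h = / 2 * / Rabs (IZR n))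
    by (unfold h; rewrite Rabs_mult, (Rabs_inv (IZR n)), Rabs_pos_eq by lra; reflexivity).
  assert (Hinv_le_1 : / Rabs (IZR n) <= 1) by (rewrite <- Rinv_1; apply Rinv_le_contravar; lra).
  assert (Hinv_lt_d : / Rabs (IZR n) < d).
  { rewrite <- (Rinv_inv d). apply Rinv_lt_contravar; auto. apply Rmult_lt_0_compat; lra. }
  assert (Hh := Rabs_def2 h 1 ltac:(lra)).
  assert (Hc' : forall x, ccontinuous (fun x => u (x + h)%R) x)
    by (intros; apply ccontinuous_translate, Hc).
  assert (E : (RtoC 2 * fourier u n)%C = fourier (fun x => u x + RtoC (-1) * u (x + h)%R)%C n).
  { rewrite fourier_plus, fourier_scal; auto.
    - unfold h. rewrite fourier_translate_half_wave by auto. ring.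
    - intros x. apply ccontinuous_mult; [apply continuous_const|auto]. }
  assert (Hbound : Cmod (RtoC 2 * fourier u n) <= eps).
  { rewrite E. apply Cmod_fourier_le.
    - intros x. apply ccontinuous_plus; auto. apply ccontinuous_mult; [apply continuous_const|auto].
    - intros x Hx. replace (u x + RtoC (-1) * u (x + h)%R)%C with (u x - u (x + h)%R)%C by ring.
      apply Hu; try lra. replace (x - (x + h)) with (- h) by ring. rewrite Rabs_Ropp.
      assert (0 < / Rabs (IZR n)) by (apply Rinv_0_lt_compat; lra). lra. }
  rewrite Cmod_mult, Cmod_R, Rabs_pos_eq in Hbound by lra.
  lra.
Qed.

Definition slope (f : R -> C) (x : R) (l : C) (y : R) : C :=
  if Req_dec_T y x then l else ((f y - f x) / RtoC (y - x))%C.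

Lemma ccontinuous_slope (f : R -> C) (x : R) (l : C) :
  is_derive (V := C_R_NormedModule) f x l -> ccontinuous (slope f x l) x.
Proof.
  intros H. apply ccontinuous_Cmod. intros eps Heps.
  generalize (proj1 (is_derive_C_R_Cmod _ _ _) H (eps / 2) ltac:(lra)). apply filter_imp.
  intros y Hy. unfold slope. destruct (Req_dec_T x x) as [_|Nx]; [|congruence].
  destruct (Req_dec_T y x) as [Ex|Nx].
  - replace (l - l)%C with (RtoC 0) by ring. rewrite Cmod_0. exact Heps.
  - assert (Ndiff : RtoC (y - x) <> RtoC 0) by (intros E; apply RtoC_inj in E; lra).
    assert (Hpos : 0 < Rabs (y - x)) by (apply Rabs_pos_lt; lra).
    replace ((f y - f x) / RtoC (y - x) - l)%C
      with ((f y - f x - l * RtoC (y - x)) / RtoC (y - x))%C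
      by (field; auto).
    rewrite Cmod_div, Cmod_R by auto. apply Rle_lt_trans with (eps / 2); [|lra].
    apply Rmult_le_reg_r with (Rabs (y - x)); auto.
    unfold Rdiv at 1. rewrite Rmult_assoc, Rinv_l by lra. lra.
Qed.

Lemma is_derive_e2pi_R_0 : is_derive (V := C_R_NormedModule) (fun x : R => e2pi (RtoC x)) 0 C2PIi.
Proof.
  apply (is_derive_ext (V := C_R_NormedModule) (fun x : R => e2pi (RtoC 0 + RtoC x * RtoC 1))).
  { intros x. f_equal. ring. }
  rewrite <- (Cmult_1_r C2PIi). apply is_derive_line.
  apply is_cderive_eq with (C2PIi * e2pi (RtoC 0 + RtoC 0 * RtoC 1))%C;
    [apply is_cderive_e2pi|].
  replace (RtoC 0 + RtoC 0 * RtoC 1)%C with (RtoC 0) by ring. rewrite e2pi_0. ring.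
Qed.

Section FourierInversion.

Variables (u : R -> C) (l : C).
Hypotheses (Hc : forall x, ccontinuous u x) (Hp : forall x, u (x + 1) = u x)
  (Hd : is_derive (V := C_R_NormedModule) u 0 l).

(* The solution of [u x = u 0 + (e2pi x - 1) * v x]. *)
Definition chernoff_quotient (x : R) : C :=
  if Ceq_dec (e2pi (RtoC x)) (RtoC 1) then (l / C2PIi)%C
  else ((u x - u 0) / (e2pi (RtoC x) - RtoC 1))%C.

Lemma chernoff_quotient_IZR (k : Z) (x : R) : chernoff_quotient (x + IZR k) = chernoff_quotient x.
Proof.
  unfold chernoff_quotient. rewrite RtoC_plus, e2pi_plus, e2pi_IZR, Cmult_1_r, (periodic_IZR u)
    by exact Hp. reflexivity.
Qed.

Lemma ccontinuous_chernoff_quotient_0 : ccontinuous chernoff_quotient 0.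
Proof.
  apply (ccontinuous_ext_loc
    (fun x => slope u 0 l x / slope (fun x => e2pi (RtoC x)) 0 C2PIi x)%C).
  - exists (mkposreal 1 Rlt_0_1). intros x Hx.
    assert (Hx' : Rabs (x - 0) < 1) by exact Hx. rewrite Rminus_0_r in Hx'.
    apply Rabs_lt_between in Hx'. unfold slope, chernoff_quotient.
    destruct (Ceq_dec (e2pi (RtoC x)) (RtoC 1)) as [Ee|Ne]; destruct (Req_dec_T x 0) as [Ex|Nx].
    + reflexivity.
    + exfalso. destruct (e2pi_eq_1 x Ee) as [k ->]. apply Nx.
      assert (-1 < k < 1)%Z by (split; apply lt_IZR; lra). replace k with 0%Z by lia. reflexivity.
    + exfalso. apply Ne. rewrite Ex. apply e2pi_0.
    + rewrite e2pi_0, Rminus_0_r. field.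
      split; [apply Cminus_eq_contra, Ne|intros E; apply Nx, RtoC_inj, E].
  - apply ccontinuous_div; try apply ccontinuous_slope; auto.
    + apply is_derive_e2pi_R_0.
    + unfold slope. destruct (Req_dec_T 0 0); [apply C2PIi_neq_0|congruence].
Qed.

Lemma ccontinuous_chernoff_quotient (x : R) : ccontinuous chernoff_quotient x.
Proof.
  destruct (Ceq_dec (e2pi (RtoC x)) (RtoC 1)) as [Ee|Ne].
  - destruct (e2pi_eq_1 x Ee) as [k ->].
    apply (continuous_ext (fun y => chernoff_quotient (y + IZR (- k)))).
    + intros y. apply chernoff_quotient_IZR.
    + apply ccontinuous_translate. rewrite <- plus_IZR, Z.add_opp_diag_r.
      apply ccontinuous_chernoff_quotient_0.
  - assert (He : forall y : R, ccontinuous (fun y : R => e2pi (RtoC y)) y).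
    { intros y.
      apply (continuous_comp RtoC e2pi); [apply ccontinuous_RtoC|apply ccontinuous_e2pi]. }
    assert (Hn := Cminus_eq_contra _ _ Ne).
    apply (ccontinuous_ext_loc (fun y => (u y - u 0) / (e2pi (RtoC y) - RtoC 1))%C).
    + generalize (proj1 (ccontinuous_Cmod _ _) (He x) _ (proj1 (Cmod_gt_0 _) Hn)).
      apply filter_imp. intros y Hy. unfold chernoff_quotient.
      destruct (Ceq_dec (e2pi (RtoC y)) (RtoC 1)) as [Ee|_]; [|reflexivity].
      rewrite Ee, Cmod_minus_sym in Hy. lra.
    + apply ccontinuous_div; auto; apply ccontinuous_minus; auto; apply continuous_const.
Qed.

(* Chernoff's argument: the Fourier series of [u] at [0] telescopes into Fourier coefficients
   of the quotient. *)
Theorem is_zsum_fourier_0 : is_zsum (fourier u) (u 0).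
Proof.
  set (v := chernoff_quotient).
  assert (Hvc : forall x, ccontinuous v x) by apply ccontinuous_chernoff_quotient.
  assert (Hvp : forall x, v (x + 1) = v x) by (intros; apply (chernoff_quotient_IZR 1)).
  assert (Hev : forall x, ccontinuous (fun x => e2pi (RtoC x) * v x)%C x).
  { intros x. apply ccontinuous_mult; auto.
    apply (continuous_comp RtoC e2pi); [apply ccontinuous_RtoC|apply ccontinuous_e2pi]. }
  assert (Hu : forall x, u x = (u 0 + (e2pi (RtoC x) * v x + RtoC (-1) * v x))%C).
  { intros x. unfold v, chernoff_quotient. destruct (Ceq_dec (e2pi (RtoC x)) (RtoC 1)) as [Ee|Ne].
    - destruct (e2pi_eq_1 x Ee) as [k ->].
      rewrite e2pi_IZR, <- (Rplus_0_l (IZR k)), (periodic_IZR u) by exact Hp. ring.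
    - field. apply Cminus_eq_contra, Ne. }
  assert (Hmv : forall x, ccontinuous (fun x => RtoC (-1) * v x)%C x)
    by (intros; apply ccontinuous_mult; auto; apply continuous_const).
  assert (E : forall n, fourier u n =
    (fourier (fun _ => u 0) n + (fourier v (n - 1) - fourier v n))%C).
  { intros n. rewrite (fourier_ext u _ n Hu).
    rewrite (fourier_plus (fun _ => u 0)), fourier_plus, fourier_scal; auto.
    - replace (fourier (fun x => e2pi (RtoC x) * v x)%C n) with (fourier v (n - 1)); [ring|].
      unfold fourier. apply CInt_ext. intros x.
      replace (- IZR (n - 1) * x) with (x + - IZR n * x) by (rewrite minus_IZR; ring).
      rewrite RtoC_plus, e2pi_plus. ring.
    - intros x. apply continuous_const.
    - intros x. apply ccontinuous_plus; auto. }
  apply (is_zsum_ext _ _ _ (fun n => eq_sym (E n))).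
  assert (Hsum := is_zsum_plus (fourier (fun _ => u 0))
    (fun n => fourier v (n - 1) - fourier v n)%C (u 0) (RtoC 0)).
  rewrite Cplus_0_r in Hsum. apply Hsum.
  - apply (is_zsum_ext (fun n => if Z.eq_dec n 0 then u 0 else RtoC 0));
      [intros n; symmetry; apply fourier_const|]. apply is_zsum_delta.
  - apply is_zsum_telescope, riemann_lebesgue; auto.
Qed.

End FourierInversion.

(** * Periodic holomorphic functions on the upper half plane *)

Definition periodic_on_H (f : C -> C) : Prop :=
  forall z, 0 < Im z -> f (z + RtoC 1)%C = f z.

Lemma Im_pos_of_near (z w : C) : Cmod (w - z) < Im z -> 0 < Im w.
Proof.
  intros H. assert (Him := im_le_Cmod (w - z)).
  assert (Hlt : Rabs (Im (w - z)) < Im z) by lra. apply Rabs_lt_between in Hlt.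
  destruct w, z. simpl in *. lra.
Qed.

Lemma is_cderive_ext_H (f g : C -> C) (z l : C) : 0 < Im z ->
  (forall w, 0 < Im w -> f w = g w) -> is_cderive f z l -> is_cderive g z l.
Proof.
  intros Hz H. apply (is_derive_ext_loc (K := C_AbsRing) (V := C_NormedModule)).
  apply locally_C, locally_Cmod. exists (Im z). split; auto.
  intros w Hw. apply H, (Im_pos_of_near z), Hw.
Qed.

Lemma C_derive_unique_H (f g : C -> C) (z l : C) : 0 < Im z ->
  (forall w, 0 < Im w -> f w = g w) -> is_cderive f z l -> C_derive g z = l.
Proof. intros Hz H Hf. apply is_C_derive_unique, (is_cderive_ext_H f); auto. Qed.

Lemma is_cderive_C_derive (f : C -> C) (z : C) :
  holo_on_H f -> 0 < Im z -> is_cderive f z (C_derive f z).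
Proof. intros Hf Hz. apply (C_derive_correct f z z), Hf, Hz. Qed.

Lemma ccontinuous_H (f : C -> C) (z : C) : holo_on_H f -> 0 < Im z -> ccontinuous f z.
Proof. intros Hf Hz. apply ex_cderive_continuous, Hf, Hz. Qed.

Lemma ccontinuous_real_line (f : C -> C) (z : C) (x : R) :
  holo_on_H f -> 0 < Im z -> ccontinuous (fun x : R => f (z + RtoC x)%C) x.
Proof.
  intros Hf Hz. apply (continuous_ext (fun x : R => f (z + RtoC x * RtoC 1)%C)).
  - intros y. rewrite Cmult_1_r. reflexivity.
  - apply ccontinuous_line, ccontinuous_H; auto. rewrite Cmult_1_r, Im_plus_R. exact Hz.
Qed.

Lemma holo_on_H_ext (f g : C -> C) :
  (forall z, 0 < Im z -> f z = g z) -> holo_on_H f -> holo_on_H g.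
Proof.
  intros H Hf z Hz. destruct (Hf z Hz) as [l Hl]. exists l. apply (is_cderive_ext_H f); auto.
Qed.

Lemma holo_on_H_const (c : C) : holo_on_H (fun _ => c).
Proof. intros z _. exists (RtoC 0). apply is_cderive_const. Qed.

Lemma holo_on_H_plus (f g : C -> C) :
  holo_on_H f -> holo_on_H g -> holo_on_H (fun z => f z + g z)%C.
Proof.
  intros Hf Hg z Hz. destruct (Hf z Hz), (Hg z Hz). eexists. apply is_cderive_plus; eassumption.
Qed.

Lemma holo_on_H_mult (f g : C -> C) :
  holo_on_H f -> holo_on_H g -> holo_on_H (fun z => f z * g z)%C.
Proof. intros Hf Hg z Hz. apply ex_cderive_mult; auto. Qed.

Lemma holo_on_H_scal (c : C) (f : C -> C) : holo_on_H f -> holo_on_H (fun z => c * f z)%C.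
Proof. intros Hf. apply holo_on_H_mult; [apply holo_on_H_const|exact Hf]. Qed.

Lemma holo_on_H_pow (f : C -> C) (n : nat) : holo_on_H f -> holo_on_H (fun z => f z ^ n)%C.
Proof. intros Hf z Hz. apply ex_cderive_pow, Hf, Hz. Qed.

Lemma holo_on_H_id : holo_on_H (fun z => z).
Proof. intros z _. eexists. apply is_cderive_id. Qed.

Lemma holo_on_H_comp (f g : C -> C) : (forall z, 0 < Im z -> 0 < Im (g z)) ->
  holo_on_H f -> holo_on_H g -> holo_on_H (fun z => f (g z)).
Proof. intros Hgz Hf Hg z Hz. apply ex_cderive_comp; auto. Qed.

Lemma holo_on_H_dilation (f : C -> C) (r : R) : 0 < r -> holo_on_H f ->
  holo_on_H (fun z => f (RtoC r * z)%C).
Proof.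
  intros Hr Hf. apply holo_on_H_comp; [|exact Hf|apply holo_on_H_scal, holo_on_H_id].
  intros z Hz. rewrite im_scal_l. apply Rmult_lt_0_compat; assumption.
Qed.

Lemma holo_on_H_inv (f : C -> C) : (forall z, 0 < Im z -> f z <> RtoC 0) ->
  holo_on_H f -> holo_on_H (fun z => / f z)%C.
Proof.
  intros Nf Hf z Hz. apply ex_cderive_comp; [eexists; apply is_cderive_Cinv|]; auto.
Qed.

Lemma holo_on_H_translate (f : C -> C) (w : C) :
  0 <= Im w -> holo_on_H f -> holo_on_H (fun z => f (z + w)%C).
Proof.
  intros Hw Hf. apply holo_on_H_comp; [|exact Hf|].
  - intros z Hz. destruct z, w. simpl in *. lra.
  - apply holo_on_H_plus; [apply holo_on_H_id|apply holo_on_H_const].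
Qed.

Lemma holo_on_H_qpow (n : Z) : holo_on_H (fun z => qpow z n).
Proof. intros z _. eexists. apply is_cderive_qpow. Qed.

Lemma periodic_on_H_plus (f g : C -> C) :
  periodic_on_H f -> periodic_on_H g -> periodic_on_H (fun z => f z + g z)%C.
Proof. intros Hf Hg z Hz. rewrite Hf, Hg by exact Hz. reflexivity. Qed.

Lemma periodic_on_H_mult (f g : C -> C) :
  periodic_on_H f -> periodic_on_H g -> periodic_on_H (fun z => f z * g z)%C.
Proof. intros Hf Hg z Hz. rewrite Hf, Hg by exact Hz. reflexivity. Qed.

Lemma periodic_on_H_scal (c : C) (f : C -> C) :
  periodic_on_H f -> periodic_on_H (fun z => c * f z)%C.
Proof. intros Hf z Hz. rewrite Hf by exact Hz. reflexivity. Qed.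

Lemma periodic_on_H_translate (f : C -> C) (w : C) :
  0 <= Im w -> periodic_on_H f -> periodic_on_H (fun z => f (z + w)%C).
Proof.
  intros Hw Hf z Hz. replace (z + RtoC 1 + w)%C with (z + w + RtoC 1)%C by ring.
  apply Hf. destruct z, w. simpl in *. lra.
Qed.

Lemma periodic_on_H_qpow (n : Z) : periodic_on_H (fun z => qpow z n).
Proof. intros z _. rewrite qpow_translate, qpow_1. ring. Qed.

Lemma periodic_real_line (f : C -> C) (z : C) (x : R) : periodic_on_H f -> 0 < Im z ->
  f (z + RtoC (x + 1))%C = f (z + RtoC x)%C.
Proof. intros Hf Hz. rewrite RtoC_plus, Cplus_assoc. apply Hf. rewrite Im_plus_R. exact Hz. Qed.

Lemma CInt_height (g : C -> C) (y y' : R) : holo_on_H g -> periodic_on_H g -> 0 < y <= y' ->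
  CInt (fun x => g (x, y)) 0 1 = CInt (fun x => g (x, y')) 0 1.
Proof.
  intros Hg Hp Hy.
  assert (Hrect : rect_int g 0 y 1 (y' - y) = RtoC 0).
  { apply Goursat; [lra|lra|]. intros z [_ Hz]. apply Hg. lra. }
  unfold rect_int in Hrect. replace (y + (y' - y)) with y' in Hrect by ring.
  rewrite Rplus_0_l in Hrect.
  replace (CInt (fun v => g (1, v)) y y') with (CInt (fun v => g (0, v)) y y') in Hrect.
  - apply Ceq_minus. rewrite <- Hrect. ring.
  - unfold CInt. apply (RInt_ext (V := C_R_CompleteNormedModule)). intros v Hv.
    rewrite Rmin_left, Rmax_right in Hv by lra.
    rewrite <- (Hp (0, v)) by (simpl; lra). f_equal.
    apply injective_projections; simpl; ring.
Qed.

Lemma CInt_real_line (g : C -> C) (z w : C) : holo_on_H g -> periodic_on_H g ->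
  0 < Im z -> 0 < Im w ->
  CInt (fun x => g (z + RtoC x)%C) 0 1 = CInt (fun x => g (w + RtoC x)%C) 0 1.
Proof.
  intros Hg Hp.
  assert (Hre : forall z, 0 < Im z ->
            CInt (fun x => g (z + RtoC x)%C) 0 1 = CInt (fun x => g (x, Im z)) 0 1).
  { clear z w. intros z Hz.
    assert (Hc : forall x, ccontinuous (fun x => g (x, Im z)) x).
    { intros x. apply ccontinuous_horizontal, ccontinuous_H; auto. }
    rewrite <- (CInt_period (fun x => g (x, Im z)) (Re z)); auto.
    - assert (Etrans := CInt_translate (fun x => g (x, Im z)) (Re z) 0 1
                     (ex_CInt_continuous _ _ _ Hc)).
      rewrite Rplus_0_l, (Rplus_comm 1) in Etrans. rewrite <- Etrans.
      apply CInt_ext. intros x. f_equal. destruct z. apply injective_projections; simpl; ring.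
    - intros x. rewrite <- (Hp (x, Im z)) by exact Hz. f_equal.
      apply injective_projections; simpl; ring. }
  intros Hz Hw. rewrite !Hre by auto.
  destruct (Rle_lt_dec (Im z) (Im w)); [|symmetry]; apply CInt_height; auto; lra.
Qed.

Section LaurentExpansion.

Variable f : C -> C.
Hypotheses (Hf : holo_on_H f) (Hp : periodic_on_H f).

Lemma fcoef_CInt (z : C) (n : Z) : 0 < Im z ->
  fcoef f n = CInt (fun x => f (z + RtoC x) * qpow (z + RtoC x) (- n))%C 0 1.
Proof.
  intros Hz.
  rewrite (CInt_real_line (fun w => f w * qpow w (- n))%C z Ci); auto.
  - unfold fcoef, CInt. apply (RInt_ext (V := C_R_CompleteNormedModule)). intros x _.
    replace (Ci + RtoC x)%C with ((x, 1) : C) by (apply injective_projections; simpl; ring).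
    reflexivity.
  - apply holo_on_H_mult; [exact Hf|apply holo_on_H_qpow].
  - apply periodic_on_H_mult; [exact Hp|apply periodic_on_H_qpow].
  - simpl. lra.
Qed.

Lemma fourier_real_line (z : C) (n : Z) : 0 < Im z ->
  fourier (fun x => f (z + RtoC x)%C) n = (fcoef f n * qpow z n)%C.
Proof.
  intros Hz. rewrite (fcoef_CInt z), Cmult_comm by exact Hz. unfold fourier.
  rewrite <- CInt_scal.
  - apply CInt_ext. intros x. rewrite qpow_translate, (qpow_e2pi (RtoC x)).
    rewrite <- RtoC_mult, opp_IZR.
    replace (qpow z n * (f (z + RtoC x) * (qpow z (- n) * e2pi (RtoC (- IZR n * x)))))%C
      with ((qpow z n * qpow z (- n)) * (f (z + RtoC x) * e2pi (RtoC (- IZR n * x))))%C by ring.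
    rewrite qpow_mul_opp. ring.
  - apply ex_CInt_continuous. intros x.
    apply (ccontinuous_real_line (fun w => f w * qpow w (- n))%C); auto.
    apply holo_on_H_mult; [exact Hf|apply holo_on_H_qpow].
Qed.

Lemma is_zsum_fcoef (z : C) : 0 < Im z -> is_zsum (fun n => fcoef f n * qpow z n)%C (f z).
Proof.
  intros Hz. replace (f z) with (f (z + RtoC 0)%C) by (rewrite Cplus_0_r; reflexivity).
  apply (is_zsum_ext (fourier (fun x => f (z + RtoC x)%C))); [intros; apply fourier_real_line, Hz|].
  destruct (Hf z Hz) as [l Hl].
  apply (is_zsum_fourier_0 (fun x => f (z + RtoC x)%C) l).
  - intros x. apply ccontinuous_real_line; auto.
  - intros x. apply periodic_real_line; auto.
  - apply (is_derive_ext (V := C_R_NormedModule) (fun x : R => f (z + RtoC x * RtoC 1)%C)).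
    { intros x. rewrite Cmult_1_r. reflexivity. }
    rewrite <- (Cmult_1_r l). apply is_derive_line.
    rewrite Cmult_0_l, Cplus_0_r. exact Hl.
Qed.

Lemma Cmod_fcoef_le (n : Z) (y M : R) : 0 < y ->
  (forall x, 0 <= x <= 1 -> Cmod (f (x, y)) <= M) ->
  Cmod (fcoef f n) <= M * exp (2 * PI * IZR n * y).
Proof.
  intros Hy HM. assert (Hz : 0 < Im (0, y)) by exact Hy.
  assert (E := f_equal Cmod (fourier_real_line (0, y) n Hz)). rewrite Cmod_mult, Cmod_qpow in E.
  assert (Hbound : Cmod (fourier (fun x => f ((0, y) + RtoC x)%C) n) <= M).
  { apply Cmod_fourier_le; [intros; apply ccontinuous_real_line; auto|]. intros x Hx.
    replace ((0, y) + RtoC x)%C with ((x, y) : C) by (apply injective_projections; simpl; ring).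
    auto. }
  rewrite E in Hbound. apply Rmult_le_compat_r with (r := exp (2 * PI * IZR n * y)) in Hbound;
    [|left; apply exp_pos].
  rewrite Rmult_assoc, <- exp_plus in Hbound. simpl Im in Hbound.
  replace (- (2 * PI * IZR n * y) + 2 * PI * IZR n * y) with 0 in Hbound by ring.
  rewrite exp_0, Rmult_1_r in Hbound. exact Hbound.
Qed.

Lemma bounded_on_period (y : R) : 0 < y ->
  exists M, forall x, 0 <= x <= 1 -> Cmod (f (x, y)) <= M.
Proof.
  intros Hy.
  destruct (ex_RInt_ub (V := C_R_CompleteNormedModule) (fun x => f (x, y)) 0 1) as [M HM].
  - apply ex_CInt_continuous. intros x. apply ccontinuous_horizontal, ccontinuous_H; auto.
  - exists M. intros x Hx. rewrite Cmod_norm. apply HM. rewrite Rmin_left, Rmax_right by lra. auto.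
Qed.

Lemma exp_summable_fcoef (z : C) : 0 < Im z ->
  exp_summable (fcoef f) (fun n => RtoC (IZR n)) z (Im z / 4).
Proof.
  intros Hz. set (y := Im z) in *. assert (HPI := PI_RGT_0).
  destruct (bounded_on_period (y / 2) ltac:(lra)) as [Mlow Hlow].
  destruct (bounded_on_period (2 * y) ltac:(lra)) as [Mhigh Hhigh].
  apply ex_zseries_le with (fun n => Rmax Mlow Mhigh * exp (- (PI * y / 2 * Rabs (IZR n))));
    [|apply ex_zseries_scal, ex_zseries_exp_neg_abs; nra].
  assert (Hlow_max := Rmax_l Mlow Mhigh). assert (Hhigh_max := Rmax_r Mlow Mhigh).
  assert (Hlow0 : 0 <= Mlow) by (eapply Rle_trans; [apply Cmod_ge_0|apply (Hlow 0); lra]).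
  intros n. rewrite <- qpow_e2pi, Cmod_qpow, Cmod_R. fold y.
  split; [repeat apply Rmult_le_pos; try apply Cmod_ge_0; left; apply exp_pos|].
  rewrite Rmult_assoc, <- exp_plus.
  destruct (Rle_lt_dec 0 (IZR n)) as [Hn|Hn].
  - apply Rle_trans with (Mlow * exp (2 * PI * IZR n * (y / 2)) *
      exp (- (2 * PI * IZR n * y) + 2 * PI * Rabs (IZR n) * (y / 4))).
    + apply Rmult_le_compat_r; [left; apply exp_pos|]. apply Cmod_fcoef_le; [lra|auto].
    + rewrite Rmult_assoc, <- exp_plus, Rabs_pos_eq by exact Hn.
      apply Rmult_le_compat; auto; [left; apply exp_pos|]. apply exp_le. right. field.
  - apply Rle_trans with (Mhigh * exp (2 * PI * IZR n * (2 * y)) *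
      exp (- (2 * PI * IZR n * y) + 2 * PI * Rabs (IZR n) * (y / 4))).
    + apply Rmult_le_compat_r; [left; apply exp_pos|]. apply Cmod_fcoef_le; [lra|auto].
    + rewrite Rmult_assoc, <- exp_plus, Rabs_left by exact Hn.
      assert (Hhigh0 : 0 <= Mhigh) by (eapply Rle_trans; [apply Cmod_ge_0|apply (Hhigh 0); lra]).
      apply Rmult_le_compat; auto; [left; apply exp_pos|]. apply exp_le.
      assert (0 <= PI * y) by nra.
      assert (0 <= PI * y * - IZR n) by (apply Rmult_le_pos; lra). lra.
Qed.

Lemma zsummable_fcoef (z : C) : 0 < Im z -> zsummable (fun n => fcoef f n * qpow z n)%C.
Proof.
  intros Hz. apply (zsummable_ext (fun n => fcoef f n * e2pi (RtoC (IZR n) * z))%C).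
  { intros n. rewrite qpow_e2pi. reflexivity. }
  apply (exp_summable_zsummable_center _ _ z (Im z / 4)); [lra|apply exp_summable_fcoef, Hz].
Qed.

Lemma zsum_fcoef (z : C) : 0 < Im z -> f z = zsum (fun n => fcoef f n * qpow z n)%C.
Proof. intros Hz. symmetry. apply is_zsum_unique, is_zsum_fcoef, Hz. Qed.

Lemma exp_series_fcoef (z : C) : 0 < Im z ->
  exp_series (fcoef f) (fun n => RtoC (IZR n)) z = f z.
Proof.
  intros Hz. rewrite (zsum_fcoef z Hz). apply zsum_ext. intros n. rewrite qpow_e2pi. reflexivity.
Qed.

Lemma C_derive_exp_series (z : C) : 0 < Im z ->
  C_derive f z =
  (C2PIi * exp_series (fun n => fcoef f n * RtoC (IZR n)) (fun n => RtoC (IZR n)) z)%C.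
Proof.
  intros Hz. apply (C_derive_unique_H (exp_series (fcoef f) (fun n => RtoC (IZR n)))); auto.
  - apply exp_series_fcoef.
  - apply (is_cderive_exp_series _ _ z (Im z / 4)); [lra|apply exp_summable_fcoef, Hz].
Qed.

Lemma holo_on_H_C_derive : holo_on_H (C_derive f).
Proof.
  apply (holo_on_H_ext (fun z => C2PIi *
    exp_series (fun n => fcoef f n * RtoC (IZR n)) (fun n => RtoC (IZR n)) z)%C).
  - intros z Hz. symmetry. apply C_derive_exp_series, Hz.
  - apply holo_on_H_scal. intros z Hz. eexists.
    apply (is_cderive_exp_series _ _ z (Im z / 4 / 2)); [lra|].
    apply exp_summable_derive; [lra|apply exp_summable_fcoef, Hz].
Qed.

End LaurentExpansion.

Lemma is_cderive_translate (f : C -> C) (w z l : C) :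
  is_cderive f (z + w)%C l -> is_cderive (fun z => f (z + w)%C) z l.
Proof.
  intros H. apply is_cderive_eq with (l * (RtoC 1 + RtoC 0))%C; [|ring].
  apply (is_cderive_comp f); [exact H|].
  apply is_cderive_plus; [apply is_cderive_id|apply is_cderive_const].
Qed.

Lemma periodic_on_H_C_derive (f : C -> C) :
  holo_on_H f -> periodic_on_H f -> periodic_on_H (C_derive f).
Proof.
  intros Hf Hp z Hz. symmetry. apply (C_derive_unique_H (fun w => f (w + RtoC 1))%C); auto.
  apply is_cderive_translate, is_cderive_C_derive; [exact Hf|rewrite Im_plus_R; exact Hz].
Qed.

Lemma holo_on_H_Csum (f : nat -> C -> C) (n : nat) :
  (forall j, (j <= n)%nat -> holo_on_H (f j)) -> holo_on_H (fun z => Csum (fun j => f j z) n).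
Proof.
  induction n as [|n IH]; intros H.
  - apply (holo_on_H_ext (f O)); [intros z _; rewrite Csum_0; reflexivity|auto].
  - apply (holo_on_H_ext (fun z => Csum (fun j => f j z) n + f (S n) z)%C);
      [intros z _; rewrite Csum_S; reflexivity|].
    apply holo_on_H_plus; auto.
Qed.

Lemma periodic_on_H_Csum (f : nat -> C -> C) (n : nat) :
  (forall j, (j <= n)%nat -> periodic_on_H (f j)) ->
  periodic_on_H (fun z => Csum (fun j => f j z) n).
Proof. intros H z Hz. apply Csum_ext. intros j Hj. apply H; auto. Qed.

(** * Fourier coefficients *)

Lemma fcoef_fourier (f : C -> C) (n : Z) : holo_on_H f -> periodic_on_H f ->
  fcoef f n = (qpow Ci (- n) * fourier (fun x => f (Ci + RtoC x)%C) n)%C.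
Proof.
  intros Hf Hp. rewrite fourier_real_line by (auto; simpl; lra).
  replace (qpow Ci (- n) * (fcoef f n * qpow Ci n))%C
    with (fcoef f n * (qpow Ci n * qpow Ci (- n)))%C by ring.
  rewrite qpow_mul_opp. ring.
Qed.

Lemma fcoef_ext (f g : C -> C) (n : Z) : (forall z, 0 < Im z -> f z = g z) -> fcoef f n = fcoef g n.
Proof.
  intros H. unfold fcoef. apply (RInt_ext (V := C_R_CompleteNormedModule)). intros x _.
  rewrite H by (simpl; lra). reflexivity.
Qed.

Lemma fcoef_0 (n : Z) : fcoef (fun _ => RtoC 0) n = RtoC 0.
Proof.
  change (CInt (fun x => RtoC 0 * qpow (x, 1) (- n))%C 0 1 = RtoC 0).
  rewrite (CInt_ext _ (fun _ => RtoC 0)), CInt_const by (intros; ring). ring.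
Qed.

Section FcoefOperations.

Variables f g : C -> C.
Hypotheses (Hf : holo_on_H f) (Hpf : periodic_on_H f) (Hg : holo_on_H g) (Hpg : periodic_on_H g).

Lemma fcoef_plus (n : Z) : fcoef (fun z => f z + g z)%C n = (fcoef f n + fcoef g n)%C.
Proof.
  rewrite !fcoef_fourier by
    (assumption || apply holo_on_H_plus || apply periodic_on_H_plus; assumption).
  rewrite fourier_plus; [ring| |]; intros x; apply ccontinuous_real_line; auto; simpl; lra.
Qed.

Lemma fcoef_scal (c : C) (n : Z) : fcoef (fun z => c * f z)%C n = (c * fcoef f n)%C.
Proof.
  rewrite !fcoef_fourier by
    (assumption || apply holo_on_H_scal || apply periodic_on_H_scal; assumption).
  rewrite fourier_scal; [ring|]. intros x. apply ccontinuous_real_line; auto. simpl. lra.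
Qed.

Lemma fcoef_translate (w : C) (n : Z) :
  0 <= Im w -> fcoef (fun z => f (z + w)%C) n = (qpow w n * fcoef f n)%C.
Proof.
  intros Hw.
  rewrite (fcoef_fourier (fun z => f (z + w)%C)) by
    (apply holo_on_H_translate || apply periodic_on_H_translate; assumption).
  rewrite (fourier_ext _ (fun x => f ((Ci + w) + RtoC x)%C)) by (intros x; f_equal; ring).
  rewrite fourier_real_line by (auto; destruct w; simpl in *; lra).
  rewrite qpow_translate.
  replace (qpow Ci (- n) * (fcoef f n * (qpow Ci n * qpow w n)))%C
    with (qpow w n * fcoef f n * (qpow Ci n * qpow Ci (- n)))%C by ring.
  rewrite qpow_mul_opp. ring.
Qed.

Lemma fcoef_mult_qpow (k n : Z) : fcoef (fun z => f z * qpow z k)%C n = fcoef f (n - k).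
Proof.
  unfold fcoef. apply (RInt_ext (V := C_R_CompleteNormedModule)). intros x _.
  rewrite <- Cmult_assoc, <- qpow_plus. repeat f_equal. ring.
Qed.

(* Integrating [(f q^(-n))' = f' q^(-n) - 2 pi i n f q^(-n)] over a period gives [0]. *)
Lemma fcoef_C_derive (n : Z) : fcoef (C_derive f) n = (C2PIi * RtoC (IZR n) * fcoef f n)%C.
Proof.
  set (d := fun z => (C_derive f z * qpow z (- n)
                      + f z * (C2PIi * RtoC (IZR (- n)) * qpow z (- n)))%C).
  assert (Hi : 0 < Im Ci) by (simpl; lra).
  assert (Hd := holo_on_H_C_derive f Hf Hpf).
  assert (Hdq : holo_on_H (fun z => C_derive f z * qpow z (- n))%C)
    by (apply holo_on_H_mult; [exact Hd|apply holo_on_H_qpow]).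
  assert (Hfq : holo_on_H (fun z => f z * qpow z (- n))%C)
    by (apply holo_on_H_mult; [exact Hf|apply holo_on_H_qpow]).
  assert (E : is_CInt (fun x => d (Ci + RtoC x * RtoC 1) * RtoC 1)%C 0 1
     (f (Ci + RtoC 1 * RtoC 1) * qpow (Ci + RtoC 1 * RtoC 1) (- n)
      - f (Ci + RtoC 0 * RtoC 1) * qpow (Ci + RtoC 0 * RtoC 1) (- n))%C).
  { apply (is_CInt_cderive_line (fun z => f z * qpow z (- n))%C d); intros x;
      assert (Hx : 0 < Im (Ci + RtoC x * RtoC 1)) by (rewrite Cmult_1_r, Im_plus_R; exact Hi).
    - apply is_cderive_mult; [apply is_cderive_C_derive; auto|apply is_cderive_qpow].
    - apply ccontinuous_H; [|exact Hx]. apply holo_on_H_plus; [exact Hdq|].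
      apply holo_on_H_mult; [exact Hf|]. apply holo_on_H_scal, holo_on_H_qpow. }
  rewrite Cmult_1_r, Cmult_0_l, Cplus_0_r, Hpf, qpow_translate, qpow_1, Cmult_1_r in E by exact Hi.
  apply CInt_unique in E.
  rewrite (CInt_ext _ (fun x => C_derive f (Ci + RtoC x) * qpow (Ci + RtoC x) (- n) +
    (- C2PIi * RtoC (IZR n)) * (f (Ci + RtoC x) * qpow (Ci + RtoC x) (- n))))%C in E.
  2: { intros x. unfold d. rewrite !Cmult_1_r, opp_IZR, RtoC_opp. ring. }
  assert (Cd : forall x, ccontinuous
      (fun x : R => C_derive f (Ci + RtoC x) * qpow (Ci + RtoC x) (- n))%C x)
    by (intros; apply (ccontinuous_real_line _ Ci _ Hdq Hi)).
  assert (Cf : forall x, ccontinuous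
      (fun x : R => f (Ci + RtoC x) * qpow (Ci + RtoC x) (- n))%C x)
    by (intros; apply (ccontinuous_real_line _ Ci _ Hfq Hi)).
  rewrite CInt_plus, CInt_scal in E; try (apply ex_CInt_continuous; auto);
    [|intros x; apply ccontinuous_mult; [apply continuous_const|apply Cf]].
  rewrite <- !fcoef_CInt in E by (auto; apply periodic_on_H_C_derive; auto).
  apply Ceq_minus.
  transitivity (fcoef (C_derive f) n + - C2PIi * RtoC (IZR n) * fcoef f n)%C; [ring|].
  rewrite E. ring.
Qed.

Lemma eq_of_fcoef : (forall n, fcoef f n = fcoef g n) -> forall z, 0 < Im z -> f z = g z.
Proof.
  intros H z Hz. rewrite (zsum_fcoef f Hf Hpf z Hz), (zsum_fcoef g Hg Hpg z Hz).
  apply zsum_ext. intros n. rewrite H. reflexivity.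
Qed.

Lemma fcoef_eq_0_of_growth (K a : R) (n : Z) :
  (forall z, 1 <= Im z -> Cmod (f z) <= K * exp (a * Im z)) -> a + 2 * PI * IZR n < 0 ->
  fcoef f n = RtoC 0.
Proof.
  intros HK Ha. apply Ceq_of_Cmod_le. intros eps Heps.
  replace (fcoef f n - RtoC 0)%C with (fcoef f n) by ring.
  set (b := - (a + 2 * PI * IZR n)). assert (Hb : 0 < b) by (unfold b; lra).
  set (y := Rmax 1 ((Rabs K + 1) / (eps * b))).
  assert (Hy_ge_1 : 1 <= y) by apply Rmax_l.
  assert (Hy_ge : (Rabs K + 1) / (eps * b) <= y) by apply Rmax_r.
  eapply Rle_trans; [apply (Cmod_fcoef_le f Hf Hpf n y (K * exp (a * y))); [lra|]|].
  { intros x _. apply HK. exact Hy_ge_1. }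
  rewrite Rmult_assoc, <- exp_plus.
  replace (a * y + 2 * PI * IZR n * y) with (- (b * y)) by (unfold b; ring). rewrite exp_Ropp.
  apply Rmult_le_reg_r with (exp (b * y)); [apply exp_pos|].
  rewrite Rmult_assoc, Rinv_l, Rmult_1_r by (apply Rgt_not_eq, exp_pos).
  assert (PK := Rle_abs K). assert (Hexp := exp_ineq1_le (b * y)).
  apply Rmult_le_compat_l with (r := eps * b) in Hy_ge; [|nra].
  replace (eps * b * ((Rabs K + 1) / (eps * b))) with (Rabs K + 1) in Hy_ge by (field; split; lra).
  nra.
Qed.

End FcoefOperations.

Lemma fcoef_Csum (f : nat -> C -> C) (n : nat) (m : Z) :
  (forall j, (j <= n)%nat -> holo_on_H (f j)) -> (forall j, (j <= n)%nat -> periodic_on_H (f j)) ->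
  fcoef (fun z => Csum (fun j => f j z) n) m = Csum (fun j => fcoef (f j) m) n.
Proof.
  induction n as [|n IH]; intros Hf Hp.
  - rewrite Csum_0. apply fcoef_ext. intros z _. apply Csum_0.
  - rewrite Csum_S, <- IH by auto.
    rewrite (fcoef_ext _ (fun z => Csum (fun j => f j z) n + f (S n) z)%C)
      by (intros z _; apply Csum_S).
    apply fcoef_plus; auto using holo_on_H_Csum, periodic_on_H_Csum.
Qed.

Lemma translate_eigenfunction (f : C -> C) (w c : C) : holo_on_H f -> periodic_on_H f ->
  0 <= Im w -> (forall n, fcoef f n <> RtoC 0 -> qpow w n = c) ->
  forall z, 0 < Im z -> f (z + w)%C = (c * f z)%C.
Proof.
  intros Hf Hp Hw Hc.
  apply (eq_of_fcoef (fun z => f (z + w)%C) (fun z => c * f z)%C);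
    auto using holo_on_H_translate, periodic_on_H_translate, holo_on_H_scal, periodic_on_H_scal.
  intros n. rewrite fcoef_translate, fcoef_scal by assumption.
  destruct (Ceq_dec (fcoef f n) (RtoC 0)) as [E|N]; [rewrite E; ring|rewrite (Hc n N); reflexivity].
Qed.

Lemma fcoef_qpow (k n : Z) :
  fcoef (fun z => qpow z k) n = if Z.eq_dec n k then RtoC 1 else RtoC 0.
Proof.
  rewrite (fcoef_ext _ (fun z => RtoC 1 * qpow z k)%C), fcoef_mult_qpow by (intros; ring).
  rewrite fcoef_fourier, fourier_const.
  - destruct (Z.eq_dec (n - k) 0), (Z.eq_dec n k); try lia; [|ring].
    replace (- (n - k))%Z with 0%Z by lia. rewrite qpow_0. ring.
  - apply holo_on_H_const.
  - intros z _. reflexivity.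
Qed.

Lemma q_expansion_bounded (f : C -> C) (A : Z) (y0 : R) : holo_on_H f -> periodic_on_H f ->
  (forall n, (n < A)%Z -> fcoef f n = RtoC 0) -> 0 < y0 ->
  exists K, 0 <= K /\ forall z, y0 <= Im z -> Cmod (f z) <= K * exp (- (2 * PI * IZR A * Im z)).
Proof.
  intros Hf Hp HA Hy0. assert (HPI := PI_RGT_0).
  set (b := fun n => Cmod (fcoef f n * qpow (0, y0) n)).
  assert (Hb : ex_zseries b) by apply (zsummable_fcoef f Hf Hp (0, y0) Hy0).
  assert (Pb : 0 <= zseries b) by (apply zseries_ge_0; auto; intros n; apply Cmod_ge_0).
  assert (Pexp := exp_pos (2 * PI * IZR A * y0)).
  exists (exp (2 * PI * IZR A * y0) * zseries b). split; [nra|]. intros z Hz.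
  rewrite (zsum_fcoef f Hf Hp) by lra.
  replace (exp (2 * PI * IZR A * y0) * zseries b * exp (- (2 * PI * IZR A * Im z)))
    with (exp (2 * PI * IZR A * (y0 - Im z)) * zseries b).
  2: { replace (2 * PI * IZR A * (y0 - Im z))
         with (2 * PI * IZR A * y0 + - (2 * PI * IZR A * Im z)) by ring. rewrite exp_plus. ring. }
  rewrite <- zseries_scal. apply Cmod_zsum_le; [|apply ex_zseries_scal, Hb].
  intros n. unfold b. rewrite !Cmod_mult, !Cmod_qpow. destruct (Z_lt_le_dec n A) as [Hn|Hn].
  - rewrite HA, Cmod_0 by exact Hn. lra.
  - replace (exp (2 * PI * IZR A * (y0 - Im z)) *
        (Cmod (fcoef f n) * exp (- (2 * PI * IZR n * Im (0, y0)))))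
      with (Cmod (fcoef f n) * (exp (2 * PI * IZR A * (y0 - Im z)) *
        exp (- (2 * PI * IZR n * y0)))) by (simpl; ring).
    apply Rmult_le_compat_l; [apply Cmod_ge_0|]. rewrite <- exp_plus. apply exp_le.
    apply IZR_le in Hn.
    assert (0 <= PI * (IZR n - IZR A) * (Im z - y0))
      by (apply Rmult_le_pos; [apply Rmult_le_pos|]; lra). lra.
Qed.

Lemma q_expansion_leading_term (f : C -> C) (A : Z) : holo_on_H f -> periodic_on_H f ->
  (forall n, (n < A)%Z -> fcoef f n = RtoC 0) ->
  exists K, 0 <= K /\ forall z, 1 <= Im z ->
    Cmod (f z * qpow z (- A) - fcoef f A) <= K * exp (- (2 * PI * Im z)).
Proof.
  intros Hf Hp HA. set (g := fun z => (f z + - fcoef f A * qpow z A)%C).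
  destruct (q_expansion_bounded g (A + 1) 1) as [K [HK HB]].
  - apply holo_on_H_plus; [exact Hf|apply holo_on_H_scal, holo_on_H_qpow].
  - apply periodic_on_H_plus; [exact Hp|apply periodic_on_H_scal, periodic_on_H_qpow].
  - intros n Hn. unfold g.
    rewrite fcoef_plus, fcoef_scal, fcoef_qpow; auto using holo_on_H_qpow, periodic_on_H_qpow,
      holo_on_H_scal, periodic_on_H_scal.
    destruct (Z.eq_dec n A) as [->|Hne]; [ring|]. rewrite HA by lia. ring.
  - lra.
  - exists K. split; [exact HK|]. intros z Hz. specialize (HB z Hz).
    replace (f z * qpow z (- A) - fcoef f A)%C with (g z * qpow z (- A))%C.
    + rewrite Cmod_mult, Cmod_qpow.
      apply Rmult_le_compat_r with (r := exp (- (2 * PI * IZR (- A) * Im z))) in HB;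
        [|left; apply exp_pos].
      eapply Rle_trans; [exact HB|]. rewrite Rmult_assoc, <- exp_plus, plus_IZR, opp_IZR.
      right. f_equal. f_equal. ring.
    + unfold g. transitivity (f z * qpow z (- A) - fcoef f A * (qpow z A * qpow z (- A)))%C;
        [ring|]. rewrite qpow_mul_opp. ring.
Qed.

Lemma fcoef_eq_of_leading_term (f : C -> C) (A : Z) (a : C) (K : R) :
  holo_on_H f -> periodic_on_H f ->
  (forall z, 1 <= Im z -> Cmod (f z * qpow z (- A) - a) <= K * exp (- (2 * PI * Im z))) ->
  fcoef f A = a.
Proof.
  intros Hf Hp HK. assert (HPI := PI_RGT_0).
  assert (Hq : holo_on_H (fun z => - a * qpow z A)%C) by (apply holo_on_H_scal, holo_on_H_qpow).
  assert (Hpq : periodic_on_H (fun z => - a * qpow z A)%C)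
    by (apply periodic_on_H_scal, periodic_on_H_qpow).
  assert (E : fcoef (fun z => f z + - a * qpow z A)%C A = RtoC 0).
  { apply fcoef_eq_0_of_growth with (K := K) (a := - (2 * PI * IZR (A + 1))).
    - apply holo_on_H_plus; auto.
    - apply periodic_on_H_plus; auto.
    - intros z Hz.
      replace (f z + - a * qpow z A)%C with (qpow z A * (f z * qpow z (- A) - a))%C.
      + rewrite Cmod_mult, Cmod_qpow.
        eapply Rle_trans; [apply Rmult_le_compat_l; [left; apply exp_pos|apply HK, Hz]|].
        rewrite Rmult_comm, Rmult_assoc, <- exp_plus, plus_IZR. right. f_equal. f_equal. ring.
      + transitivity (f z * (qpow z A * qpow z (- A)) - a * qpow z A)%C; [ring|].
        rewrite qpow_mul_opp. ring.
    - rewrite plus_IZR. nra. }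
  rewrite fcoef_plus, fcoef_scal, fcoef_qpow in E;
    auto using holo_on_H_qpow, periodic_on_H_qpow.
  destruct (Z.eq_dec A A); [|congruence]. apply Ceq_minus. rewrite <- E. ring.
Qed.

Lemma fcoef_mult_leading (f g : C -> C) (A B : Z) :
  holo_on_H f -> periodic_on_H f -> (forall n, (n < A)%Z -> fcoef f n = RtoC 0) ->
  holo_on_H g -> periodic_on_H g -> (forall n, (n < B)%Z -> fcoef g n = RtoC 0) ->
  fcoef (fun z => f z * g z)%C (A + B) = (fcoef f A * fcoef g B)%C.
Proof.
  intros Hf Hpf HA Hg Hpg HB.
  destruct (q_expansion_leading_term f A Hf Hpf HA) as [K [HK Hlead_f]].
  destruct (q_expansion_leading_term g B Hg Hpg HB) as [L [HL Hlead_g]].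
  set (a := fcoef f A) in *. set (b := fcoef g B) in *.
  apply fcoef_eq_of_leading_term with (K * (Cmod b + L) + Cmod a * L).
  - apply holo_on_H_mult; auto.
  - apply periodic_on_H_mult; auto.
  - intros z Hz. specialize (Hlead_f z Hz). specialize (Hlead_g z Hz).
    set (F := (f z * qpow z (- A))%C) in *. set (G := (g z * qpow z (- B))%C) in *.
    set (e := exp (- (2 * PI * Im z))) in *. assert (Pe : 0 < e) by apply exp_pos.
    assert (He : e <= 1) by (rewrite <- exp_0; apply exp_le; assert (HPI := PI_RGT_0); nra).
    replace (f z * g z * qpow z (- (A + B)) - a * b)%C with ((F - a) * G + a * (G - b))%C
      by (unfold F, G; rewrite Z.opp_add_distr, qpow_plus; ring).
    eapply Rle_trans; [apply Cmod_triangle|]. rewrite !Cmod_mult.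
    assert (Htri := Cmod_triangle_rev G b).
    assert (Hfg : Cmod (F - a) * Cmod G <= K * e * (Cmod b + L))
      by (apply Rmult_le_compat; try apply Cmod_ge_0; nra).
    assert (Hgb : Cmod a * Cmod (G - b) <= Cmod a * (L * e))
      by (apply Rmult_le_compat_l; [apply Cmod_ge_0|exact Hlead_g]).
    lra.
Qed.

Lemma fcoef_mult_low (f g : C -> C) (A B n : Z) :
  holo_on_H f -> periodic_on_H f -> (forall n, (n < A)%Z -> fcoef f n = RtoC 0) ->
  holo_on_H g -> periodic_on_H g -> (forall n, (n < B)%Z -> fcoef g n = RtoC 0) ->
  (n < A + B)%Z -> fcoef (fun z => f z * g z)%C n = RtoC 0.
Proof.
  intros Hf Hpf HA Hg Hpg HB Hn. replace n with (n - B + B)%Z by ring.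
  rewrite fcoef_mult_leading; auto; [|intros k Hk; apply HA; lia].
  rewrite HA by lia. ring.
Qed.

(** * Reduction theory on the upper half plane *)

Lemma neq_0_of_Im_pos (z : C) : 0 < Im z -> z <> RtoC 0.
Proof. intros H E. rewrite E in H. simpl in H. lra. Qed.

Lemma Im_Copp_Cinv (z : C) : Im (- / z) = Im z / Cmod z ^ 2.
Proof. rewrite Cmod2_alt. destruct z as [x y]. simpl. unfold Rdiv. ring. Qed.

Lemma Im_Copp_Cinv_pos (z : C) : 0 < Im z -> 0 < Im (- / z).
Proof.
  intros H. rewrite Im_Copp_Cinv. apply Rdiv_lt_0_compat; [exact H|].
  apply pow_lt, Cmod_gt_0, neq_0_of_Im_pos, H.
Qed.

Lemma Copp_Cinv_involutive (z : C) : z <> RtoC 0 -> (- / (- / z))%C = z.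
Proof. intros H. field. exact H. Qed.

Lemma is_cderive_Copp_Cinv (z : C) : z <> RtoC 0 -> is_cderive (fun z => - / z)%C z (/ (z * z))%C.
Proof.
  intros Nz.
  apply (is_derive_ext (K := C_AbsRing) (V := C_NormedModule) (fun z => RtoC (-1) * / z)%C).
  - intros w. change ((RtoC (-1) * / w)%C = (- / w)%C). ring.
  - apply is_cderive_eq with (RtoC (-1) * - / (z * z))%C; [|ring].
    apply is_cderive_scal, is_cderive_Cinv, Nz.
Qed.

Lemma holo_on_H_Copp_Cinv : holo_on_H (fun z => - / z)%C.
Proof. intros z Hz. eexists. apply is_cderive_Copp_Cinv, neq_0_of_Im_pos, Hz. Qed.

Lemma translate_invariant_IZR (P : C -> Prop) (k : Z) (z : C) :
  (forall z, 0 < Im z -> (P (z + RtoC 1)%C <-> P z)) -> 0 < Im z ->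
  (P (z + RtoC (IZR k))%C <-> P z).
Proof.
  intros HT Hz. revert k. apply Z.bi_induction.
  - intros x y ->. reflexivity.
  - rewrite Cplus_0_r. reflexivity.
  - intros k. rewrite <- (HT (z + RtoC (IZR k))%C) by (rewrite Im_plus_R; exact Hz).
    unfold Z.succ. rewrite plus_IZR, RtoC_plus, Cplus_assoc. reflexivity.
Qed.

Lemma exists_integer_translate (z : C) : exists k : Z, Rabs (Re (z + RtoC (IZR k))) <= / 2.
Proof.
  destruct z as [x y]. exists (- up (x - / 2))%Z. destruct (archimed (x - / 2)) as [Hlt Hle].
  rewrite opp_IZR. simpl. apply Rabs_le. lra.
Qed.

Lemma Im_Copp_Cinv_ge (z : C) : 0 < Im z <= 3 / 4 -> Rabs (Re z) <= / 2 ->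
  16 / 13 * Im z <= Im (- / z).
Proof.
  intros Hz HR. apply Rabs_le_between in HR. rewrite Im_Copp_Cinv, Cmod2_alt.
  assert (Hm : 0 < Re z ^ 2 + Im z ^ 2 <= 13 / 16) by nra.
  set (m := Re z ^ 2 + Im z ^ 2) in *. apply Rmult_le_reg_r with m; [lra|].
  replace (Im z / m * m) with (Im z) by (field; lra). nra.
Qed.

(* The region [3/4 <= Im z] contains the standard fundamental domain of [SL2(Z)]: the inversion
   multiplies [Im z] by at least [16/13] when [Im z <= 3/4] and [|Re z| <= 1/2]. *)
Lemma upper_half_ind (P : C -> Prop) :
  (forall z, 0 < Im z -> (P (z + RtoC 1)%C <-> P z)) ->
  (forall z, 0 < Im z -> P (- / z)%C -> P z) ->
  (forall z, 3 / 4 <= Im z -> P z) ->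
  forall z, 0 < Im z -> P z.
Proof.
  intros HT HS HF.
  assert (Hpow : forall n z, 3 / 4 * (13 / 16) ^ n <= Im z -> P z).
  { induction n as [|n IH]; intros z Hz; [apply HF; simpl in Hz; lra|].
    assert (Hpos : 0 < (13 / 16) ^ n) by (apply pow_lt; lra). simpl in Hz.
    destruct (exists_integer_translate z) as [k Hk].
    apply (translate_invariant_IZR P k z HT); [nra|].
    destruct (Rle_lt_dec (3 / 4) (Im z)) as [Hy|Hy]; [apply HF; rewrite Im_plus_R; exact Hy|].
    assert (Hinv := Im_Copp_Cinv_ge (z + RtoC (IZR k))). rewrite Im_plus_R in Hinv.
    apply HS; [rewrite Im_plus_R; nra|]. apply IH.
    assert (Hinv' : 16 / 13 * Im z <= Im (- / (z + RtoC (IZR k)))) by (apply Hinv; [nra|exact Hk]).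
    lra. }
  intros z Hz. destruct (pow_lt_1_zero (13 / 16)) with (y := Im z) as [n Hlim]; [|exact Hz|].
  - rewrite Rabs_pos_eq; lra.
  - apply (Hpow n). assert (Hpos : 0 < (13 / 16) ^ n) by (apply pow_lt; lra).
    specialize (Hlim n (le_n n)). rewrite Rabs_pos_eq in Hlim; lra.
Qed.

(** * Inversion of the theta function *)

Definition gaussian (s z : C) : C := e2pi (s * (z * z)).

Definition gauss_theta (s z : C) : C := zsum (fun m => gaussian s (z + RtoC (IZR m))).

Section GaussTheta.

Variable s : C.
Hypothesis Hs : 0 < Im s.

Let c (m : Z) : C := e2pi (s * RtoC (IZR m * IZR m)).
Let a (m : Z) : C := (RtoC (2 * IZR m) * s)%C.

Lemma exp_summable_gaussian (z : C) : exp_summable c a z 1.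
Proof.
  assert (HPI := PI_RGT_0).
  apply ex_zseries_le with (fun m => exp (- (2 * PI * Im s * (IZR m * IZR m))
                                       + 4 * PI * Cmod s * (Cmod z + 1) * Rabs (IZR m)));
    [|apply ex_zseries_gaussian; nra].
  intros m. split; [repeat apply Rmult_le_pos; try apply Cmod_ge_0; left; apply exp_pos|].
  eapply Rle_trans.
  { apply Rmult_le_compat_r; [left; apply exp_pos|].
    apply Rmult_le_compat_l; [apply Cmod_ge_0|apply Cmod_e2pi_le]. }
  unfold c, a. rewrite Cmod_e2pi, Cmult_comm, im_scal_l, !Cmod_mult, Cmod_R, Rabs_mult,
    (Rabs_pos_eq 2) by lra. rewrite <- !exp_plus. right. f_equal. ring.
Qed.

Lemma gaussian_translate (z : C) (m : Z) :
  gaussian s (z + RtoC (IZR m)) = (gaussian s z * (c m * e2pi (a m * z)))%C.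
Proof.
  unfold gaussian, c, a. rewrite <- !e2pi_plus, !RtoC_mult. f_equal. ring.
Qed.

Lemma zsummable_gaussian (z : C) : zsummable (fun m => gaussian s (z + RtoC (IZR m))).
Proof.
  apply (zsummable_ext (fun m => gaussian s z * (c m * e2pi (a m * z)))%C).
  { intros m. symmetry. apply gaussian_translate. }
  apply zsummable_scal, (exp_summable_zsummable_center c a z 1);
    [apply Rlt_0_1|apply exp_summable_gaussian].
Qed.

Lemma gauss_theta_exp_series (z : C) :
  gauss_theta s z = (gaussian s z * exp_series c a z)%C.
Proof.
  apply is_zsum_unique.
  apply (is_zsum_ext (fun m => gaussian s z * (c m * e2pi (a m * z)))%C).
  { intros m. symmetry. apply gaussian_translate. }
  apply is_zsum_scal, zsum_correct, (exp_summable_zsummable_center c a z 1);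
    [apply Rlt_0_1|apply exp_summable_gaussian].
Qed.

Lemma ex_cderive_gauss_theta (z : C) : ex_cderive (gauss_theta s) z.
Proof.
  apply (ex_derive_ext (K := C_AbsRing) (V := C_NormedModule)
           (fun z => gaussian s z * exp_series c a z)%C).
  { intros w. symmetry. apply gauss_theta_exp_series. }
  apply (ex_cderive_mult (gaussian s) (exp_series c a)).
  - apply (ex_cderive_comp e2pi (fun z => s * (z * z))%C).
    + eexists. apply is_cderive_e2pi.
    + eexists. apply is_cderive_scal, is_cderive_mult; apply is_cderive_id.
  - eexists. apply (is_cderive_exp_series c a z 1); [lra|apply exp_summable_gaussian].
Qed.

Lemma holo_on_H_gauss_theta : holo_on_H (gauss_theta s).
Proof. intros z _. apply ex_cderive_gauss_theta. Qed.

Lemma gauss_theta_periodic (z : C) : gauss_theta s (z + RtoC 1) = gauss_theta s z.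
Proof.
  symmetry. apply is_zsum_unique.
  apply (is_zsum_ext (fun m => gaussian s (z + RtoC 1 + RtoC (IZR (m - 1))))).
  { intros m. rewrite minus_IZR, RtoC_minus.
    replace (z + RtoC 1 + (RtoC (IZR m) - RtoC 1))%C with (z + RtoC (IZR m))%C by ring.
    reflexivity. }
  apply (is_zsum_pred (fun m => gaussian s (z + RtoC 1 + RtoC (IZR m)))).
  apply zsummable_gaussian.
Qed.

Lemma periodic_on_H_gauss_theta : periodic_on_H (gauss_theta s).
Proof. intros z _. apply gauss_theta_periodic. Qed.

Lemma gauss_theta_quasi_periodic (z : C) :
  gauss_theta s (z + - / (RtoC 2 * s)) = (e2pi (/ (RtoC 4 * s) + - z) * gauss_theta s z)%C.
Proof.
  assert (Ns := neq_0_of_Im_pos s Hs). apply is_zsum_unique.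
  apply (is_zsum_ext (fun m => e2pi (/ (RtoC 4 * s) + - z) * gaussian s (z + RtoC (IZR m)))%C).
  - intros m. unfold gaussian.
    replace (s * ((z + - / (RtoC 2 * s) + RtoC (IZR m)) * (z + - / (RtoC 2 * s) + RtoC (IZR m))))%C
      with ((/ (RtoC 4 * s) + - z) + s * ((z + RtoC (IZR m)) * (z + RtoC (IZR m)))
            + RtoC (IZR (- m)))%C by (rewrite opp_IZR, RtoC_opp; field; auto).
    rewrite (e2pi_plus _ (RtoC (IZR (- m)))), e2pi_IZR, (e2pi_plus _ (s * _)). ring.
  - apply is_zsum_scal, zsum_correct, zsummable_gaussian.
Qed.

Definition gauss_int : C := fcoef (gauss_theta s) 0.

Lemma fcoef_gauss_theta_succ (n : Z) :
  fcoef (gauss_theta s) (n + 1) =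
  (e2pi (- (RtoC (IZR (2 * n + 1)) * / (RtoC 4 * s))) * fcoef (gauss_theta s) n)%C.
Proof.
  assert (Ns := neq_0_of_Im_pos s Hs). set (w := (- / (RtoC 2 * s))%C).
  assert (Hw : 0 < Im w).
  { apply Im_Copp_Cinv_pos. rewrite im_scal_l. lra. }
  assert (E := fcoef_translate _ holo_on_H_gauss_theta periodic_on_H_gauss_theta w n
    (Rlt_le _ _ Hw)).
  rewrite (fcoef_ext _ (fun z => e2pi (/ (RtoC 4 * s)) * (gauss_theta s z * qpow z (-1)))%C) in E.
  2: { intros z _. unfold w. rewrite gauss_theta_quasi_periodic, e2pi_plus, qpow_e2pi.
       replace (RtoC (IZR (-1)) * z)%C with (- z)%C by ring. ring. }
  rewrite fcoef_scal, fcoef_mult_qpow in E.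
  - replace (n - -1)%Z with (n + 1)%Z in E by ring.
    replace (fcoef (gauss_theta s) (n + 1)) with
      (e2pi (- / (RtoC 4 * s)) * (e2pi (/ (RtoC 4 * s)) * fcoef (gauss_theta s) (n + 1)))%C.
    + rewrite E, qpow_e2pi, Cmult_assoc, <- e2pi_plus. f_equal. f_equal. unfold w.
      rewrite plus_IZR, mult_IZR, RtoC_plus, RtoC_mult. field. exact Ns.
    + rewrite Cmult_assoc, <- e2pi_plus.
      replace (- / (RtoC 4 * s) + / (RtoC 4 * s))%C with (RtoC 0) by ring.
      rewrite e2pi_0. ring.
  - apply holo_on_H_mult; [apply holo_on_H_gauss_theta|apply holo_on_H_qpow].
  - apply periodic_on_H_mult; [apply periodic_on_H_gauss_theta|apply periodic_on_H_qpow].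
Qed.

Lemma fcoef_gauss_theta (n : Z) :
  fcoef (gauss_theta s) n = (gauss_int * e2pi (- (RtoC (IZR n * IZR n) * / (RtoC 4 * s))))%C.
Proof.
  assert (Hstep : forall m, fcoef (gauss_theta s) m =
            (gauss_int * e2pi (- (RtoC (IZR m * IZR m) * / (RtoC 4 * s))))%C <->
          fcoef (gauss_theta s) (m + 1) =
            (gauss_int * e2pi (- (RtoC (IZR (m + 1) * IZR (m + 1)) * / (RtoC 4 * s))))%C).
  { intros m. rewrite fcoef_gauss_theta_succ.
    replace (- (RtoC (IZR (m + 1) * IZR (m + 1)) * / (RtoC 4 * s)))%C
      with (- (RtoC (IZR (2 * m + 1)) * / (RtoC 4 * s)) +
            - (RtoC (IZR m * IZR m) * / (RtoC 4 * s)))%C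
      by (rewrite !plus_IZR, mult_IZR, !RtoC_mult, !RtoC_plus, RtoC_mult; ring).
    rewrite e2pi_plus. set (E := e2pi (- (RtoC (IZR (2 * m + 1)) * / (RtoC 4 * s)))).
    split; intros H; [rewrite H; ring|].
    assert (NE : E <> RtoC 0) by apply e2pi_neq_0.
    replace (fcoef (gauss_theta s) m) with (E * fcoef (gauss_theta s) m / E)%C by (field; auto).
    rewrite H. field. exact NE. }
  revert n. apply Z.bi_induction; [intros x y ->; reflexivity| |exact Hstep].
  fold gauss_int. rewrite Rmult_0_l, Cmult_0_l.
  replace (- RtoC 0)%C with (RtoC 0) by ring. rewrite e2pi_0. ring.
Qed.

End GaussTheta.

Lemma theta_zsum (tau : C) : 0 < Im tau ->
  theta tau = zsum (fun m => gaussian tau (RtoC (IZR m))).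
Proof.
  intros Ht. set (u := fun k : nat => qpow tau (Z.of_nat k * Z.of_nat k)).
  assert (Hgq : forall m, gaussian tau (RtoC (IZR m)) = qpow tau (m * m)).
  { intros m. unfold gaussian. rewrite qpow_e2pi, mult_IZR, RtoC_mult. f_equal. ring. }
  assert (Hu : ex_series (fun k => Cmod (u k))).
  { assert (H := zsummable_gaussian tau Ht (RtoC 0)).
    revert H. apply ex_series_le_R. intros k. split; [apply Cmod_ge_0|].
    unfold zfold_R. rewrite !Cplus_0_l, !Hgq.
    assert (Hneg := Cmod_ge_0 (qpow tau ((-1 - Z.of_nat k) * (-1 - Z.of_nat k)))). unfold u. lra. }
  symmetry. apply is_zsum_unique.
  apply (is_Cseries_ext (fun k => u k + u (S k))%C).
  { intros k. unfold zfold, u. rewrite !Hgq. f_equal. f_equal. lia. }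
  replace (theta tau) with (Cseries u + Cseries (fun k => u (S k)))%C.
  - apply (is_series_plus (K := C_AbsRing) (V := C_NormedModule)); apply Cseries_correct;
      [exact Hu|]. apply (ex_series_incr_1 (fun k => Cmod (u k))), Hu.
  - rewrite (Cseries_incr_1 u Hu). unfold u at 1. simpl (Z.of_nat 0 * Z.of_nat 0)%Z. rewrite qpow_0.
    apply injective_projections; simpl; unfold u; ring.
Qed.

Lemma theta_gauss_theta (tau : C) : 0 < Im tau -> theta tau = gauss_theta tau (RtoC 0).
Proof.
  intros Ht. rewrite theta_zsum by exact Ht. apply zsum_ext. intros m. rewrite Cplus_0_l.
  reflexivity.
Qed.

Lemma theta_inversion (s : C) : 0 < Im s ->
  theta s = (gauss_int s * theta (- / (RtoC 4 * s)))%C.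
Proof.
  intros Hs. assert (Ns := neq_0_of_Im_pos s Hs).
  set (w := (- / (RtoC 2 * s))%C). set (t := (- / (RtoC 4 * s))%C).
  assert (Hw : 0 < Im w) by (apply Im_Copp_Cinv_pos; rewrite im_scal_l; lra).
  assert (Ht : 0 < Im t) by (apply Im_Copp_Cinv_pos; rewrite im_scal_l; lra).
  assert (Q := gauss_theta_quasi_periodic s Hs (RtoC 0)). fold w in Q.
  rewrite Cplus_0_l, <- theta_gauss_theta in Q by exact Hs.
  replace (/ (RtoC 4 * s) + - RtoC 0)%C with (- t)%C in Q by (unfold t; ring).
  replace (theta s) with (e2pi t * gauss_theta s w)%C.
  2: { rewrite Q, Cmult_assoc, <- e2pi_plus. replace (t + - t)%C with (RtoC 0) by ring.
       rewrite e2pi_0. ring. }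
  rewrite (theta_gauss_theta t Ht), <- (gauss_theta_periodic t Ht).
  assert (Hser : is_zsum (fun n => gauss_int s * gaussian t (RtoC 0 + RtoC 1 + RtoC (IZR n)))%C
                   (e2pi t * gauss_theta s w)%C).
  - apply (is_zsum_ext (fun n => e2pi t * (fcoef (gauss_theta s) n * qpow w n))%C).
    + intros n. rewrite fcoef_gauss_theta, qpow_e2pi by exact Hs. unfold gaussian.
      rewrite <- Cmult_assoc, <- e2pi_plus, Cmult_assoc, (Cmult_comm (e2pi t)), <- Cmult_assoc,
        <- e2pi_plus.
      f_equal. f_equal. unfold t, w. rewrite RtoC_mult. field. exact Ns.
    + apply is_zsum_scal, is_zsum_fcoef; auto using holo_on_H_gauss_theta,
        periodic_on_H_gauss_theta.
  - rewrite <- (is_zsum_unique _ _ Hser).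
    apply is_zsum_unique, is_zsum_scal, zsum_correct, zsummable_gaussian, Ht.
Qed.

Lemma fcoef_0_dilation (g : C -> C) (n : nat) : holo_on_H g -> periodic_on_H g ->
  fcoef (fun z => g (RtoC (INR (S n)) * z)%C) 0 = fcoef g 0.
Proof.
  intros Hg Hp. set (N := INR (S n)). assert (HN : 0 < N) by apply lt_0_INR, Nat.lt_0_succ.
  set (u := fun x => g (RtoC N * Ci + RtoC x)%C).
  assert (Hu : forall x, ccontinuous u x).
  { intros x. apply ccontinuous_real_line; [exact Hg|]. rewrite im_scal_l. simpl. lra. }
  rewrite (fcoef_CInt g Hg Hp (RtoC N * Ci)) by (rewrite im_scal_l; simpl; lra).
  rewrite (CInt_ext _ u) by (intros x; rewrite qpow_0, Cmult_1_r; reflexivity).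
  transitivity (CInt (fun x => u (N * x + 0)) 0 1).
  - apply CInt_ext. intros x. rewrite qpow_0, Cmult_1_r, Rplus_0_r. unfold u. f_equal.
    apply injective_projections; simpl; ring.
  - rewrite CInt_comp_lin by (lra || apply ex_CInt_continuous, Hu).
    replace (N * 0 + 0) with 0 by ring. replace (N * 1 + 0) with N by ring.
    unfold N at 2. rewrite CInt_periods; [|exact Hu|].
    + fold N. rewrite Cmult_assoc, <- RtoC_mult, Rinv_l by lra. ring.
    + intros x. apply periodic_real_line; [exact Hp|]. rewrite im_scal_l. simpl. lra.
Qed.

Lemma Im_Cdiv_sqr_pos (z : C) (r : R) : 0 < Im z -> 0 < r -> 0 < Im (z / (RtoC r * RtoC r)).
Proof.
  intros Hz Hr. unfold Cdiv. rewrite Cmult_comm, <- RtoC_mult, <- RtoC_inv, im_scal_l by nra.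
  apply Rmult_lt_0_compat; [apply Rinv_0_lt_compat; nra|exact Hz].
Qed.

Lemma gauss_theta_dilation (s z : C) (n : nat) : 0 < Im s ->
  gauss_theta (s / (RtoC (INR (S n)) * RtoC (INR (S n)))) (RtoC (INR (S n)) * z)
  = Csum (fun j => gauss_theta s (z + RtoC (INR j / INR (S n)))) n.
Proof.
  intros Hs. set (N := INR (S n)). assert (HN : 0 < N) by apply lt_0_INR, Nat.lt_0_succ.
  assert (NN : RtoC N <> RtoC 0) by (apply RtoC_neq_0; lra).
  assert (HsN := Im_Cdiv_sqr_pos s N Hs HN).
  assert (R := is_zsum_residues _ _ n (zsum_correct _ (zsummable_gaussian _ HsN (RtoC N * z)))).
  unfold gauss_theta at 1. rewrite <- (is_zsum_unique _ _ R). apply is_zsum_unique.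
  apply (is_zsum_ext (fun m => Csum (fun j =>
           gaussian s (z + RtoC (INR j / N) + RtoC (IZR m)))%C n)).
  - intros m. apply Csum_ext. intros j _. unfold gaussian. f_equal.
    rewrite plus_IZR, mult_IZR, <- !INR_IZR_INZ, RtoC_plus, RtoC_mult. unfold Rdiv. fold N.
    rewrite RtoC_mult, RtoC_inv by lra. field. exact NN.
  - apply is_zsum_Csum. intros j. apply zsum_correct, zsummable_gaussian, Hs.
Qed.

Lemma gauss_int_dilation (s : C) (n : nat) : 0 < Im s ->
  gauss_int (s / (RtoC (INR (S n)) * RtoC (INR (S n)))) = (RtoC (INR (S n)) * gauss_int s)%C.
Proof.
  intros Hs. set (N := INR (S n)). assert (HN : 0 < N) by apply lt_0_INR, Nat.lt_0_succ.
  assert (HsN := Im_Cdiv_sqr_pos s N Hs HN).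
  assert (Hj : forall j, 0 <= Im (RtoC (INR j / N))) by (intros j; apply Rle_refl).
  unfold gauss_int at 1. rewrite <- (fcoef_0_dilation _ n) by
    auto using holo_on_H_gauss_theta, periodic_on_H_gauss_theta.
  rewrite (fcoef_ext _ _ _ (fun z _ => gauss_theta_dilation s z n Hs)).
  rewrite (fcoef_Csum (fun j z => gauss_theta s (z + RtoC (INR j / N))%C)).
  - rewrite (Csum_ext _ (fun _ => gauss_int s)).
    + apply Csum_const.
    + intros j _. rewrite fcoef_translate, qpow_0, Cmult_1_l by
        auto using holo_on_H_gauss_theta, periodic_on_H_gauss_theta. reflexivity.
  - intros j _. apply holo_on_H_translate; auto using holo_on_H_gauss_theta.
  - intros j _. apply periodic_on_H_translate; auto using periodic_on_H_gauss_theta.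
Qed.

(* The automorphy factor of theta: up to an eighth root of unity, [theta_factor z] is
   [sqrt (z / 2)]. *)
Definition theta_factor (z : C) : C := gauss_int (- / z).

Lemma theta_Copp_Cinv (z : C) : 0 < Im z ->
  theta (- / z) = (theta_factor z * theta (RtoC (/ 4) * z))%C.
Proof.
  intros Hz. assert (Nz := neq_0_of_Im_pos z Hz).
  rewrite theta_inversion by (apply Im_Copp_Cinv_pos, Hz). unfold theta_factor. f_equal. f_equal.
  rewrite RtoC_inv by lra. field. exact Nz.
Qed.

Lemma theta_factor_dilation (z : C) (n : nat) : 0 < Im z ->
  theta_factor (RtoC (INR (S n)) * RtoC (INR (S n)) * z) = (RtoC (INR (S n)) * theta_factor z)%C.
Proof.
  intros Hz. assert (HN := lt_0_INR _ (Nat.lt_0_succ n)). unfold theta_factor.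
  rewrite <- (gauss_int_dilation (- / z) n) by (apply Im_Copp_Cinv_pos, Hz). f_equal.
  field. split; [apply neq_0_of_Im_pos, Hz|apply RtoC_neq_0; lra].
Qed.

(** * The theta vector *)

(* [theta (z / 4)] is the sum of [q^(m^2/4)]; the even [m] contribute [theta z]. *)
Definition theta_odd (z : C) : C := (theta (RtoC (/ 4) * z) - theta z)%C.

Lemma theta_odd_gauss_theta (z : C) : 0 < Im z -> theta_odd z = gauss_theta z (RtoC (/ 2)).
Proof.
  intros Hz. unfold theta_odd. rewrite !theta_gauss_theta by (try rewrite im_scal_l; lra).
  assert (D := gauss_theta_dilation z (RtoC 0) 1 Hz).
  rewrite Csum_S, Csum_0 in D. simpl INR in D.
  replace (z / (RtoC (1 + 1) * RtoC (1 + 1)))%C with (RtoC (/ 4) * z)%C in D.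
  2: { unfold Cdiv. rewrite <- RtoC_mult, <- RtoC_inv, Cmult_comm by lra. reflexivity. }
  rewrite Cmult_0_r, !Cplus_0_l in D. rewrite D.
  replace (0 / (1 + 1)) with 0 by field. replace (1 / (1 + 1)) with (/ 2) by field. ring.
Qed.

Lemma theta_S (z : C) : 0 < Im z ->
  theta (- / z) = (theta_factor z * (theta z + theta_odd z))%C.
Proof. intros Hz. rewrite theta_Copp_Cinv by exact Hz. f_equal. unfold theta_odd. ring. Qed.

Lemma theta_odd_S (z : C) : 0 < Im z ->
  theta_odd (- / z) = (theta_factor z * (theta z - theta_odd z))%C.
Proof.
  intros Hz. assert (Nz := neq_0_of_Im_pos z Hz). unfold theta_odd at 1.
  rewrite theta_S by exact Hz.
  replace (RtoC (/ 4) * (- / z))%C with (- / (RtoC 4 * z))%C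
    by (rewrite RtoC_inv by lra; field; exact Nz).
  rewrite theta_Copp_Cinv by (rewrite im_scal_l; lra).
  assert (D := theta_factor_dilation z 1 Hz). change (INR 2) with 2 in D.
  replace (RtoC 4 * z)%C with (RtoC 2 * RtoC 2 * z)%C
    by (rewrite <- RtoC_mult; f_equal; f_equal; ring).
  rewrite D. replace (RtoC (/ 4) * (RtoC 2 * RtoC 2 * z))%C with z; [ring|].
  transitivity (RtoC (/ 4 * (2 * 2)) * z)%C; [|rewrite !RtoC_mult; ring].
  replace (/ 4 * (2 * 2)) with 1 by field. ring.
Qed.

Lemma gaussian_Cplus_1 (z w : C) : gaussian (z + RtoC 1) w = (gaussian z w * e2pi (w * w))%C.
Proof. unfold gaussian. rewrite <- e2pi_plus. f_equal. ring. Qed.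

Lemma theta_T (z : C) : 0 < Im z -> theta (z + RtoC 1) = theta z.
Proof.
  intros Hz. rewrite !theta_zsum by (try rewrite Im_plus_R; exact Hz).
  apply zsum_ext. intros m. rewrite gaussian_Cplus_1, <- RtoC_mult, <- mult_IZR, e2pi_IZR. ring.
Qed.

Lemma theta_odd_T (z : C) : 0 < Im z -> theta_odd (z + RtoC 1) = (Ci * theta_odd z)%C.
Proof.
  intros Hz. rewrite !theta_odd_gauss_theta by (try rewrite Im_plus_R; exact Hz).
  apply is_zsum_unique.
  apply (is_zsum_ext (fun m => Ci * gaussian z (RtoC (/ 2) + RtoC (IZR m)))%C).
  - intros m. rewrite gaussian_Cplus_1, <- RtoC_plus, <- RtoC_mult.
    replace ((/ 2 + IZR m) * (/ 2 + IZR m)) with (IZR (m * m + m) + / 4)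
      by (rewrite plus_IZR, mult_IZR; field).
    rewrite (RtoC_plus _ (/ 4)), e2pi_plus, e2pi_IZR, e2pi_quarter. ring.
  - apply is_zsum_scal, zsum_correct, zsummable_gaussian, Hz.
Qed.

Lemma exp_neg_9_8 : exp (- (9 / 8)) <= 5 / 14.
Proof.
  rewrite exp_Ropp. replace (5 / 14) with (/ (14 / 5)) by field. apply Rinv_le_contravar; [lra|].
  replace (9 / 8) with (9 / 64 * INR 8) by (simpl; field). rewrite exp_mult_INR.
  apply Rle_trans with ((1 + 9 / 64) ^ 8); [lra|]. apply pow_incr. split; [lra|apply exp_ineq1_le].
Qed.

Lemma exp_neg_9_2 : exp (- (9 / 2)) <= / 60.
Proof.
  replace (- (9 / 2)) with (- (9 / 8) * INR 4) by (simpl; field). rewrite exp_mult_INR.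
  apply Rle_trans with ((5 / 14) ^ 4); [|lra]. apply pow_incr.
  split; [left; apply exp_pos|apply exp_neg_9_8].
Qed.

Lemma theta_Cseries (z : C) :
  theta z = (RtoC 1 + RtoC 2 * Cseries (fun k => qpow z (Z.of_nat (S k) * Z.of_nat (S k))))%C.
Proof. apply injective_projections; simpl; ring. Qed.

Lemma theta_bound (z : C) : 3 / 4 <= Im z -> Cmod (theta z - RtoC 1) <= / 8.
Proof.
  intros Hz. assert (HPI := PI2_3_2). set (a := 2 * PI * Im z).
  assert (Ha : 9 / 2 <= a) by (unfold a; nra).
  assert (He : exp (- a) <= / 60) by (eapply Rle_trans; [|apply exp_neg_9_2]; apply exp_le; lra).
  rewrite theta_Cseries. set (u := fun k => qpow z (Z.of_nat (S k) * Z.of_nat (S k))).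
  replace (RtoC 1 + RtoC 2 * Cseries u - RtoC 1)%C with (RtoC 2 * Cseries u)%C by ring.
  rewrite Cmod_mult, Cmod_R, Rabs_pos_eq by lra.
  assert (Htail : Cmod (Cseries u) <= exp (- a) / (1 - exp (- a))).
  { apply Cmod_Cseries_geom; [lra|]. intros k. unfold u. rewrite Cmod_qpow, <- exp_plus.
    apply exp_le.
    rewrite mult_IZR, <- INR_IZR_INZ, S_INR. assert (Hk := pos_INR k).
    replace (- (2 * PI * ((INR k + 1) * (INR k + 1)) * Im z))
      with (- (a * ((INR k + 1) * (INR k + 1)))) by (unfold a; ring). nra. }
  apply Rle_trans with (2 * / 59); [|lra]. apply Rmult_le_compat_l; [lra|].
  eapply Rle_trans; [exact Htail|]. apply Rle_div_l; lra.
Qed.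

Lemma zfold_gaussian_half (z : C) (k : nat) :
  zfold (fun m => gaussian z (RtoC (/ 2) + RtoC (IZR m))) k
  = (RtoC 2 * e2pi (RtoC ((INR k + / 2) * (INR k + / 2)) * z))%C.
Proof.
  unfold zfold, gaussian. rewrite minus_IZR, <- INR_IZR_INZ, <- !RtoC_plus, <- !RtoC_mult.
  replace ((/ 2 + (-1 - INR k)) * (/ 2 + (-1 - INR k))) with ((INR k + / 2) * (INR k + / 2))
    by field.
  rewrite (Rplus_comm (/ 2)), (Cmult_comm z). ring.
Qed.

Lemma Cmod_e2pi_half_odd_sqr_le (z : C) (k : nat) : 0 < Im z ->
  Cmod (e2pi (RtoC ((INR (S k) + / 2) * (INR (S k) + / 2)) * z))
  <= exp (- (PI / 2 * Im z)) * exp (- (2 * PI * Im z)) ^ 2 * exp (- (2 * PI * Im z * INR k)).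
Proof.
  intros Hz. assert (HPI := PI_RGT_0).
  rewrite Cmod_e2pi, im_scal_l, S_INR, <- exp_mult_INR, <- !exp_plus.
  apply exp_le. simpl (INR 2). set (y := PI * Im z). assert (Hy : 0 < y) by (unfold y; nra).
  replace (2 * PI * ((INR k + 1 + / 2) * (INR k + 1 + / 2) * Im z))
    with (2 * y * ((INR k + 1 + / 2) * (INR k + 1 + / 2))) by (unfold y; ring).
  replace (PI / 2 * Im z) with (y / 2) by (unfold y; field).
  replace (2 * PI * Im z) with (2 * y) by (unfold y; ring).
  assert (Hk := pos_INR k).
  assert (Hyk : 0 <= y * INR k) by nra. assert (Hykk : 0 <= y * INR k * INR k) by nra. lra.
Qed.

Lemma theta_odd_bound (z : C) : 3 / 4 <= Im z ->
  Cmod (theta_odd z - RtoC 2 * e2pi (RtoC (/ 4) * z)) <= / 50 * exp (- (PI / 2 * Im z)).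
Proof.
  intros Hz. assert (HPI := PI2_3_2). set (r := exp (- (PI / 2 * Im z))).
  set (a := 2 * PI * Im z). set (e := exp (- a)). assert (Ha : 9 / 2 <= a) by (unfold a; nra).
  assert (He : e <= / 60) by (eapply Rle_trans; [|apply exp_neg_9_2]; apply exp_le; lra).
  assert (Hepos := exp_pos (- a) : 0 < e). assert (Hr := exp_pos (- (PI / 2 * Im z)) : 0 < r).
  rewrite theta_odd_gauss_theta by lra. unfold gauss_theta, zsum.
  rewrite Cseries_incr_1 by (apply zsummable_zfold, zsummable_gaussian; lra).
  rewrite zfold_gaussian_half. simpl INR. replace ((0 + / 2) * (0 + / 2)) with (/ 4) by field.
  set (u := Cseries _). set (v := (RtoC 2 * e2pi (RtoC (/ 4) * z))%C).
  replace (v + u - v)%C with u by ring.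
  assert (Htail : Cmod u <= 2 * (r * e ^ 2) / (1 - e)).
  { apply Cmod_Cseries_geom; [lra|]. intros k.
    rewrite zfold_gaussian_half, Cmod_mult, Cmod_R, Rabs_pos_eq, Rmult_assoc by lra.
    apply Rmult_le_compat_l; [lra|]. apply Cmod_e2pi_half_odd_sqr_le. lra. }
  eapply Rle_trans; [exact Htail|]. apply Rle_div_l; [lra|].
  apply Rle_trans with (r * (2 * e ^ 2)); [lra|].
  apply Rle_trans with (r * (/ 50 * (1 - e))); [|lra]. apply Rmult_le_compat_l; [lra|nra].
Qed.

Lemma theta_vector_bounds (z : C) : 3 / 4 <= Im z ->
  7 / 8 <= Cmod (theta z) <= 9 / 8 /\
  198 / 100 * exp (- (PI / 2 * Im z)) <= Cmod (theta_odd z)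
    <= 202 / 100 * exp (- (PI / 2 * Im z)) /\
  Cmod (theta_odd z) <= 73 / 100.
Proof.
  intros Hz. assert (HPI := PI2_3_2). set (r := exp (- (PI / 2 * Im z))).
  assert (Htheta := theta_bound z Hz). assert (Hodd := theta_odd_bound z Hz). fold r in Hodd.
  set (v := (RtoC 2 * e2pi (RtoC (/ 4) * z))%C) in Hodd.
  assert (Hr_le : r <= 5 / 14) by (eapply Rle_trans; [|apply exp_neg_9_8]; apply exp_le; nra).
  assert (Hv : Cmod v = 2 * r).
  { unfold v, r. rewrite Cmod_mult, Cmod_R, Rabs_pos_eq, Cmod_e2pi, im_scal_l by lra.
    f_equal. f_equal. field. }
  assert (Htheta_ge := Cmod_triangle_rev (theta z) (RtoC 1)).
  assert (Htheta_le := Cmod_triangle_rev (RtoC 1) (theta z)).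
  assert (Hodd_ge := Cmod_triangle_rev (theta_odd z) v).
  assert (Hodd_le := Cmod_triangle_rev v (theta_odd z)).
  rewrite Cmod_1 in Htheta_ge, Htheta_le. rewrite Cmod_minus_sym in Htheta_le, Hodd_le.
  rewrite Hv in Hodd_ge, Hodd_le. lra.
Qed.

(* [x y (x^4 - y^4)] is the invariant of degree six of the octahedral group, through which
   [SL2(Z)] acts projectively on the theta vector. *)
Definition theta_disc (z : C) : C :=
  (theta z * theta_odd z * (theta z ^ 4 - theta_odd z ^ 4))%C.

Lemma theta_disc_bounds (z : C) : 3 / 4 <= Im z ->
  / 2 * exp (- (PI / 2 * Im z)) <= Cmod (theta_disc z) <= 5 * exp (- (PI / 2 * Im z)).
Proof.
  intros Hz. destruct (theta_vector_bounds z Hz) as [Hx [[Hy_ge Hy_le] Hy_small]].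
  set (r := exp (- (PI / 2 * Im z))) in *. assert (Hr : 0 < r) by apply exp_pos.
  unfold theta_disc. rewrite !Cmod_mult.
  assert (Hw_ge := Cmod_triangle_rev (theta z ^ 4) (theta_odd z ^ 4)).
  assert (Hw_le := Cmod_triangle_minus (theta z ^ 4) (theta_odd z ^ 4)).
  set (w := Cmod (theta z ^ 4 - theta_odd z ^ 4)) in *. rewrite !Cmod_pow in Hw_ge, Hw_le.
  set (x := Cmod (theta z)) in *. set (y := Cmod (theta_odd z)) in *.
  assert (Hx4 : (7 / 8) ^ 4 <= x ^ 4 <= (9 / 8) ^ 4) by (split; apply pow_incr; lra).
  assert (Hy4 : 0 <= y ^ 4 <= (73 / 100) ^ 4).
  { split; [apply pow_le|apply pow_incr]; lra. }
  assert (Hxy_ge : 7 / 8 * (198 / 100 * r) <= x * y) by (apply Rmult_le_compat; lra).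
  assert (Hxy_le : x * y <= 9 / 8 * (202 / 100 * r)) by (apply Rmult_le_compat; lra).
  split.
  - apply Rle_trans with (7 / 8 * (198 / 100 * r) * (30 / 100)); [lra|]. apply Rmult_le_compat; lra.
  - apply Rle_trans with (9 / 8 * (202 / 100 * r) * (189 / 100)); [apply Rmult_le_compat; lra|lra].
Qed.

Lemma theta_disc_T (z : C) : 0 < Im z -> theta_disc (z + RtoC 1) = (Ci * theta_disc z)%C.
Proof.
  intros Hz. unfold theta_disc. rewrite theta_T, theta_odd_T, Cpow_mult_l by exact Hz.
  replace (Ci ^ 4)%C with (RtoC 1) by (apply injective_projections; simpl; ring). ring.
Qed.

Lemma theta_disc_S (z : C) : 0 < Im z ->
  theta_disc (- / z) = (RtoC 8 * theta_factor z ^ 6 * theta_disc z)%C.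
Proof. intros Hz. unfold theta_disc. rewrite theta_S, theta_odd_S by exact Hz. ring. Qed.

Lemma theta_disc_neq_0 (z : C) : 0 < Im z -> theta_disc z <> RtoC 0.
Proof.
  revert z. apply upper_half_ind.
  - intros z Hz. rewrite theta_disc_T by exact Hz. split; intros H E; apply H.
    + rewrite E. ring.
    + destruct (Cmult_integral _ _ E) as [E'|E']; [destruct (Ci_nz E')|exact E'].
  - intros z Hz H E. apply H. rewrite theta_disc_S, E by exact Hz. ring.
  - intros z Hz E. assert (H := proj1 (theta_disc_bounds z Hz)). rewrite E, Cmod_0 in H.
    assert (Hexp := exp_pos (- (PI / 2 * Im z))). lra.
Qed.

Lemma theta_neq_0 (z : C) : 0 < Im z -> theta z <> RtoC 0.
Proof.
  intros Hz E. apply (theta_disc_neq_0 z Hz). unfold theta_disc. rewrite E. ring.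
Qed.

Lemma theta_factor_inv (z : C) : 0 < Im z ->
  (RtoC 2 * theta_factor z * theta_factor (- / z))%C = RtoC 1.
Proof.
  intros Hz. assert (E := theta_S (- / z) (Im_Copp_Cinv_pos z Hz)).
  rewrite Copp_Cinv_involutive, theta_S, theta_odd_S in E by auto using neq_0_of_Im_pos.
  assert (N := theta_neq_0 z Hz).
  replace (RtoC 2 * theta_factor z * theta_factor (- / z))%C with
    (theta_factor (- / z) * (theta_factor z * (theta z + theta_odd z)
       + theta_factor z * (theta z - theta_odd z)) / theta z)%C by (field; exact N).
  rewrite <- E. field. exact N.
Qed.

Lemma holo_on_H_theta : holo_on_H theta.
Proof.
  intros z Hz. assert (HPI := PI_RGT_0).
  set (sqr := fun m => RtoC (IZR (m * m))).
  exists (C2PIi * exp_series (fun m => RtoC 1 * sqr m) sqr z)%C.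
  apply (is_cderive_ext_H (exp_series (fun _ => RtoC 1) sqr) theta z _ Hz).
  - intros w Hw. rewrite theta_zsum by exact Hw. apply zsum_ext. intros m.
    unfold gaussian, sqr. rewrite <- RtoC_mult, <- mult_IZR, (Cmult_comm w). ring.
  - apply is_cderive_exp_series with (Im z / 2); [lra|].
    apply ex_zseries_le with (fun m => exp (- (PI * Im z * (IZR m * IZR m)) + 0 * Rabs (IZR m)));
      [|apply ex_zseries_gaussian; nra].
    intros m. unfold sqr. rewrite Cmod_1, Rmult_1_l, Cmod_e2pi, im_scal_l, Cmod_R, mult_IZR.
    rewrite <- exp_plus, Rabs_pos_eq by apply Rle_0_sqr. split; [left; apply exp_pos|].
    apply exp_le. lra.
Qed.

Lemma holo_on_H_theta_odd : holo_on_H theta_odd.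
Proof.
  apply (holo_on_H_ext (fun z => theta (RtoC (/ 4) * z) + RtoC (-1) * theta z)%C).
  - intros z _. unfold theta_odd. ring.
  - apply holo_on_H_plus; [apply holo_on_H_dilation; [lra|]|apply holo_on_H_scal];
      apply holo_on_H_theta.
Qed.

Lemma dilation_invariant_constant (phi : R -> R) (x y : R) :
  (forall x, 0 < x -> continuous phi x) ->
  (forall n x, 0 < x -> phi (INR (S n) * x) = phi x) -> 0 < x -> 0 < y -> phi x = phi y.
Proof.
  intros Hc Hd Hx Hy. apply NNPP. intros Nphi.
  assert (Hgap : 0 < Rabs (phi x - phi y)) by (apply Rabs_pos_lt; lra).
  destruct (proj1 (filterlim_locally phi (phi y)) (Hc y Hy) (mkposreal _ Hgap)) as [d Hdelta].
  destruct (nfloor_ex (x / d)) as [q [_ Hq]].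
  { apply Rlt_le, Rdiv_lt_0_compat; [exact Hx|apply cond_pos]. }
  set (Q := INR (S q)). assert (HQ : 0 < Q) by apply lt_0_INR, Nat.lt_0_succ.
  assert (HxQ : x / Q < d).
  { apply Rlt_div_l; [exact HQ|]. unfold Q. rewrite S_INR. assert (Hd_pos := cond_pos d).
    apply Rlt_div_l in Hq; lra. }
  destruct (nfloor_ex (y / (x / Q))) as [p [Hp_le Hp_gt]].
  { apply Rlt_le, Rdiv_lt_0_compat; [exact Hy|apply Rdiv_lt_0_compat; assumption]. }
  set (w := INR (S p) * (x / Q)).
  assert (Ew : phi w = phi x).
  { unfold w. rewrite Hd by (apply Rdiv_lt_0_compat; assumption).
    rewrite <- (Hd q (x / Q)) by (apply Rdiv_lt_0_compat; assumption). f_equal. fold Q. field.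
    lra. }
  apply (Rlt_irrefl (Rabs (phi x - phi y))). rewrite <- Ew at 1. apply Hdelta.
  change (Rabs (w - y) < d). unfold w. rewrite S_INR.
  assert (Hs : 0 < x / Q) by (apply Rdiv_lt_0_compat; assumption).
  apply Rle_div_r in Hp_le; [|exact Hs]. apply Rlt_div_l in Hp_gt; [|exact Hs].
  rewrite Rabs_pos_eq; lra.
Qed.

Lemma theta_Cconj (z : C) : theta (- Cconj z) = Cconj (theta z).
Proof.
  rewrite !theta_Cseries.
  set (u := fun k => qpow z (Z.of_nat (S k) * Z.of_nat (S k))).
  rewrite (Cseries_ext _ (fun k => Cconj (u k))).
  - unfold Cseries. apply injective_projections; simpl.
    + ring.
    + rewrite Series_opp. ring.
  - intros k. unfold u. rewrite !qpow_e2pi, <- e2pi_Cconj. f_equal.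
    apply injective_projections; simpl; ring.
Qed.

Lemma theta_factor_quotient (z : C) : 0 < Im z ->
  theta_factor z = (theta (- / z) / theta (RtoC (/ 4) * z))%C.
Proof.
  intros Hz. rewrite theta_Copp_Cinv by exact Hz. field. apply theta_neq_0. rewrite im_scal_l. lra.
Qed.

Lemma Im_Copp_Cconj (z : C) : Im (- Cconj z) = Im z.
Proof. destruct z. simpl. ring. Qed.

Lemma Cmod_theta_factor_Cconj (z : C) : 0 < Im z ->
  Cmod (theta_factor (- Cconj z)) = Cmod (theta_factor z).
Proof.
  intros Hz. assert (Nz := neq_0_of_Im_pos z Hz).
  assert (Ntheta : theta (RtoC (/ 4) * z) <> RtoC 0) by (apply theta_neq_0; rewrite im_scal_l; lra).
  rewrite !theta_factor_quotient by (try rewrite Im_Copp_Cconj; exact Hz).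
  replace (- / - Cconj z)%C with (- Cconj (- / z))%C.
  2: { rewrite Copp_conj, Cinv_conj by exact Nz.
       field. apply Cconj_neq_0, Nz. }
  replace (RtoC (/ 4) * - Cconj z)%C with (- Cconj (RtoC (/ 4) * z))%C
    by (apply injective_projections; simpl; ring).
  rewrite !theta_Cconj, <- Cdiv_conj, Cmod_conj by exact Ntheta. reflexivity.
Qed.

Lemma holo_on_H_theta_factor : holo_on_H theta_factor.
Proof.
  apply (holo_on_H_ext (fun z => theta (- / z) * / theta (RtoC (/ 4) * z))%C).
  - intros z Hz. symmetry. apply theta_factor_quotient, Hz.
  - apply holo_on_H_mult.
    + apply holo_on_H_comp;
        [exact Im_Copp_Cinv_pos|apply holo_on_H_theta|apply holo_on_H_Copp_Cinv].
    + apply holo_on_H_inv; [|apply holo_on_H_dilation; [lra|apply holo_on_H_theta]].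
      intros z Hz. apply theta_neq_0. rewrite im_scal_l. lra.
Qed.

Lemma continuous_Cmod_ray (f : C -> C) (z : C) (x : R) : holo_on_H f -> 0 < Im z -> 0 < x ->
  continuous (fun x : R => Cmod (f (RtoC (x * x) * z)%C) / x) x.
Proof.
  intros Hf Hz Hx. assert (Hxx : 0 < x * x) by nra.
  apply (continuous_mult (K := R_AbsRing) (fun x => Cmod (f (RtoC (x * x) * z)%C)) (fun x => / x)).
  - apply continuous_Cmod, (continuous_comp (fun x : R => RtoC (x * x) * z)%C f).
    + apply ccontinuous_mult; [|apply continuous_const].
      apply (continuous_comp (fun x : R => x * x) RtoC); [|apply ccontinuous_RtoC].
      apply (continuous_mult (K := R_AbsRing)); apply continuous_id.
    + apply ccontinuous_H; [exact Hf|]. rewrite im_scal_l. apply Rmult_lt_0_compat; assumption.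
  - apply continuous_Rinv. lra.
Qed.

Lemma Cmod_theta_factor (z : C) : 0 < Im z -> 2 * Cmod (theta_factor z) ^ 2 = Cmod z.
Proof.
  intros Hz. assert (Nz := neq_0_of_Im_pos z Hz). assert (Pz := proj1 (Cmod_gt_0 z) Nz).
  set (w := (- Cconj z)%C). assert (Hw : 0 < Im w) by (unfold w; rewrite Im_Copp_Cconj; exact Hz).
  assert (Einv : Cmod (theta_factor (- / z)) = Cmod (theta_factor z) / Cmod z).
  - rewrite <- (Cmod_theta_factor_Cconj z Hz). fold w.
    set (phi := fun x => Cmod (theta_factor (RtoC (x * x) * w)) / x).
    replace (- / z)%C with (RtoC (/ Cmod z * / Cmod z) * w)%C.
    + transitivity (phi (/ Cmod z) / Cmod z); [unfold phi; field; lra|]. f_equal.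
      rewrite (dilation_invariant_constant phi _ 1); [| | |apply Rinv_0_lt_compat; exact Pz|lra].
      * unfold phi. rewrite Rmult_1_l, Cmult_1_l, Rdiv_1_r. reflexivity.
      * intros x Hx. exact (continuous_Cmod_ray theta_factor w x holo_on_H_theta_factor Hw Hx).
      * intros n x Hx. unfold phi. assert (HN := lt_0_INR _ (Nat.lt_0_succ n)).
        replace (RtoC (INR (S n) * x * (INR (S n) * x)) * w)%C with
          (RtoC (INR (S n)) * RtoC (INR (S n)) * (RtoC (x * x) * w))%C
            by (rewrite !RtoC_mult; ring).
        assert (Hxw : 0 < Im (RtoC (x * x) * w))
          by (rewrite im_scal_l; apply Rmult_lt_0_compat; [nra|exact Hw]).
        rewrite theta_factor_dilation, Cmod_mult, Cmod_R, Rabs_pos_eq by lra. field. lra.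
    + unfold w. rewrite <- Rinv_mult, RtoC_inv by nra.
      replace (Cmod z * Cmod z) with (Cmod z ^ 2) by ring. rewrite Cmod2_conj. field.
      split; [exact Nz|apply Cconj_neq_0, Nz].
  - assert (Eprod := f_equal Cmod (theta_factor_inv z Hz)).
    rewrite !Cmod_mult, Cmod_1, Cmod_R, Rabs_pos_eq, Einv in Eprod by lra.
    replace (2 * Cmod (theta_factor z) ^ 2) with
      (2 * Cmod (theta_factor z) * (Cmod (theta_factor z) / Cmod z) * Cmod z) by (field; lra).
    rewrite Eprod. ring.
Qed.

Lemma Cmod_theta_disc_S (z : C) : 0 < Im z ->
  Cmod (theta_disc (- / z)) = Cmod z ^ 3 * Cmod (theta_disc z).
Proof.
  intros Hz. rewrite theta_disc_S, !Cmod_mult, Cmod_R, Rabs_pos_eq, Cmod_pow by (exact Hz || lra).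
  rewrite <- (Cmod_theta_factor z Hz). ring.
Qed.

Lemma holo_on_H_theta_disc : holo_on_H theta_disc.
Proof.
  apply (holo_on_H_ext (fun z => theta z * theta_odd z *
    (theta z ^ 4 + RtoC (-1) * theta_odd z ^ 4))%C).
  - intros z _. unfold theta_disc. ring.
  - assert (Htheta := holo_on_H_theta). assert (Hodd := holo_on_H_theta_odd).
    apply holo_on_H_mult; [apply holo_on_H_mult; assumption|].
    apply holo_on_H_plus; [|apply holo_on_H_scal]; apply holo_on_H_pow; assumption.
Qed.

(** * Integer powers *)

Lemma Czpow_mult (a b : C) (n : Z) : a <> RtoC 0 -> b <> RtoC 0 ->
  Czpow (a * b) n = (Czpow a n * Czpow b n)%C.
Proof.
  intros Ha Hb. destruct n; simpl; [ring| |]; rewrite Cpow_mult_l; auto.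
  field. split; apply Cpow_nz; assumption.
Qed.

Lemma Czpow_1_l (n : Z) : Czpow (RtoC 1) n = RtoC 1.
Proof. destruct n; simpl; rewrite ?Cpow_1_l; auto. field. Qed.

Lemma Czpow_neq_0 (a : C) (n : Z) : a <> RtoC 0 -> Czpow a n <> RtoC 0.
Proof.
  intros Ha. destruct n; simpl; [apply C1_nz|apply Cpow_nz, Ha|].
  apply Cmod_gt_0. rewrite Cmod_inv by apply Cpow_nz, Ha.
  apply Rinv_0_lt_compat, Cmod_gt_0, Cpow_nz, Ha.
Qed.

Lemma Cmod_Czpow (a : C) (n : Z) : a <> RtoC 0 -> Cmod (Czpow a n) = exp (IZR n * ln (Cmod a)).
Proof.
  intros Ha. assert (Pa := proj1 (Cmod_gt_0 a) Ha).
  assert (Hp : forall p, Cmod (a ^ Pos.to_nat p) = exp (IZR (Zpos p) * ln (Cmod a))).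
  { intros p.
    rewrite Cmod_pow, Rmult_comm, <- positive_nat_Z, <- INR_IZR_INZ, exp_mult_INR, exp_ln
      by exact Pa.
    reflexivity. }
  destruct n as [|p|p]; simpl Czpow.
  - rewrite Cmod_1, Rmult_0_l, exp_0. reflexivity.
  - apply Hp.
  - rewrite Cmod_inv, Hp, <- exp_Ropp by apply Cpow_nz, Ha. f_equal.
    rewrite Ropp_mult_distr_l, <- opp_IZR. reflexivity.
Qed.

Lemma Czpow_e2pi (w : C) (n : Z) : Czpow (e2pi w) n = e2pi (RtoC (IZR n) * w).
Proof.
  assert (Hn : forall k : nat, (e2pi w ^ k)%C = e2pi (RtoC (INR k) * w)).
  { induction k as [|k IH]; [simpl; rewrite Cmult_0_l, e2pi_0; reflexivity|].
    rewrite S_INR. simpl. rewrite IH, <- e2pi_plus. f_equal. rewrite RtoC_plus. ring. }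
  assert (Hp : forall p, (e2pi w ^ Pos.to_nat p)%C = e2pi (RtoC (IZR (Zpos p)) * w)).
  { intros p. rewrite Hn, INR_IZR_INZ, positive_nat_Z. reflexivity. }
  destruct n as [|p|p]; simpl Czpow.
  - rewrite Cmult_0_l, e2pi_0. reflexivity.
  - apply Hp.
  - rewrite Hp. set (u := (RtoC (IZR (Z.pos p)) * w)%C).
    replace (RtoC (IZR (Z.neg p)) * w)%C with (- u)%C
      by (unfold u; rewrite <- Pos2Z.opp_pos, opp_IZR, RtoC_opp; ring).
    assert (E : (e2pi (- u) * e2pi u)%C = RtoC 1).
    { rewrite <- e2pi_plus. replace (- u + u)%C with (RtoC 0) by ring. apply e2pi_0. }
    transitivity (e2pi (- u) * e2pi u / e2pi u)%C; [rewrite E|]; field; apply e2pi_neq_0.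
Qed.

Lemma holo_on_H_Czpow (f : C -> C) (n : Z) : (forall z, 0 < Im z -> f z <> RtoC 0) ->
  holo_on_H f -> holo_on_H (fun z => Czpow (f z) n).
Proof.
  intros Nf Hf. destruct n; simpl.
  - apply holo_on_H_const.
  - apply holo_on_H_pow, Hf.
  - apply holo_on_H_inv; [intros z Hz; apply Cpow_nz, Nf, Hz|apply holo_on_H_pow, Hf].
Qed.

(** * Vanishing of level one functions of weight zero *)

Lemma periodic_inversion_bound (phi : C -> C) (B : R) : periodic_on_H phi ->
  (forall z, 0 < Im z -> Cmod (phi (- / z)%C) = Cmod (phi z)) ->
  (forall z, 3 / 4 <= Im z -> Cmod (phi z) <= B) -> forall z, 0 < Im z -> Cmod (phi z) <= B.
Proof.
  intros Hp HS HB. apply upper_half_ind; [| |exact HB].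
  - intros z Hz. rewrite Hp by exact Hz. reflexivity.
  - intros z Hz. rewrite HS by exact Hz. auto.
Qed.

Lemma Cmod_fcoef_le_of_bounded (phi : C -> C) (B : R) (n : Z) :
  holo_on_H phi -> periodic_on_H phi -> (forall z, 0 < Im z -> Cmod (phi z) <= B) ->
  (0 < n)%Z -> Cmod (fcoef phi n) <= 3 * B.
Proof.
  intros Hh Hp HB Hn. assert (HPI := PI_RGT_0). apply IZR_lt in Hn.
  set (y := / (2 * PI * IZR n)). assert (Hy : 0 < y) by (apply Rinv_0_lt_compat; nra).
  eapply Rle_trans; [apply (Cmod_fcoef_le phi Hh Hp n y B Hy)|].
  - intros x _. apply HB, Hy.
  - replace (2 * PI * IZR n * y) with 1 by (unfold y; field; split; nra).
    assert (HB0 := Rle_trans _ _ _ (Cmod_ge_0 _) (HB (0, y) Hy)). assert (He3 := exp_le_3). nra.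
Qed.

(* The coefficients of a cusp form bounded by [B] are at most [3 B], so that its q-expansion gives
   the bound [B / 2] on the region [3/4 <= Im z]. *)
Lemma cusp_form_bound_half (phi : C -> C) (B : R) : holo_on_H phi -> periodic_on_H phi ->
  (forall n, (n <= 0)%Z -> fcoef phi n = RtoC 0) -> (forall z, 0 < Im z -> Cmod (phi z) <= B) ->
  forall z, 3 / 4 <= Im z -> Cmod (phi z) <= B / 2.
Proof.
  intros Hh Hp Hcusp HB z Hz. assert (HPI := PI2_3_2). set (a := 2 * PI * Im z).
  set (x := exp (- a)).
  assert (Ha : 9 / 2 <= a) by (unfold a; nra).
  assert (Hx : x <= / 60) by (eapply Rle_trans; [|apply exp_neg_9_2]; apply exp_le; lra).
  assert (HBpos : 0 <= B) by (apply (Rle_trans _ _ _ (Cmod_ge_0 (phi z))), HB; lra).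
  set (u := fun n => (fcoef phi n * qpow z n)%C).
  assert (Hu : forall k, zfold u k = u (Z.of_nat k)).
  { intros k. unfold zfold, u at 2. rewrite (Hcusp (-1 - Z.of_nat k)%Z) by lia. ring. }
  assert (Hs : zsummable u) by (apply (zsummable_fcoef phi Hh Hp); lra).
  rewrite (zsum_fcoef phi Hh Hp z) by lra. change (Cmod (Cseries (zfold u)) <= B / 2).
  rewrite (Cseries_incr_1 (zfold u) (zsummable_zfold u Hs)).
  rewrite Hu. unfold u at 1. simpl (Z.of_nat 0). rewrite (Hcusp 0%Z), Cmult_0_l, Cplus_0_l by lia.
  eapply Rle_trans; [apply (Cmod_Cseries_geom _ (3 * B * x) a); [lra|]|].
  - intros k. rewrite Hu. unfold u, x.
    rewrite Cmod_mult, Cmod_qpow, (Rmult_assoc (3 * B)), <- exp_plus.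
    rewrite <- INR_IZR_INZ, S_INR.
    replace (- (2 * PI * (INR k + 1) * Im z)) with (- a + - (a * INR k)) by (unfold a; ring).
    apply Rmult_le_compat_r; [left; apply exp_pos|]. apply Cmod_fcoef_le_of_bounded; auto. lia.
  - fold x. apply Rle_div_l; [lra|]. nra.
Qed.

Lemma weight_zero_eq_0 (phi : C -> C) (K : R) : holo_on_H phi -> periodic_on_H phi ->
  (forall z, 0 < Im z -> Cmod (phi (- / z)%C) = Cmod (phi z)) ->
  (forall z, 3 / 4 <= Im z -> Cmod (phi z) <= K * exp (- (2 * PI * Im z))) ->
  forall z, 0 < Im z -> phi z = RtoC 0.
Proof.
  intros Hh Hp HS HK. assert (HPI := PI2_3_2).
  assert (Hcusp : forall n, (n <= 0)%Z -> fcoef phi n = RtoC 0).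
  { intros n Hn. apply IZR_le in Hn. apply (fcoef_eq_0_of_growth phi Hh Hp K (- (2 * PI))); [|nra].
    intros z Hz. rewrite Ropp_mult_distr_l_reverse. apply HK. lra. }
  assert (Hpow : forall n z, 0 < Im z -> Cmod (phi z) <= Rabs K * (/ 2) ^ n).
  { induction n as [|n IH]; apply periodic_inversion_bound; auto; intros z Hz.
    - eapply Rle_trans; [apply HK, Hz|]. rewrite Rmult_1_r.
      assert (He : exp (- (2 * PI * Im z)) <= 1) by (rewrite <- exp_0; apply exp_le; nra).
      assert (Hepos := exp_pos (- (2 * PI * Im z))). assert (HK_le := Rle_abs K).
      assert (HK_ge0 := Rabs_pos K). nra.
    - replace (Rabs K * (/ 2) ^ S n) with (Rabs K * (/ 2) ^ n / 2) by (simpl; field).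
      apply cusp_form_bound_half; auto. }
  intros z Hz. apply Ceq_of_Cmod_le. intros eps Heps.
  destruct (pow_lt_1_zero (/ 2)) with (y := eps / (Rabs K + 1)) as [n Hn].
  - rewrite Rabs_pos_eq; lra.
  - apply Rdiv_lt_0_compat; [exact Heps|]. assert (HK_ge0 := Rabs_pos K). lra.
  - specialize (Hn n (le_n n)). rewrite Rabs_pos_eq in Hn by (apply pow_le; lra).
    replace (phi z - RtoC 0)%C with (phi z) by ring.
    eapply Rle_trans; [apply (Hpow n z Hz)|]. assert (HK_ge0 := Rabs_pos K).
    apply Rlt_div_r in Hn; [|lra]. nra.
Qed.

(** * Wronskians *)

Definition wronskian (f g : C -> C) (z : C) : C := (f z * C_derive g z - g z * C_derive f z)%C.

Lemma wronskian_ext (f f' g g' : C -> C) (z : C) : holo_on_H f -> holo_on_H g ->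
  (forall z, 0 < Im z -> f z = f' z) -> (forall z, 0 < Im z -> g z = g' z) -> 0 < Im z ->
  wronskian f g z = wronskian f' g' z.
Proof.
  intros Hf Hg Ef Eg Hz. unfold wronskian. rewrite Ef, Eg by exact Hz.
  rewrite (C_derive_unique_H f f' z (C_derive f z)) by auto using is_cderive_C_derive.
  rewrite (C_derive_unique_H g g' z (C_derive g z)) by auto using is_cderive_C_derive.
  reflexivity.
Qed.

Lemma wronskian_linear (f g : C -> C) (a b c d : C) (z : C) :
  holo_on_H f -> holo_on_H g -> 0 < Im z ->
  wronskian (fun z => a * f z + b * g z)%C (fun z => c * f z + d * g z)%C z
  = ((a * d - b * c) * wronskian f g z)%C.
Proof.
  intros Hf Hg Hz. unfold wronskian.
  assert (Df := is_cderive_C_derive f z Hf Hz). assert (Dg := is_cderive_C_derive g z Hg Hz).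
  assert (D : forall a b, C_derive (fun z => a * f z + b * g z)%C z
                          = (a * C_derive f z + b * C_derive g z)%C).
  { intros u v. apply is_C_derive_unique.
    apply is_cderive_plus; apply is_cderive_scal; assumption. }
  rewrite !D. ring.
Qed.

Lemma wronskian_mult (h f g : C -> C) (z : C) :
  holo_on_H h -> holo_on_H f -> holo_on_H g -> 0 < Im z ->
  wronskian (fun z => h z * f z)%C (fun z => h z * g z)%C z = (h z * h z * wronskian f g z)%C.
Proof.
  intros Hh Hf Hg Hz. unfold wronskian.
  assert (D : forall u, holo_on_H u -> C_derive (fun z => h z * u z)%C z
                        = (C_derive h z * u z + h z * C_derive u z)%C).
  { intros u Hu. apply is_C_derive_unique, is_cderive_mult; apply is_cderive_C_derive; assumption. }
  rewrite !D by assumption. ring.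
Qed.

Lemma wronskian_comp (f g h : C -> C) (z l : C) : holo_on_H f -> holo_on_H g ->
  0 < Im (h z) -> is_cderive h z l ->
  wronskian (fun z => f (h z)) (fun z => g (h z)) z = (l * wronskian f g (h z))%C.
Proof.
  intros Hf Hg Hz Hh. unfold wronskian.
  assert (D : forall u, holo_on_H u -> C_derive (fun z => u (h z)) z = (C_derive u (h z) * l)%C).
  { intros u Hu.
    apply is_C_derive_unique, is_cderive_comp; [apply is_cderive_C_derive|]; assumption. }
  rewrite !D by assumption. ring.
Qed.

Section PeriodicWronskian.

Variables f g : C -> C.
Hypotheses (Hf : holo_on_H f) (Hpf : periodic_on_H f) (Hg : holo_on_H g) (Hpg : periodic_on_H g).

Lemma holo_on_H_wronskian : holo_on_H (wronskian f g).
Proof.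
  apply (holo_on_H_ext (fun z => f z * C_derive g z + RtoC (-1) * (g z * C_derive f z))%C).
  - intros z _. unfold wronskian. ring.
  - apply holo_on_H_plus; [|apply holo_on_H_scal]; apply holo_on_H_mult;
      auto using holo_on_H_C_derive.
Qed.

Lemma periodic_on_H_wronskian : periodic_on_H (wronskian f g).
Proof.
  intros z Hz. unfold wronskian.
  rewrite Hpf, Hpg, !periodic_on_H_C_derive by assumption. reflexivity.
Qed.

Lemma fcoef_wronskian (n : Z) :
  fcoef (wronskian f g) n = (fcoef (fun z => f z * C_derive g z) n
                             - fcoef (fun z => g z * C_derive f z) n)%C.
Proof.
  rewrite (fcoef_ext _ (fun z => f z * C_derive g z + RtoC (-1) * (g z * C_derive f z))%C)
    by (intros z _; unfold wronskian; ring).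
  assert (Hh : forall u v, holo_on_H u -> holo_on_H v -> periodic_on_H v ->
    holo_on_H (fun z => u z * C_derive v z)%C)
    by (intros u v Hu Hv Hpv; apply holo_on_H_mult; auto using holo_on_H_C_derive).
  assert (Hp : forall u v, periodic_on_H u -> holo_on_H v -> periodic_on_H v ->
    periodic_on_H (fun z => u z * C_derive v z)%C)
    by (intros u v Hu Hv Hpv; apply periodic_on_H_mult; auto using periodic_on_H_C_derive).
  rewrite (fcoef_plus (fun z => f z * C_derive g z)%C
             (fun z => RtoC (-1) * (g z * C_derive f z))%C),
    (fcoef_scal (fun z => g z * C_derive f z)%C);
    auto using holo_on_H_scal, periodic_on_H_scal. ring.
Qed.

Variables A B : Z.
Hypotheses (HA : forall n, (n < A)%Z -> fcoef f n = RtoC 0)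
           (HB : forall n, (n < B)%Z -> fcoef g n = RtoC 0).

Lemma fcoef_wronskian_low (n : Z) : (n < A + B)%Z -> fcoef (wronskian f g) n = RtoC 0.
Proof.
  intros Hn. rewrite fcoef_wronskian.
  rewrite (fcoef_mult_low f _ A B), (fcoef_mult_low g _ B A); try lia; [ring|..];
    auto using holo_on_H_C_derive, periodic_on_H_C_derive;
    intros k Hk; rewrite fcoef_C_derive; rewrite ?HA, ?HB; auto; ring.
Qed.

Lemma fcoef_wronskian_leading :
  fcoef (wronskian f g) (A + B) = (C2PIi * RtoC (IZR (B - A)) * (fcoef f A * fcoef g B))%C.
Proof.
  rewrite fcoef_wronskian, fcoef_mult_leading, (Z.add_comm A B), fcoef_mult_leading,
    !fcoef_C_derive;
    auto using holo_on_H_C_derive, periodic_on_H_C_derive;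
    try (intros k Hk; rewrite fcoef_C_derive; rewrite ?HA, ?HB; auto; ring).
  rewrite minus_IZR, RtoC_minus. ring.
Qed.

End PeriodicWronskian.

(** * Plus forms as vector-valued forms of level one *)

Definition plus_form (t : Z) (f : C -> C) : Prop :=
  holo_on_H f /\ transforms_like_theta t f /\ plus_space t f.

Lemma in_Mshriek_plus_form (t : Z) (f : C -> C) : in_Mshriek t f -> plus_form t f.
Proof. intros [Hf [Ht [_ Hs]]]. exact (conj Hf (conj Ht Hs)). Qed.

Lemma mobius_translation (z : C) : mobius 1 1 0 1 z = (z + RtoC 1)%C.
Proof. unfold mobius. field. Qed.

Lemma plus_form_periodic (t : Z) (f : C -> C) : plus_form t f -> periodic_on_H f.
Proof.
  intros [_ [Ht _]] z Hz. rewrite <- mobius_translation, Ht, mobius_translation, theta_T;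
    [|exact Hz|split; [reflexivity|exists 0%Z; reflexivity]|exact Hz].
  replace (theta z / theta z)%C with (RtoC 1) by (field; apply theta_neq_0, Hz).
  rewrite Czpow_1_l. ring.
Qed.

Lemma qpow_half (n : Z) : qpow (RtoC (/ 2)) n = RtoC (if Z.even n then 1 else -1).
Proof.
  rewrite qpow_e2pi, <- RtoC_mult. assert (E := Zdiv2_odd_eqn n).
  rewrite <- Z.negb_odd. destruct (Z.odd n); simpl negb; cbv iota in *.
  - replace (IZR n * / 2) with (IZR (Z.div2 n) + / 2)
      by (rewrite E at 2; rewrite plus_IZR, mult_IZR; field).
    rewrite RtoC_plus, e2pi_plus, e2pi_IZR, e2pi_half. ring.
  - replace (IZR n * / 2) with (IZR (Z.div2 n))
      by (rewrite E at 2; rewrite Z.add_0_r, mult_IZR; field).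
    apply e2pi_IZR.
Qed.

Lemma e2pi_quarter_residue (n r : Z) :
  (n mod 4 = r)%Z -> e2pi (RtoC (IZR n * / 4)) = e2pi (RtoC (IZR r * / 4)).
Proof.
  intros H. replace (IZR n * / 4) with (IZR (n / 4) + IZR r * / 4).
  - rewrite RtoC_plus, e2pi_plus, e2pi_IZR. ring.
  - rewrite (Z.div_mod n 4) at 2 by lia. rewrite H, plus_IZR, mult_IZR. field.
Qed.

Lemma plus_okb_mod_4 (t n : Z) :
  plus_okb t n = true <-> (n mod 4 = if Z.even n then 0 else if Z.even t then 1 else 3)%Z.
Proof.
  unfold plus_okb. rewrite Bool.orb_true_iff, !Z.eqb_eq. assert (P := Zmod_even n).
  destruct (Z.even n), (Z.even t); Z.div_mod_to_equations; lia.
Qed.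

Definition eps_i (t : Z) : C := if Z.even t then Ci else (- Ci)%C.

Lemma eps_i_sqr (t : Z) : (eps_i t * eps_i t)%C = RtoC (-1).
Proof. unfold eps_i. rewrite <- Ci_sqr. destruct (Z.even t); ring. Qed.

Lemma Cmod_eps_i (t : Z) : Cmod (eps_i t) = 1.
Proof. unfold eps_i. destruct (Z.even t); rewrite ?Cmod_opp; apply Cmod_Ci. Qed.

Lemma qpow_quarter (t n : Z) : plus_okb t n = true ->
  qpow (RtoC (/ 4)) n = if Z.even n then RtoC 1 else eps_i t.
Proof.
  intros H. apply plus_okb_mod_4 in H.
  rewrite qpow_e2pi, <- RtoC_mult, (e2pi_quarter_residue n _ H).
  unfold eps_i. destruct (Z.even n), (Z.even t); try (rewrite Rmult_0_l; apply e2pi_0);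
    try (rewrite Rmult_1_l; apply e2pi_quarter).
  replace (3 * / 4) with (/ 2 + / 4) by field.
  rewrite RtoC_plus, e2pi_plus, e2pi_half, e2pi_quarter. ring.
Qed.

(* The part of [f] supported on the exponents [n] with [Z.even n = b]. *)
Definition parity_part (b : bool) (f : C -> C) (z : C) : C :=
  (RtoC (/ 2) * (f z + RtoC (if b then 1 else -1) * f (z + RtoC (/ 2))))%C.

Lemma parity_part_decompose (f : C -> C) (z : C) :
  f z = (parity_part true f z + parity_part false f z)%C.
Proof.
  unfold parity_part. transitivity (RtoC (/ 2 * 2) * f z)%C; [|rewrite RtoC_mult; ring].
  rewrite Rinv_l by lra. ring.
Qed.

Lemma theta_quarter (sigma : Z) (z : C) : (sigma * sigma = 1)%Z -> 0 < Im z ->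
  theta (RtoC (/ 4) * (z + RtoC (IZR sigma))) = (theta z + RtoC (IZR sigma) * Ci * theta_odd z)%C.
Proof.
  intros Hs Hz. set (w := (z + RtoC (IZR sigma))%C).
  assert (Hw : 0 < Im w) by (unfold w; rewrite Im_plus_R; exact Hz).
  replace (theta (RtoC (/ 4) * w)) with (theta w + theta_odd w)%C by (unfold theta_odd; ring).
  assert (E : (sigma = 1 \/ sigma = -1)%Z) by nia. unfold w in *. destruct E as [-> | ->].
  - rewrite theta_T, theta_odd_T by exact Hz. ring.
  - assert (Htheta := theta_T _ Hw). assert (Hodd := theta_odd_T _ Hw).
    replace (z + RtoC (-1) + RtoC 1)%C with z in Htheta, Hodd by ring. rewrite Htheta, Hodd.
    transitivity (theta (z + RtoC (-1)) - (Ci * Ci) * theta_odd (z + RtoC (-1)))%C;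
      [rewrite Ci_sqr|]; ring.
Qed.

Lemma theta_quarter_S (sigma : Z) (z : C) : (sigma * sigma = 1)%Z -> 0 < Im z ->
  theta (RtoC (/ 4) * (- / z + RtoC (IZR sigma)))
  = ((RtoC 1 + RtoC (IZR sigma) * Ci) * theta_factor z
     * theta (RtoC (/ 4) * (z + RtoC (IZR (- sigma)))))%C.
Proof.
  intros Hs Hz.
  rewrite !theta_quarter, theta_S, theta_odd_S by (lia || auto using Im_Copp_Cinv_pos).
  rewrite opp_IZR, RtoC_opp. assert (Esqr : (RtoC (IZR sigma) * RtoC (IZR sigma))%C = RtoC 1)
    by (rewrite <- RtoC_mult, <- mult_IZR, Hs; reflexivity).
  set (s := RtoC (IZR sigma)) in *.
  transitivity (theta_factor z * ((RtoC 1 + s * Ci) * theta z + (RtoC 1 - s * Ci) * theta_odd z))%C;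
    [ring|].
  replace (RtoC 1 - s * Ci)%C with (- (s * s) * (Ci * Ci) - s * Ci)%C; [ring|].
  rewrite Esqr, Ci_sqr. ring.
Qed.

Lemma one_plus_sigma_Ci_neq_0 (sigma : Z) : (RtoC 1 + RtoC (IZR sigma) * Ci)%C <> RtoC 0.
Proof. intros E. apply (f_equal fst) in E. simpl in E. lra. Qed.

Lemma theta_factor_neq_0 (z : C) : 0 < Im z -> theta_factor z <> RtoC 0.
Proof.
  intros Hz E. assert (Einv := theta_factor_inv z Hz). rewrite E, Cmult_0_r, Cmult_0_l in Einv.
  apply C1_nz. symmetry. exact Einv.
Qed.

(* [z |-> -1/z] acts on [f ((z - sigma) / 4)] through the matrix [(1, 0; 4 sigma, 1)] of
   [Gamma_0(4)]. *)
Lemma mobius_quarter (sigma : Z) (z : C) : (sigma * sigma = 1)%Z -> z <> RtoC 0 ->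
  mobius 1 0 (4 * sigma) 1 (RtoC (/ 4) * (z + RtoC (IZR (- sigma))))
  = (RtoC (/ 4) * (- / z + RtoC (IZR sigma)))%C.
Proof.
  intros Hs Nz. unfold mobius. assert (E : (sigma = 1 \/ sigma = -1)%Z) by nia.
  rewrite !RtoC_inv by lra. destruct E as [-> | ->]; simpl.
  - replace (RtoC 4 * (/ RtoC 4 * (z + RtoC (-1))) + RtoC 1)%C with z by (field). field. exact Nz.
  - replace (RtoC (-4) * (/ RtoC 4 * (z + RtoC 1)) + RtoC 1)%C with (- z)%C by (field). field.
    exact Nz.
Qed.

Lemma Czpow_Ci_odd_neq_1 (n : Z) : Czpow Ci (2 * n + 1) <> RtoC 1.
Proof.
  rewrite <- e2pi_quarter, Czpow_e2pi, <- RtoC_mult. intros E. apply e2pi_eq_1 in E.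
  destruct E as [k E]. assert (Ek : IZR (2 * n + 1) = IZR (4 * k)) by (rewrite mult_IZR; lra).
  apply eq_IZR in Ek. lia.
Qed.

Section PlusForm.

Variables (t : Z) (f : C -> C).
Hypothesis Hf : plus_form t f.

Let Hh : holo_on_H f := proj1 Hf.
Let Hp : periodic_on_H f := plus_form_periodic t f Hf.

Lemma holo_on_H_parity_part (b : bool) : holo_on_H (parity_part b f).
Proof.
  apply holo_on_H_scal, holo_on_H_plus; [exact Hh|].
  apply holo_on_H_scal, holo_on_H_translate; [apply Rle_refl|exact Hh].
Qed.

Lemma periodic_on_H_parity_part (b : bool) : periodic_on_H (parity_part b f).
Proof.
  apply periodic_on_H_scal, periodic_on_H_plus; [exact Hp|].
  apply periodic_on_H_scal, periodic_on_H_translate; [apply Rle_refl|exact Hp].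
Qed.

Lemma fcoef_parity_part (b : bool) (n : Z) :
  fcoef (parity_part b f) n = if Bool.eqb (Z.even n) b then fcoef f n else RtoC 0.
Proof.
  unfold parity_part. assert (Hhalf : 0 <= Im (RtoC (/ 2))) by apply Rle_refl.
  rewrite (fcoef_scal (fun z => f z + RtoC (if b then 1 else -1) * f (z + RtoC (/ 2)))%C),
    (fcoef_plus f (fun z => RtoC (if b then 1 else -1) * f (z + RtoC (/ 2)))%C),
    (fcoef_scal (fun z => f (z + RtoC (/ 2)))%C), fcoef_translate, qpow_half;
    auto 6 using holo_on_H_plus, holo_on_H_scal, holo_on_H_translate, periodic_on_H_plus,
      periodic_on_H_scal, periodic_on_H_translate.
  destruct (Z.even n), b; simpl Bool.eqb; cbv iota; try ring; rewrite <- Cmult_1_l, RtoC_inv by lra;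
    field.
Qed.

Lemma parity_part_quarter (b : bool) (z : C) : 0 < Im z ->
  parity_part b f (z + RtoC (/ 4))
  = ((if b then RtoC 1 else eps_i t) * parity_part b f z)%C.
Proof.
  apply translate_eigenfunction;
    [apply holo_on_H_parity_part|apply periodic_on_H_parity_part|apply Rle_refl|].
  intros n Nn. rewrite fcoef_parity_part in Nn.
  destruct (Bool.eqb (Z.even n) b) eqn:E; [|destruct (Nn eq_refl)]. apply Bool.eqb_prop in E.
  subst b.
  apply qpow_quarter. apply Bool.not_false_iff_true. intros E. apply Nn, (proj2 (proj2 Hf)), E.
Qed.

Lemma plus_form_quarter (sigma : Z) (z : C) : (sigma * sigma = 1)%Z -> 0 < Im z ->
  f (RtoC (/ 4) * (z + RtoC (IZR sigma)))%C
  = (parity_part true f (RtoC (/ 4) * z)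
     + RtoC (IZR sigma) * eps_i t * parity_part false f (RtoC (/ 4) * z))%C.
Proof.
  intros Hs Hz. set (w := (RtoC (/ 4) * (z + RtoC (IZR sigma)))%C).
  assert (Hw : 0 < Im w) by (unfold w; rewrite im_scal_l, Im_plus_R; lra).
  rewrite (parity_part_decompose f w).
  assert (E : (sigma = 1 \/ sigma = -1)%Z) by nia. unfold w in *. destruct E as [-> | ->].
  - rewrite Cmult_plus_distr_l, Cmult_1_r, !parity_part_quarter by (rewrite im_scal_l; lra). ring.
  - assert (Q := fun b => parity_part_quarter b _ Hw).
    replace (RtoC (/ 4) * (z + RtoC (-1)) + RtoC (/ 4))%C with (RtoC (/ 4) * z)%C in Q by ring.
    rewrite !Q. set (u := parity_part false f _).
    transitivity (parity_part true f (RtoC (/ 4) * (z + RtoC (-1))) - (eps_i t * eps_i t) * u)%C;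
      [rewrite eps_i_sqr|]; ring.
Qed.

Lemma plus_form_S (sigma : Z) (z : C) : (sigma * sigma = 1)%Z -> 0 < Im z ->
  f (RtoC (/ 4) * (- / z + RtoC (IZR sigma)))%C
  = (Czpow (theta_factor z) (2 * t + 1)
     * (Czpow (RtoC 1 + RtoC (IZR sigma) * Ci) (2 * t + 1)
        * f (RtoC (/ 4) * (z + RtoC (IZR (- sigma))))))%C.
Proof.
  intros Hs Hz. set (w := (RtoC (/ 4) * (z + RtoC (IZR (- sigma))))%C).
  assert (Hw : 0 < Im w) by (unfold w; rewrite im_scal_l, Im_plus_R; lra).
  rewrite <- (mobius_quarter sigma z Hs (neq_0_of_Im_pos z Hz)). fold w.
  rewrite (proj1 (proj2 Hf)); [|split; [ring|exists sigma; ring]|exact Hw].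
  unfold w at 1. rewrite mobius_quarter, theta_quarter_S by auto using neq_0_of_Im_pos. fold w.
  rewrite Cmult_assoc, <- Czpow_mult by auto using theta_factor_neq_0, one_plus_sigma_Ci_neq_0.
  f_equal. f_equal. field. apply theta_neq_0, Hw.
Qed.

Definition plus_wronskian : C -> C :=
  wronskian (fun z => parity_part true f (RtoC (/ 4) * z))
            (fun z => parity_part false f (RtoC (/ 4) * z)).

Lemma plus_wronskian_eq (z : C) : 0 < Im z ->
  plus_wronskian z
  = (RtoC (/ 4) * wronskian (parity_part true f) (parity_part false f) (RtoC (/ 4) * z))%C.
Proof.
  intros Hz.
  apply (wronskian_comp (parity_part true f) (parity_part false f) (fun z => RtoC (/ 4) * z)%C);
    auto using holo_on_H_parity_part; [rewrite im_scal_l; lra|].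
  apply is_cderive_eq with (RtoC (/ 4) * RtoC 1)%C; [apply is_cderive_scal, is_cderive_id|ring].
Qed.

Lemma plus_wronskian_T (z : C) : 0 < Im z ->
  plus_wronskian (z + RtoC 1) = (eps_i t * plus_wronskian z)%C.
Proof.
  intros Hz. rewrite !plus_wronskian_eq by (try rewrite Im_plus_R; exact Hz).
  set (w := (RtoC (/ 4) * z)%C). assert (Hw : 0 < Im w) by (unfold w; rewrite im_scal_l; lra).
  replace (RtoC (/ 4) * (z + RtoC 1))%C with (w + RtoC (/ 4))%C by (unfold w; ring).
  set (u := parity_part true f). set (v := parity_part false f).
  assert (Hu : holo_on_H u) by apply holo_on_H_parity_part.
  assert (Hv : holo_on_H v) by apply holo_on_H_parity_part.
  assert (E := wronskian_comp u v (fun z => z + RtoC (/ 4))%C w (RtoC 1) Hu Hv).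
  rewrite Cmult_1_l in E. rewrite <- E.
  - rewrite (wronskian_ext _ (fun z => RtoC 1 * u z + RtoC 0 * v z)%C _
      (fun z => RtoC 0 * u z + eps_i t * v z)%C), wronskian_linear;
      auto using holo_on_H_translate, Rle_refl; [ring|..]; intros x Hx; unfold u, v;
      rewrite parity_part_quarter by exact Hx; ring.
  - rewrite Im_plus_R. exact Hw.
  - apply is_cderive_eq with (RtoC 1 + RtoC 0)%C; [|ring].
    apply is_cderive_plus; [apply is_cderive_id|apply is_cderive_const].
Qed.

Lemma wronskian_quarter_translates (z : C) : 0 < Im z ->
  wronskian (fun z => f (RtoC (/ 4) * (z + RtoC 1))) (fun z => f (RtoC (/ 4) * (z + RtoC (-1)))) z
  = (RtoC (-2) * eps_i t * plus_wronskian z)%C.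
Proof.
  intros Hz. set (u := fun z => parity_part true f (RtoC (/ 4) * z)%C).
  set (v := fun z => parity_part false f (RtoC (/ 4) * z)%C).
  assert (Hu : holo_on_H u) by (apply holo_on_H_dilation; [lra|apply holo_on_H_parity_part]).
  assert (Hv : holo_on_H v) by (apply holo_on_H_dilation; [lra|apply holo_on_H_parity_part]).
  transitivity (wronskian (fun z => RtoC 1 * u z + eps_i t * v z)%C
                          (fun z => RtoC 1 * u z + RtoC (-1) * eps_i t * v z)%C z).
  - symmetry. apply wronskian_ext; [..|exact Hz].
    + apply holo_on_H_plus; apply holo_on_H_scal; assumption.
    + apply holo_on_H_plus; apply holo_on_H_scal; assumption.
    + intros w Hw. rewrite (plus_form_quarter 1) by (reflexivity || exact Hw). unfold u, v. ring.
    + intros w Hw. rewrite (plus_form_quarter (-1)) by (reflexivity || exact Hw). unfold u, v. ring.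
  - rewrite wronskian_linear by assumption. unfold plus_wronskian. fold u v. ring.
Qed.

Lemma holo_on_H_quarter_translate (r : R) : holo_on_H (fun z => f (RtoC (/ 4) * (z + RtoC r))%C).
Proof.
  apply (holo_on_H_translate (fun z => f (RtoC (/ 4) * z)%C)); [apply Rle_refl|].
  apply holo_on_H_dilation; [lra|exact Hh].
Qed.

Lemma wronskian_quarter_translates_S (z : C) : 0 < Im z ->
  let w := wronskian (fun z => f (RtoC (/ 4) * (z + RtoC 1)))%C
                     (fun z => f (RtoC (/ 4) * (z + RtoC (-1))))%C in
  w (- / z)%C = (RtoC (-1) * (z * z) * Czpow (RtoC 2 * theta_factor z ^ 2) (2 * t + 1) * w z)%C.
Proof.
  intros Hz w. assert (Nz := neq_0_of_Im_pos z Hz).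
  set (u := fun z => f (RtoC (/ 4) * (z + RtoC 1))%C) in w.
  set (v := fun z => f (RtoC (/ 4) * (z + RtoC (-1)))%C) in w.
  assert (Hu : holo_on_H u) by apply holo_on_H_quarter_translate.
  assert (Hv : holo_on_H v) by apply holo_on_H_quarter_translate.
  set (K := fun z => Czpow (theta_factor z) (2 * t + 1)).
  set (c := Czpow (RtoC 1 + RtoC 1 * Ci) (2 * t + 1)).
  set (d := Czpow (RtoC 1 + RtoC (-1) * Ci) (2 * t + 1)).
  assert (HK : holo_on_H K) by (apply holo_on_H_Czpow;
    [exact theta_factor_neq_0|exact holo_on_H_theta_factor]).
  assert (Hcomp := wronskian_comp u v (fun z => - / z)%C z (/ (z * z))%C Hu Hv
    (Im_Copp_Cinv_pos z Hz) (is_cderive_Copp_Cinv z Nz)).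
  rewrite (wronskian_ext _ (fun z => K z * (RtoC 0 * u z + c * v z))%C _
    (fun z => K z * (d * u z + RtoC 0 * v z))%C) in Hcomp.
  - rewrite wronskian_mult, wronskian_linear in Hcomp by
      auto using holo_on_H_plus, holo_on_H_scal. fold w in Hcomp.
    replace (Czpow (RtoC 2 * theta_factor z ^ 2) (2 * t + 1)) with (K z * K z * (c * d))%C.
    + transitivity (z * z * (/ (z * z) * w (- / z)))%C; [field; exact Nz|]. rewrite <- Hcomp. ring.
    + assert (Nf := theta_factor_neq_0 z Hz). assert (Nc := one_plus_sigma_Ci_neq_0 1).
      assert (Nd := one_plus_sigma_Ci_neq_0 (-1)).
      unfold K, c, d. rewrite <- !Czpow_mult by auto using Cmult_neq_0.
      f_equal. transitivity (theta_factor z ^ 2 * (RtoC 1 - Ci * Ci))%C; [ring|]. rewrite Ci_sqr.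
      ring.
  - apply holo_on_H_comp; [exact Im_Copp_Cinv_pos|exact Hu|exact holo_on_H_Copp_Cinv].
  - apply holo_on_H_comp; [exact Im_Copp_Cinv_pos|exact Hv|exact holo_on_H_Copp_Cinv].
  - intros x Hx. unfold u at 1. rewrite (plus_form_S 1) by (reflexivity || exact Hx). simpl Z.opp.
    fold (K x) c (v x). ring.
  - intros x Hx. unfold v at 1. rewrite (plus_form_S (-1)) by (reflexivity || exact Hx).
    simpl Z.opp. fold (K x) d (u x). ring.
  - exact Hz.
Qed.

Lemma Cmod_plus_wronskian_S (z : C) : 0 < Im z ->
  Cmod (plus_wronskian (- / z)) = exp (IZR (2 * t + 3) * ln (Cmod z)) * Cmod (plus_wronskian z).
Proof.
  intros Hz. assert (Pz := proj1 (Cmod_gt_0 z) (neq_0_of_Im_pos z Hz)).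
  assert (E := f_equal Cmod (wronskian_quarter_translates_S z Hz)). cbv zeta in E.
  rewrite !wronskian_quarter_translates in E by auto using Im_Copp_Cinv_pos.
  assert (Ntwo : RtoC 2 <> RtoC 0) by (apply RtoC_neq_0; lra).
  assert (Nf := Cpow_nz _ 2 (theta_factor_neq_0 z Hz)).
  rewrite !Cmod_mult, Cmod_Czpow, !Cmod_mult, Cmod_pow, Cmod_eps_i, !Cmod_R in E
    by (apply Cmult_neq_0; assumption).
  rewrite (Rabs_pos_eq 2), (Cmod_theta_factor z Hz), !Rabs_left in E by lra.
  replace (2 * t + 3)%Z with (2 * t + 1 + 2)%Z by ring.
  rewrite plus_IZR, Rmult_plus_distr_r, exp_plus.
  replace (exp (2 * ln (Cmod z))) with (Cmod z * Cmod z)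
    by (replace (2 * ln (Cmod z)) with (ln (Cmod z) + ln (Cmod z)) by ring;
        rewrite exp_plus, exp_ln by exact Pz; reflexivity).
  lra.
Qed.

Lemma plus_form_quarter_eq_0 (b : bool) (z : C) :
  (forall z, 0 < Im z -> parity_part b f z = RtoC 0) -> 0 < Im z ->
  f (RtoC (/ 4) * (z + RtoC 1))%C = RtoC 0.
Proof.
  intros Hpart Hz. set (s := RtoC (if b then -1 else 1)).
  assert (Hs : forall w, 0 < Im w -> f (RtoC (/ 4) * (w + RtoC (-1)))%C
                                     = (s * f (RtoC (/ 4) * (w + RtoC 1)))%C).
  { intros w Hw.
    rewrite (plus_form_quarter 1), (plus_form_quarter (-1)) by (reflexivity || exact Hw).
    unfold s. destruct b; rewrite Hpart by (rewrite im_scal_l; lra); ring. }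
  set (c := Czpow (RtoC 1 + RtoC 1 * Ci) (2 * t + 1)).
  set (d := Czpow (RtoC 1 + RtoC (-1) * Ci) (2 * t + 1)).
  assert (Hcd : c = (Czpow Ci (2 * t + 1) * d)%C).
  { unfold c, d. rewrite <- Czpow_mult by (apply Ci_nz || apply (one_plus_sigma_Ci_neq_0 (-1))).
    f_equal. transitivity (Ci - Ci * Ci)%C; [rewrite Ci_sqr|]; ring. }
  assert (Nd : d <> RtoC 0) by apply Czpow_neq_0, (one_plus_sigma_Ci_neq_0 (-1)).
  assert (NK := Czpow_neq_0 _ (2 * t + 1) (theta_factor_neq_0 z Hz)).
  assert (Eplus := plus_form_S 1 z eq_refl Hz). assert (Eminus := plus_form_S (-1) z eq_refl Hz).
  simpl Z.opp in Eplus, Eminus. fold c in Eplus. fold d in Eminus.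
  rewrite Hs, Eplus in Eminus by (exact Hz || apply Im_Copp_Cinv_pos, Hz).
  rewrite Hs, Hcd in Eminus by exact Hz.
  set (K := Czpow (theta_factor z) (2 * t + 1)) in *.
  set (u := f (RtoC (/ 4) * (z + RtoC 1))%C) in *.
  assert (E : (K * (d * ((Czpow Ci (2 * t + 1) - RtoC 1) * u)))%C = RtoC 0).
  { assert (Esqr : (s * s)%C = RtoC 1)
      by (unfold s; rewrite <- RtoC_mult; destruct b; f_equal; ring).
    transitivity (K * (Czpow Ci (2 * t + 1) * d * (s * s) * u) - K * (d * u))%C;
      [rewrite Esqr; ring|].
    rewrite <- Eminus. ring. }
  apply Cmult_integral in E. destruct E as [E|E]; [destruct (NK E)|].
  apply Cmult_integral in E. destruct E as [E|E]; [destruct (Nd E)|].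
  apply Cmult_integral in E. destruct E as [E|E]; [|exact E].
  destruct (Czpow_Ci_odd_neq_1 t). apply Ceq_minus, E.
Qed.

Lemma plus_form_eq_0_of_parity_part (b : bool) (z : C) :
  (forall z, 0 < Im z -> parity_part b f z = RtoC 0) -> 0 < Im z -> f z = RtoC 0.
Proof.
  intros Hpart Hz. rewrite <- (plus_form_quarter_eq_0 b (RtoC 4 * z + RtoC (-1)) Hpart).
  - f_equal. rewrite RtoC_inv by lra. field.
  - rewrite Im_plus_R, im_scal_l. lra.
Qed.

Section ZeroEstimate.

Variables A B : Z.
Hypotheses (HA : forall n, (n < A)%Z -> fcoef (parity_part true f) n = RtoC 0)
           (HB : forall n, (n < B)%Z -> fcoef (parity_part false f) n = RtoC 0)
           (Hweight : (2 * t + 3 < 3 * (A + B))%Z).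

Definition wronskian_quotient (z : C) : C :=
  (plus_wronskian z ^ 12 * Czpow (theta_disc z ^ 4) (- (2 * t + 3)))%C.

Lemma holo_on_H_wronskian_quotient : holo_on_H wronskian_quotient.
Proof.
  apply holo_on_H_mult.
  - apply holo_on_H_pow.
    apply (holo_on_H_ext (fun z =>
      RtoC (/ 4) * wronskian (parity_part true f) (parity_part false f) (RtoC (/ 4) * z))%C).
    + intros z Hz. symmetry. apply plus_wronskian_eq, Hz.
    + apply holo_on_H_scal, holo_on_H_dilation, holo_on_H_wronskian; [lra|..];
        auto using holo_on_H_parity_part, periodic_on_H_parity_part.
  - apply holo_on_H_Czpow; [|apply holo_on_H_pow, holo_on_H_theta_disc].
    intros z Hz. apply Cpow_nz, theta_disc_neq_0, Hz.
Qed.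

Lemma periodic_on_H_wronskian_quotient : periodic_on_H wronskian_quotient.
Proof.
  intros z Hz. unfold wronskian_quotient.
  rewrite plus_wronskian_T, theta_disc_T, !Cpow_mult_l by exact Hz.
  replace (Ci ^ 4)%C with (Ci * Ci * (Ci * Ci))%C by ring.
  replace (eps_i t ^ 12)%C with ((eps_i t * eps_i t) ^ 6)%C by ring.
  rewrite eps_i_sqr, Ci_sqr. replace (RtoC (-1) ^ 6)%C with (RtoC 1) by ring.
  replace (RtoC (-1) * RtoC (-1))%C with (RtoC 1) by ring. rewrite !Cmult_1_l. reflexivity.
Qed.

Lemma Cmod_wronskian_quotient (z : C) : 0 < Im z ->
  Cmod (wronskian_quotient z)
  = Cmod (plus_wronskian z) ^ 12 * exp (- (4 * IZR (2 * t + 3) * ln (Cmod (theta_disc z)))).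
Proof.
  intros Hz. assert (N := theta_disc_neq_0 z Hz). unfold wronskian_quotient.
  rewrite Cmod_mult, Cmod_Czpow, !Cmod_pow by apply Cpow_nz, N.
  rewrite ln_pow by apply Cmod_gt_0, N. rewrite opp_IZR. f_equal. f_equal. simpl INR. ring.
Qed.

Lemma Cmod_wronskian_quotient_S (z : C) : 0 < Im z ->
  Cmod (wronskian_quotient (- / z)) = Cmod (wronskian_quotient z).
Proof.
  intros Hz. assert (Pz := proj1 (Cmod_gt_0 z) (neq_0_of_Im_pos z Hz)).
  assert (Pd := proj1 (Cmod_gt_0 _) (theta_disc_neq_0 z Hz)).
  rewrite !Cmod_wronskian_quotient, Cmod_plus_wronskian_S, Cmod_theta_disc_S
    by auto using Im_Copp_Cinv_pos.
  rewrite ln_mult, ln_pow, Rpow_mult_distr, <- exp_mult_INR by auto using pow_lt.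
  rewrite Rmult_comm, <- Rmult_assoc, <- exp_plus, Rmult_comm.
  f_equal. f_equal. simpl INR. ring.
Qed.

Lemma ln_Cmod_theta_disc_bound (z : C) : 3 / 4 <= Im z ->
  Rabs (ln (Cmod (theta_disc z)) + PI / 2 * Im z) <= ln 5.
Proof.
  intros Hz. destruct (theta_disc_bounds z Hz) as [Hge Hle].
  assert (Hr := exp_pos (- (PI / 2 * Im z))).
  assert (Hd : 0 < Cmod (theta_disc z)) by lra.
  apply ln_le in Hge; [|lra]. apply ln_le in Hle; [|exact Hd].
  rewrite ln_mult, ln_exp, ln_Rinv in Hge by lra. rewrite ln_mult, ln_exp in Hle by lra.
  assert (Hln := ln_le 2 5 Rlt_0_2 ltac:(lra)). apply Rabs_le. lra.
Qed.

Lemma wronskian_quotient_decay : exists K, forall z, 3 / 4 <= Im z ->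
  Cmod (wronskian_quotient z) <= K * exp (- (2 * PI * Im z)).
Proof.
  destruct (q_expansion_bounded (wronskian (parity_part true f) (parity_part false f))
              (A + B) (3 / 16)) as [K [HK Hbound]]; [..|lra|].
  - apply holo_on_H_wronskian; auto using holo_on_H_parity_part, periodic_on_H_parity_part.
  - apply periodic_on_H_wronskian; auto using holo_on_H_parity_part, periodic_on_H_parity_part.
  - apply fcoef_wronskian_low; auto using holo_on_H_parity_part, periodic_on_H_parity_part.
  - set (p := IZR (2 * t + 3)). exists ((/ 4 * K) ^ 12 * exp (4 * Rabs p * ln 5)). intros z Hz.
    rewrite Cmod_wronskian_quotient by lra. fold p.
    assert (HW : Cmod (plus_wronskian z)
                 <= / 4 * K * exp (- (2 * PI * IZR (A + B) * (/ 4 * Im z)))).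
    { rewrite plus_wronskian_eq, Cmod_mult, Cmod_R, Rabs_pos_eq, Rmult_assoc by lra.
      apply Rmult_le_compat_l; [lra|]. rewrite <- im_scal_l. apply Hbound. rewrite im_scal_l. lra. }
    apply (conj (Cmod_ge_0 (plus_wronskian z))), (pow_incr _ _ 12) in HW.
    rewrite Rpow_mult_distr, <- (exp_mult_INR _ 12) in HW.
    set (l := ln (Cmod (theta_disc z))) in *.
    assert (Hl := ln_Cmod_theta_disc_bound z Hz). fold l in Hl.
    assert (Hexp : - (4 * p * l) <= 4 * Rabs p * ln 5 + p * (2 * PI * Im z)).
    { assert (Hpl : - (p * (l + PI / 2 * Im z)) <= Rabs p * ln 5).
      { eapply Rle_trans; [apply Rle_abs|]. rewrite Rabs_Ropp, Rabs_mult.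
        apply Rmult_le_compat_l; [apply Rabs_pos|exact Hl]. }
      lra. }
    apply (Rle_trans _ ((/ 4 * K) ^ 12 * exp (- (2 * PI * IZR (A + B) * (/ 4 * Im z)) * INR 12)
             * exp (4 * Rabs p * ln 5 + p * (2 * PI * Im z)))).
    + apply Rmult_le_compat;
        [apply pow_le, Cmod_ge_0|left; apply exp_pos|exact HW|apply exp_le, Hexp].
    + rewrite !Rmult_assoc, <- !exp_plus. apply Rmult_le_compat_l; [apply pow_le; lra|].
      apply exp_le.
      assert (Hi : p + 1 <= 3 * IZR (A + B)).
      { unfold p. rewrite <- mult_IZR, <- plus_IZR. apply IZR_le. lia. }
      assert (Hy : 0 < 2 * PI * Im z) by (assert (HPI := PI_RGT_0); nra).
      apply (Rmult_le_compat_r (2 * PI * Im z)) in Hi; [|lra]. simpl INR. lra.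
Qed.

Lemma plus_wronskian_eq_0 (z : C) : 0 < Im z -> plus_wronskian z = RtoC 0.
Proof.
  intros Hz. destruct wronskian_quotient_decay as [K HK].
  assert (E := weight_zero_eq_0 wronskian_quotient K holo_on_H_wronskian_quotient
    periodic_on_H_wronskian_quotient Cmod_wronskian_quotient_S HK z Hz).
  apply NNPP. intros N. revert E. apply Cmult_neq_0; [apply Cpow_nz, N|].
  apply Czpow_neq_0, Cpow_nz, theta_disc_neq_0, Hz.
Qed.

Lemma leading_coefs_eq_0 : A <> B ->
  fcoef (parity_part true f) A = RtoC 0 \/ fcoef (parity_part false f) B = RtoC 0.
Proof.
  intros NAB. apply Cmult_integral.
  assert (E : fcoef (wronskian (parity_part true f) (parity_part false f)) (A + B) = RtoC 0).
  { rewrite (fcoef_ext _ (fun _ => RtoC 0)); [apply fcoef_0|]. intros z Hz.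
    assert (E := plus_wronskian_eq_0 (RtoC 4 * z)). rewrite plus_wronskian_eq in E
      by (rewrite im_scal_l; lra).
    replace (RtoC (/ 4) * (RtoC 4 * z))%C with z in E by (rewrite RtoC_inv by lra; field).
    assert (H4z : 0 < Im (RtoC 4 * z)) by (rewrite im_scal_l; lra).
    destruct (Cmult_integral _ _ (E H4z)) as [Equarter|Equarter]; [|exact Equarter].
    exfalso. apply RtoC_inj in Equarter. lra. }
  rewrite fcoef_wronskian_leading in E by
    auto using holo_on_H_parity_part, periodic_on_H_parity_part.
  apply Cmult_integral in E. destruct E as [E|E]; [exfalso|exact E].
  apply Cmult_integral in E. destruct E as [E|E]; [exact (C2PIi_neq_0 E)|].
  apply RtoC_inj, eq_IZR in E. lia.
Qed.

End ZeroEstimate.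

End PlusForm.

Lemma exists_first_nonzero_coef (g : C -> C) (B : Z) :
  (forall n, (n < B)%Z -> fcoef g n = RtoC 0) ->
  (exists n, fcoef g n <> RtoC 0) ->
  exists A, (B <= A)%Z /\ fcoef g A <> RtoC 0 /\ forall n, (n < A)%Z -> fcoef g n = RtoC 0.
Proof.
  intros HB [n Hn].
  destruct (dec_inh_nat_subset_has_unique_least_element
              (fun k => fcoef g (B + Z.of_nat k) <> RtoC 0)) as [k [[Hk Hmin] _]].
  - intros k. apply classic.
  - exists (Z.to_nat (n - B)).
    rewrite Z2Nat.id; [replace (B + (n - B))%Z with n by ring; exact Hn|].
    destruct (Z_lt_le_dec n B) as [Hlt|Hlt]; [destruct (Hn (HB n Hlt))|lia].
  - exists (B + Z.of_nat k)%Z. split; [lia|]. split; [exact Hk|]. intros m Hm.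
    destruct (Z_lt_le_dec m B) as [Hlt|Hlt]; [apply HB, Hlt|]. apply NNPP. intros Nm.
    specialize (Hmin (Z.to_nat (m - B))). rewrite Z2Nat.id in Hmin by lia.
    replace (B + (m - B))%Z with m in Hmin by ring. specialize (Hmin Nm). lia.
Qed.

Lemma exists_parity_part_coef (t : Z) (f : C -> C) (b : bool) : plus_form t f ->
  (exists n, fcoef f n <> RtoC 0) -> exists n, fcoef (parity_part b f) n <> RtoC 0.
Proof.
  intros Hf [n Hn]. apply NNPP. intros N. apply Hn.
  rewrite (fcoef_ext f (fun _ => RtoC 0)); [apply fcoef_0|]. intros z Hz.
  apply (plus_form_eq_0_of_parity_part t f Hf b); [|exact Hz].
  apply eq_of_fcoef; [apply (holo_on_H_parity_part t), Hf|apply (periodic_on_H_parity_part t), Hf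
                     |apply holo_on_H_const|intros w _; reflexivity|].
  intros k. rewrite fcoef_0. apply NNPP. intros Nk. apply N. exists k. exact Nk.
Qed.

Lemma exists_leading_parity_coef (t : Z) (f : C -> C) (b : bool) (A : Z) : plus_form t f ->
  (exists n, fcoef f n <> RtoC 0) ->
  (forall n, Z.even n = b -> (n < A)%Z -> fcoef f n = RtoC 0) ->
  exists n, (A <= n)%Z /\ Z.even n = b /\ fcoef (parity_part b f) n <> RtoC 0 /\
            forall k, (k < n)%Z -> fcoef (parity_part b f) k = RtoC 0.
Proof.
  intros Hf Hne HA. assert (Hcoef := fcoef_parity_part t f Hf b).
  destruct (exists_first_nonzero_coef (parity_part b f) A) as [n [Hn [Nn Hlow]]].
  - intros k Hk. rewrite Hcoef. destruct (Bool.eqb (Z.even k) b) eqn:E; [|reflexivity].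
    apply HA; [apply Bool.eqb_prop, E|exact Hk].
  - apply (exists_parity_part_coef t); assumption.
  - exists n. repeat split; try assumption. rewrite Hcoef in Nn.
    destruct (Bool.eqb (Z.even n) b) eqn:E; [apply Bool.eqb_prop, E|destruct (Nn eq_refl)].
Qed.

Theorem plus_form_eq_0 (t : Z) (f : C -> C) (b : bool) (A B : Z) : plus_form t f ->
  (forall n, Z.even n = b -> (n < A)%Z -> fcoef f n = RtoC 0) ->
  (forall n, Z.even n = negb b -> (n < B)%Z -> fcoef f n = RtoC 0) ->
  (2 * t + 3 < 3 * (A + B))%Z -> forall n, fcoef f n = RtoC 0.
Proof.
  intros Hf HA HB Hw n. apply NNPP. intros Nn.
  assert (Hne : exists n, fcoef f n <> RtoC 0) by (exists n; exact Nn).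
  destruct (exists_leading_parity_coef t f b A Hf Hne HA) as [A' [HAA [EA [NA LA]]]].
  destruct (exists_leading_parity_coef t f (negb b) B Hf Hne HB) as [B' [HBB [EB [NB LB]]]].
  assert (NAB : A' <> B') by (intros E; rewrite E, EB in EA; destruct b; discriminate).
  destruct b.
  - destruct (leading_coefs_eq_0 t f Hf A' B' LA LB) as [E|E];
      [lia|exact NAB|exact (NA E)|exact (NB E)].
  - destruct (leading_coefs_eq_0 t f Hf B' A' LB LA) as [E|E];
      [lia|congruence|exact (NB E)|exact (NA E)].
Qed.

(** * Linear combinations of plus forms *)

(* The solution of [\sum_(j <= n + 1) p j * c j = 0] that extends [d], when [p (n + 1) <> 0]. *)
Definition back_substitute (p d : nat -> C) (n k : nat) : C :=
  if Nat.eq_dec k (S n) then (- Csum (fun j => p j * d j) n / p (S n))%C else d k.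

Lemma Csum_back_substitute (a p d : nat -> C) (n : nat) : p (S n) <> RtoC 0 ->
  Csum (fun j => a j * back_substitute p d n j)%C (S n)
  = Csum (fun j => (a j - a (S n) / p (S n) * p j) * d j)%C n.
Proof.
  intros Np. rewrite Csum_S, (Csum_ext _ (fun j => a j * d j)%C).
  - unfold back_substitute. destruct (Nat.eq_dec (S n) (S n)) as [_|]; [|congruence].
    rewrite (Csum_ext (fun j => (a j - a (S n) / p (S n) * p j) * d j)%C
      (fun j => a j * d j + - (a (S n) / p (S n)) * (p j * d j))%C) by (intros; ring).
    rewrite Csum_plus, Csum_scal. field. exact Np.
  - intros k Hk. unfold back_substitute. destruct (Nat.eq_dec k (S n)); [lia|reflexivity].
Qed.

Lemma homogeneous_system (rows : list (nat -> C)) :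
  exists c : nat -> C, (exists j, (j <= length rows)%nat /\ c j <> RtoC 0) /\
    forall a, In a rows -> Csum (fun j => a j * c j)%C (length rows) = RtoC 0.
Proof.
  remember (length rows) as n eqn:En. revert rows En. induction n as [|n IH]; intros rows En.
  - exists (fun _ => RtoC 1). split; [exists O; split; [lia|apply C1_nz]|].
    intros a Ha. destruct rows; [destruct Ha|discriminate].
  - destruct (classic (exists p, In p rows /\ p (S n) <> RtoC 0)) as [[p [Hp Np]]|Nopivot].
    + apply in_split in Hp. destruct Hp as [rows1 [rows2 ->]].
      rewrite length_app in En. simpl in En.
      destruct (IH (map (fun a j => a j - a (S n) / p (S n) * p j)%C (rows1 ++ rows2)))
        as [d [[j [Hj Nj]] Hd]]; [rewrite length_map, length_app; lia|].
      exists (back_substitute p d n). split.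
      * exists j. split; [lia|]. unfold back_substitute.
        destruct (Nat.eq_dec j (S n)); [lia|exact Nj].
      * intros a Ha. rewrite Csum_back_substitute by exact Np. apply in_app_or in Ha.
        destruct (classic (a = p)) as [->|Nap]; [apply Csum_eq_0; intros k _; field; exact Np|].
        apply (Hd (fun j => a j - a (S n) / p (S n) * p j)%C), in_map_iff.
        exists a. split; [reflexivity|]. apply in_or_app.
        destruct Ha as [Ha|[Ha|Ha]]; [left; exact Ha|congruence|right; exact Ha].
    + exists (fun j => if Nat.eq_dec j (S n) then RtoC 1 else RtoC 0). split.
      * exists (S n). split; [lia|]. destruct (Nat.eq_dec (S n) (S n)); [apply C1_nz|congruence].
      * intros a Ha. apply Csum_eq_0. intros j _. destruct (Nat.eq_dec j (S n)) as [->|]; [|ring].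
        rewrite Cmult_1_r. apply NNPP. intros Na. apply Nopivot. exists a. split; assumption.
Qed.

Lemma transforms_like_theta_Csum (t : Z) (f : nat -> C -> C) (c : nat -> C) (n : nat) :
  (forall j, (j <= n)%nat -> transforms_like_theta t (f j)) ->
  transforms_like_theta t (fun z => Csum (fun j => c j * f j z)%C n).
Proof.
  intros Hf a b c' d Hg z Hz. rewrite <- Csum_scal. apply Csum_ext. intros j Hj.
  rewrite (Hf j Hj a b c' d Hg z Hz). ring.
Qed.

Section LinearCombination.

Variables (t : Z) (f : nat -> C -> C) (c : nat -> C) (n : nat).
Hypothesis Hf : forall j, (j <= n)%nat -> plus_form t (f j).

Lemma fcoef_linear_combination (m : Z) :
  fcoef (fun z => Csum (fun j => c j * f j z)%C n) m = Csum (fun j => c j * fcoef (f j) m)%C n.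
Proof.
  rewrite (fcoef_Csum (fun j z => c j * f j z)%C).
  - apply Csum_ext. intros j Hj.
    apply fcoef_scal; [apply (Hf j Hj)|apply (plus_form_periodic t), Hf, Hj].
  - intros j Hj. apply holo_on_H_scal, (Hf j Hj).
  - intros j Hj. apply periodic_on_H_scal, (plus_form_periodic t), Hf, Hj.
Qed.

Lemma plus_form_linear_combination : plus_form t (fun z => Csum (fun j => c j * f j z)%C n).
Proof.
  split; [|split].
  - apply (holo_on_H_Csum (fun j z => c j * f j z)%C). intros j Hj. apply holo_on_H_scal, (Hf j Hj).
  - apply transforms_like_theta_Csum. intros j Hj. apply (Hf j Hj).
  - intros m Hm. rewrite fcoef_linear_combination. apply Csum_eq_0. intros j Hj.
    rewrite (proj2 (proj2 (Hf j Hj)) m Hm). ring.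
Qed.

End LinearCombination.

(** * Indices of canonical basis elements *)

Lemma even_mod_4 (n n' : Z) : (n mod 4 = n' mod 4)%Z -> Z.even n = Z.even n'.
Proof.
  intros H. assert (E := Zmod_even n). assert (E' := Zmod_even n').
  destruct (Z.even n), (Z.even n'); try reflexivity; Z.div_mod_to_equations; lia.
Qed.

Lemma plus_okb_congr (t n n' : Z) : (n mod 4 = n' mod 4)%Z -> plus_okb t n = plus_okb t n'.
Proof.
  intros H. apply Bool.eq_true_iff_eq. rewrite !plus_okb_mod_4, H, (even_mod_4 n n' H). reflexivity.
Qed.

Lemma plus_okb_same_parity (t n n' : Z) : plus_okb t n = true -> plus_okb t n' = true ->
  Z.even n = Z.even n' -> (n mod 4 = n' mod 4)%Z.
Proof. rewrite !plus_okb_mod_4. intros -> -> ->. reflexivity. Qed.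

Lemma admissibleb_progression (t i : Z) (j : nat) :
  admissibleb t i = true -> admissibleb t (i + 4 * Z.of_nat j) = true.
Proof.
  unfold admissibleb. rewrite !Bool.andb_true_iff, !Z.leb_le. intros [Hle Hok]. split; [lia|].
  rewrite <- Hok. apply plus_okb_congr. rewrite Z.mul_comm. apply Z_mod_plus_full.
Qed.

Lemma even_progression (i : Z) (j : nat) : Z.even (i + 4 * Z.of_nat j) = Z.even i.
Proof. rewrite Z.even_add, Z.even_mul. destruct (Z.even i); reflexivity. Qed.

Lemma qualb_progression (t m i : Z) (j : nat) :
  admissibleb t i = true -> Z.even i = negb (Z.even m) -> qualb t m (i + 4 * Z.of_nat j) = true.
Proof.
  intros Hi Hpar. unfold qualb. rewrite admissibleb_progression by exact Hi.
  apply Bool.negb_true_iff, Z.eqb_neq. intros E. apply even_mod_4 in E.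
  rewrite even_progression, Hpar in E. destruct (Z.even m); discriminate.
Qed.

Section CanonicalBasis.

Variables (t : Z) (f : Z -> C -> C).
Hypothesis Hf : forall i, admissibleb t i = true -> canonical t i (f i).

Section BasisCombination.

Variables (i0 : Z) (c : nat -> C) (L : nat).
Hypothesis Hi0 : admissibleb t i0 = true.

Lemma canonical_progression (j : nat) :
  canonical t (i0 + 4 * Z.of_nat j) (f (i0 + 4 * Z.of_nat j)%Z).
Proof. apply Hf, admissibleb_progression, Hi0. Qed.

Definition basis_combination (z : C) : C := Csum (fun j => c j * f (i0 + 4 * Z.of_nat j)%Z z)%C L.

Lemma plus_form_progression (j : nat) : plus_form t (f (i0 + 4 * Z.of_nat j)%Z).
Proof. apply in_Mshriek_plus_form, canonical_progression. Qed.

Lemma plus_form_basis_combination : plus_form t basis_combination.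
Proof.
  apply (plus_form_linear_combination t (fun j => f (i0 + 4 * Z.of_nat j)%Z)).
  intros j _. apply plus_form_progression.
Qed.

Lemma fcoef_basis_combination (n : Z) :
  fcoef basis_combination n = Csum (fun j => c j * fcoef (f (i0 + 4 * Z.of_nat j)%Z) n)%C L.
Proof.
  apply (fcoef_linear_combination t (fun j => f (i0 + 4 * Z.of_nat j)%Z)).
  intros j _. apply plus_form_progression.
Qed.

Lemma fcoef_basis_combination_low (n : Z) : (n <= Nk t)%Z ->
  (forall j, (j <= L)%nat -> n <> (- (i0 + 4 * Z.of_nat j))%Z) ->
  fcoef basis_combination n = RtoC 0.
Proof.
  intros Hn Hne. rewrite fcoef_basis_combination. apply Csum_eq_0. intros j Hj.
  destruct (canonical_progression j) as [_ [_ Hvan]]. rewrite Hvan by auto. ring.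
Qed.

Lemma fcoef_basis_combination_principal (i : nat) : (i <= L)%nat ->
  fcoef basis_combination (- (i0 + 4 * Z.of_nat i)) = c i.
Proof.
  intros Hi. rewrite fcoef_basis_combination, (Csum_single _ L i Hi).
  - destruct (canonical_progression i) as [_ [Hlead _]]. rewrite Hlead. ring.
  - intros j _ Nj. destruct (canonical_progression j) as [_ [_ Hvan]].
    assert (Hle := proj1 (andb_prop _ _ Hi0)). apply Z.leb_le in Hle. rewrite Hvan by lia. ring.
Qed.

End BasisCombination.

Lemma exists_vanishing_combination (n0 i0 : Z) (L : nat) : admissibleb t i0 = true ->
  exists c : nat -> C, (exists i, (i <= L)%nat /\ c i <> RtoC 0) /\
    forall l, (l < L)%nat -> fcoef (basis_combination i0 c L) (n0 + 4 * Z.of_nat l) = RtoC 0.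
Proof.
  intros Hi0.
  set (row := fun (l j : nat) => fcoef (f (i0 + 4 * Z.of_nat j)%Z) (n0 + 4 * Z.of_nat l)).
  destruct (homogeneous_system (map row (seq 0 L))) as [c [Hc Hrows]].
  rewrite length_map, length_seq in Hc, Hrows. exists c. split; [exact Hc|]. intros l Hl.
  rewrite fcoef_basis_combination by exact Hi0.
  rewrite (Csum_ext _ (fun j => row l j * c j)%C) by (intros j _; apply Cmult_comm).
  apply Hrows, in_map, in_seq. lia.
Qed.

(* If a combination vanishing at the exponents [n0, n0 + 4, ..., m - 4] also vanishes at [m], then
   all its coefficients of the parity of [m] below [m + 4] vanish, and those of the other parity
   below [- (i0 + 4 L)]. *)
Lemma canonical_basis_vanishing_bound (m n0 i0 : Z) (L : nat) :
  admissibleb t i0 = true -> plus_okb t m = true -> Z.even i0 = negb (Z.even m) ->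
  (n0 <= Nk t + 4)%Z -> m = (n0 + 4 * Z.of_nat L)%Z ->
  (forall j, (j <= L)%nat -> fcoef (f (i0 + 4 * Z.of_nat j)%Z) m = RtoC 0) ->
  (3 * (n0 - i0 + 4) <= 2 * t + 3)%Z.
Proof.
  intros Hi0 Hm Hpar Hn0 HL Hvan. apply Z.nlt_ge. intros Hw.
  destruct (exists_vanishing_combination n0 i0 L Hi0) as [c [[i [Hi Ni]] Hc]].
  assert (Hform := plus_form_basis_combination i0 c L Hi0).
  assert (Hle := proj1 (andb_prop _ _ Hi0)). apply Z.leb_le in Hle.
  apply Ni. rewrite <- (fcoef_basis_combination_principal i0 c L Hi0 i Hi).
  apply (plus_form_eq_0 t _ (Z.even m) (m + 4) (- (i0 + 4 * Z.of_nat L))); [exact Hform|..].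
  - intros n En Hn. destruct (plus_okb t n) eqn:Hok; [|apply Hform, Hok].
    assert (Hnm := plus_okb_same_parity t n m Hok Hm En).
    destruct (Z_le_gt_dec n (Nk t)) as [Hlow|Hhigh].
    + apply fcoef_basis_combination_low; [exact Hi0|exact Hlow|]. intros j _ E.
      apply (f_equal Z.even) in E. rewrite Z.even_opp, even_progression, Hpar, En in E.
      destruct (Z.even m); discriminate.
    + assert (El : n = (n0 + 4 * Z.of_nat (Z.to_nat ((n - n0) / 4)))%Z)
        by (Z.div_mod_to_equations; lia).
      set (l := Z.to_nat ((n - n0) / 4)) in El. rewrite El.
      assert (Hl : (l < L \/ l = L)%nat) by lia. destruct Hl as [Hl| ->]; [apply Hc, Hl|].
      rewrite <- HL, fcoef_basis_combination by exact Hi0.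
      apply Csum_eq_0. intros j Hj. rewrite Hvan by exact Hj. ring.
  - intros n _ Hn. apply fcoef_basis_combination_low; [exact Hi0|lia|]. intros j Hj. lia.
  - lia.
Qed.

End CanonicalBasis.

Lemma Nk_translate (t a : Z) : Nk (t - 12 * a) = (Nk t - 4 * a)%Z.
Proof.
  assert (Em : ((t - 12 * a) mod 6 = t mod 6)%Z).
  { replace (t - 12 * a)%Z with (t + (- 2 * a) * 6)%Z by ring. apply Z_mod_plus_full. }
  assert (Ek : kp_half (t - 12 * a) = kp_half t) by (unfold kp_half; rewrite Em; reflexivity).
  assert (Ee : Z.even (t - 12 * a) = Z.even t).
  { replace (t - 12 * a)%Z with (t + 2 * (- 6 * a))%Z by ring. apply Z.even_add_mul_2. }
  assert (El : ell (t - 12 * a) = (ell t + 2 * (- a))%Z).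
  { unfold ell. rewrite Ek.
    replace (t - 12 * a - kp_half t)%Z with (t - kp_half t + (- 2 * a) * 6)%Z by ring.
    rewrite Z_div_plus_full by lia. ring. }
  unfold Nk. rewrite Ee, El, Z.even_add_mul_2. destruct (Z.even (ell t)); ring.
Qed.

Lemma length_filter_seq_bound (p : nat -> bool) (L s : nat) :
  (forall k, p k = true -> p (S (S k)) = false) ->
  (2 * length (filter p (seq s L)) <= L + 4)%nat.
Proof.
  intros Hp. revert s. induction L as [L IH] using lt_wf_ind. intros s.
  destruct (Nat.lt_ge_cases L 4) as [HL|HL].
  - assert (Hlen := filter_length_le p (seq s L)). rewrite length_seq in Hlen. lia.
  - replace L with (4 + (L - 4))%nat by lia. rewrite seq_app, filter_app, length_app.
    assert (Hlen := IH (L - 4)%nat ltac:(lia) (s + 4)%nat).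
    assert (Hfour : (length (filter p (seq s 4)) <= 2)%nat); [|lia].
    simpl. destruct (p s) eqn:Es; destruct (p (S s)) eqn:ESs;
      rewrite ?(Hp _ Es), ?(Hp _ ESs); simpl;
      destruct (p (S (S s))), (p (S (S (S s)))); simpl; lia.
Qed.

Lemma plus_okb_add_2 (t n : Z) : plus_okb t n = true -> plus_okb t (n + 2) = false.
Proof.
  intros H. apply Bool.not_true_is_false. intros H'. rewrite plus_okb_mod_4 in H, H'.
  rewrite Z.even_add in H'. simpl in H'.
  destruct (Z.even n); simpl in *; Z.div_mod_to_equations; lia.
Qed.

Lemma rank_bound (t m i : Z) : (- Nk t <= i)%Z -> (2 * Z.of_nat (rank t m i) <= i + Nk t + 4)%Z.
Proof.
  intros Hi. unfold rank.
  set (qual := fun k => qualb t m (- Nk t + Z.of_nat k)). set (L := Z.to_nat (i + Nk t)).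
  cut (2 * length (filter qual (seq 0 L)) <= L + 4)%nat; [unfold L; lia|].
  apply length_filter_seq_bound. unfold qual. intros k Hk. unfold qualb, admissibleb in *.
  apply andb_prop, proj1, andb_prop, proj2, plus_okb_add_2 in Hk.
  replace (- Nk t + Z.of_nat (S (S k)))%Z with (- Nk t + Z.of_nat k + 2)%Z by lia.
  rewrite Hk, Bool.andb_false_r. reflexivity.
Qed.

(** * The first exponent and the first index *)

Definition first_exponent (t m : Z) : Z := (Nk t + 1 + (m - Nk t - 1) mod 4)%Z.

(* The least admissible index of parity opposite to [m]. *)
Definition first_index (t m : Z) : Z :=
  (- Nk t + ((if Z.even m then if Z.even t then 3 else 1 else 0) + Nk t) mod 4)%Z.

Lemma first_exponent_bounds (t m : Z) : (Nk t < first_exponent t m <= Nk t + 4)%Z.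
Proof. unfold first_exponent. Z.div_mod_to_equations. lia. Qed.

Lemma exists_exponent_progression (t m : Z) : (Nk t < m)%Z ->
  exists L : nat, m = (first_exponent t m + 4 * Z.of_nat L)%Z.
Proof.
  intros Hm. exists (Z.to_nat ((m - first_exponent t m) / 4)).
  unfold first_exponent. Z.div_mod_to_equations. lia.
Qed.

Lemma first_index_spec (t m : Z) : (- Nk t <= first_index t m <= - Nk t + 3)%Z
  /\ admissibleb t (first_index t m) = true /\ Z.even (first_index t m) = negb (Z.even m).
Proof.
  set (r := (if Z.even m then if Z.even t then 3 else 1 else 0)%Z).
  assert (Hr : (first_index t m mod 4 = r mod 4)%Z)
    by (unfold first_index; fold r; Z.div_mod_to_equations; lia).
  assert (Hle : (- Nk t <= first_index t m <= - Nk t + 3)%Z)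
    by (unfold first_index; Z.div_mod_to_equations; lia).
  assert (Hev : Z.even (first_index t m) = negb (Z.even m)).
  { rewrite (even_mod_4 _ _ Hr). unfold r. destruct (Z.even m), (Z.even t); reflexivity. }
  split; [exact Hle|]. split; [|exact Hev]. unfold admissibleb. apply andb_true_intro.
  split; [apply Z.leb_le; lia|]. rewrite plus_okb_mod_4, Hr, Hev, Z.even_sub.
  unfold r. destruct (Z.even m), (Z.even t); reflexivity.
Qed.

Lemma first_exponent_translate (t a m : Z) :
  first_exponent (t - 12 * a) m = (first_exponent t m - 4 * a)%Z.
Proof. unfold first_exponent. rewrite Nk_translate. Z.div_mod_to_equations. lia. Qed.

Lemma first_index_translate (t a m : Z) :
  first_index (t - 12 * a) m = (first_index t m + 4 * a)%Z.
Proof.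
  unfold first_index. replace (Z.even (t - 12 * a)) with (Z.even t)
    by (rewrite Z.even_sub, Z.even_mul; destruct (Z.even t); reflexivity).
  rewrite Nk_translate. Z.div_mod_to_equations. lia.
Qed.

Lemma first_exponent_mod_4 (t m : Z) : first_exponent t (m mod 4) = first_exponent t m.
Proof. unfold first_exponent. Z.div_mod_to_equations. lia. Qed.

Lemma first_index_mod_4 (t m : Z) : first_index t (m mod 4) = first_index t m.
Proof.
  unfold first_index. rewrite (even_mod_4 (m mod 4) m); [reflexivity|apply Z.mod_mod; discriminate].
Qed.

Definition weight_lt_gap (t m : Z) : bool :=
  (2 * t + 3 <? 3 * (first_exponent t m - first_index t m + 4))%Z.

Lemma weight_lt_gap_b_range_check :
  forallb (fun b => forallb (fun m => implb (plus_okb (1 - b) m) (weight_lt_gap (1 - b) m))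
                      (0 :: 1 :: 2 :: 3 :: nil)%Z) b_range = true.
Proof. vm_compute. reflexivity. Qed.

Lemma weight_lt_gap_b_range (a b m : Z) : let t := (1 - (12 * a + b))%Z in
  In b b_range -> plus_okb t m = true ->
  (2 * t + 3 < 3 * (first_exponent t m - first_index t m + 4))%Z.
Proof.
  intros t Hb Hm. replace t with (1 - b - 12 * a)%Z in * by (unfold t; ring).
  rewrite first_exponent_translate, first_index_translate.
  assert (Hok : plus_okb (1 - b) (m mod 4) = true).
  { rewrite (plus_okb_congr _ _ m) by (apply Z.mod_mod; discriminate).
    rewrite plus_okb_mod_4 in *. rewrite Hm, (Z.even_sub (1 - b)), Z.even_mul.
    destruct (Z.even m), (Z.even (1 - b)); reflexivity. }
  assert (Hcheck := proj1 (forallb_forall _ _) weight_lt_gap_b_range_check b Hb).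
  rewrite forallb_forall in Hcheck. specialize (Hcheck (m mod 4)%Z). cbv beta in Hcheck.
  rewrite Hok in Hcheck.
  unfold weight_lt_gap in Hcheck. rewrite first_exponent_mod_4, first_index_mod_4 in Hcheck.
  simpl implb in Hcheck. rewrite Z.ltb_lt in Hcheck.
  assert (Hmod := Z.mod_pos_bound m 4 eq_refl).
  assert (Hgap : (2 * (1 - b) + 3
                     < 3 * (first_exponent (1 - b) m - first_index (1 - b) m + 4))%Z)
    by (apply Hcheck; simpl; lia). lia.
Qed.

Lemma Nk_b_range_check :
  forallb (fun b => (-8 <=? Nk (1 - b))%Z && (Nk (1 - b) <=? 0)%Z)%bool b_range = true.
Proof. vm_compute. reflexivity. Qed.

Lemma Nk_b_range (a b : Z) : In b b_range -> (-8 - 4 * a <= Nk (1 - (12 * a + b)) <= - 4 * a)%Z.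
Proof.
  intros Hb. assert (Hcheck := proj1 (forallb_forall _ _) Nk_b_range_check b Hb).
  apply andb_prop in Hcheck. rewrite !Z.leb_le in Hcheck.
  replace (1 - (12 * a + b))%Z with (1 - b - 12 * a)%Z by ring. rewrite Nk_translate. lia.
Qed.

Lemma rank_progression_lt (a b m M : Z) (j : nat) : let t := (1 - (12 * a + b))%Z in
  In b b_range -> (23 - 4 * a <= m)%Z -> (12 * a + 3 * m + 2 * b - 7 < 4 * M)%Z ->
  (first_exponent t m + 4 * Z.of_nat j <= m)%Z ->
  (Z.of_nat (rank t m (first_index t m + 4 * Z.of_nat j)) < M)%Z.
Proof.
  intros t Hb Hm HM Hj.
  assert (Hb_ge : (6 <= b)%Z) by (unfold b_range in Hb; simpl in Hb; lia).
  assert (HN := Nk_b_range a b Hb). fold t in HN.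
  assert (Hn := first_exponent_bounds t m). assert (Hi := proj1 (first_index_spec t m)).
  assert (Hrank := rank_bound t m (first_index t m + 4 * Z.of_nat j)). lia.
Qed.

Lemma plus_okb_of_residue (s m : Z) :
  (m mod 4 = 0)%Z \/ (m mod 4 = if Z.even (s - 1) then 1 else 3)%Z -> plus_okb (1 - s) m = true.
Proof.
  intros H. replace (1 - s)%Z with (- (s - 1))%Z by ring. rewrite plus_okb_mod_4, Z.even_opp.
  assert (P := Zmod_even m). destruct (Z.even m), (Z.even (s - 1)); Z.div_mod_to_equations; lia.
Qed.

Lemma Cconst_le (m b : Z) : Cconst m b <= 7 / 4.
Proof.
  unfold Cconst. destruct (Z.even m); [destruct (Z.even b)|destruct (existsb _ _)]; lra.
Qed.

Theorem theorem1p4 :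
  exists A B : R, 0 < A /\ A <= 9 /\ 0 < B /\ B <= 109 /\
  forall s a b : Z, s = (12 * a + b)%Z -> In b b_range ->
  forall m : Z, A * IZR (Z.abs a) + B <= IZR m ->
    ((m mod 4 = 0)%Z \/ (m mod 4 = if Z.even (s - 1) then 1 else 3)%Z) ->
  forall f : Z -> C -> C,
    (forall i : Z, admissibleb (1 - s) i = true -> canonical (1 - s) i (f i)) ->
  forall M : Z,
    3 * IZR a + 3 * IZR m / 4 + IZR b / 2 - Cconst m b < IZR M ->
    ~ (forall i : Z, qualb (1 - s) m i = true ->
         (Z.of_nat (rank (1 - s) m i) < M)%Z ->
         fcoef (f i) m = RtoC 0).
Proof.
  exists 9, 109. repeat (split; [lra|]).
  intros s a b -> Hb m Hm Hmod f Hf M HM Hvan. set (t := (1 - (12 * a + b))%Z) in *.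
  assert (HmZ : (9 * Z.abs a + 109 <= m)%Z) by (apply le_IZR; rewrite plus_IZR, mult_IZR; exact Hm).
  assert (HMZ : (12 * a + 3 * m + 2 * b - 7 < 4 * M)%Z).
  { apply lt_IZR. rewrite minus_IZR, !plus_IZR, !mult_IZR. assert (HC := Cconst_le m b). lra. }
  assert (Hok : plus_okb t m = true) by apply plus_okb_of_residue, Hmod.
  destruct (first_index_spec t m) as [_ [Hadm Hpar]].
  destruct (exists_exponent_progression t m) as [L HL].
  { assert (HN := Nk_b_range a b Hb). fold t in HN. lia. }
  apply (proj1 (Z.lt_nge _ _) (weight_lt_gap_b_range a b m Hb Hok)).
  apply (canonical_basis_vanishing_bound t f Hf m _ _ L Hadm Hok Hpar); [|exact HL|].
  - apply first_exponent_bounds.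
  - intros j Hj. apply Hvan; [apply qualb_progression; assumption|].
    apply (rank_progression_lt a b); [exact Hb|lia|exact HMZ|fold t; lia].
Qed.
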